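(* Let $f$ be a transcendental entire function in the Eremenko–Lyubich class $\mathcal{B}$. If $f$ has a finite logarithmic asymptotic value, then $I(f)$ is not a spider's web.
   Context: $f^n$ denotes the $n$-th iterate of $f$; $I(f) := \{z\in\mathbb{C} : f^n(z)\to\infty\}$ is the escaping set. The class $\mathcal{B}$ consists of transcendental entire functions whose set of singular values (critical values and asymptotic values, i.e. points at which some inverse branch cannot be defined) is bounded. Write $B(a,r)=\{z:|z-a|<r\}$. A value $\alpha\in\mathbb{C}$ is a finite logarithmic asymptotic value of $f$ if there exist $r>0$ and a component $U$ of $f^{-1}(B(\alpha,r))$ such that $f:U\to B(\alpha,r)\setminus\{\alpha\}$ is a universal covering. A connected set $E\subset\mathbb{C}$ is a spider's web if there is a sequence $(G_n)_{n\in\mathbb{N}}$ of bounded simply connected domains with $\partial G_n\subset E$, $G_n\subset G_{n+1}$ for all $n$, and $\bigcup_n G_n=\mathbb{C}$. *)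

(* Defs.v *)
From Stdlib Require Import Reals.
From Coquelicot Require Import Coquelicot.
Open Scope R_scope.

Definition disk (a : C) (r : R) : C -> Prop := fun z => Cmod (z - a) < r.

Definition entire (f : C -> C) : Prop :=
  forall z : C, @ex_derive C_AbsRing C_NormedModule f z.

Definition is_polynomial (f : C -> C) : Prop :=
  exists (n : nat) (a : nat -> C),
    forall z : C, f z = sum_n (fun k => mult (a k) (pow_n z k)) n.

Definition transcendental_entire (f : C -> C) : Prop :=
  entire f /\ ~ is_polynomial f.

Fixpoint iter (n : nat) (f : C -> C) (z : C) : C :=
  match n with O => z | S m => f (iter m f z) end.

Definition escaping_set (f : C -> C) : C -> Prop :=
  fun z => is_lim_seq (fun n => Cmod (iter n f z)) p_infty.

Definition critical_value (f : C -> C) (w : C) : Prop :=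
  exists z : C, f z = w /\ @is_derive C_AbsRing C_NormedModule f z (RtoC 0).

(** w is an asymptotic value: there is a curve gamma : [0,oo) -> C with
    gamma(t) -> oo and f(gamma(t)) -> w as t -> +oo.  (The curve is given
    on all of R and continuous everywhere; any curve on [0,oo) extends.) *)
Definition asymptotic_value (f : C -> C) (w : C) : Prop :=
  exists gamma : R -> C,
    (forall t : R, continuous gamma t) /\
    filterlim (fun t => Cmod (gamma t)) (Rbar_locally p_infty) (Rbar_locally p_infty) /\
    filterlim (fun t => f (gamma t)) (Rbar_locally p_infty) (locally w).

Definition closure_set (A : C -> Prop) : C -> Prop :=
  fun z => forall e : R, 0 < e -> exists y, A y /\ Cmod (y - z) < e.

Definition singular_values (f : C -> C) : C -> Prop :=
  closure_set (fun w => critical_value f w \/ asymptotic_value f w).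

Definition bounded_set (A : C -> Prop) : Prop :=
  exists M : R, forall z, A z -> Cmod z <= M.

Definition classB (f : C -> C) : Prop :=
  transcendental_entire f /\ bounded_set (singular_values f).

Definition connected_set (E : C -> Prop) : Prop :=
  ~ exists O1 O2 : C -> Prop,
      open O1 /\ open O2 /\
      (forall z, E z -> O1 z \/ O2 z) /\
      (exists z, E z /\ O1 z) /\ (exists z, E z /\ O2 z) /\
      (forall z, E z -> O1 z -> O2 z -> False).

Definition component_of (U A : C -> Prop) : Prop :=
  (exists z, U z) /\ connected_set U /\ (forall z, U z -> A z) /\
  forall V : C -> Prop, connected_set V -> (forall z, U z -> V z) ->
    (forall z, V z -> A z) -> forall z, V z -> U z.

Definition domain (G : C -> Prop) : Prop :=
  open G /\ (exists z, G z) /\ connected_set G.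

(** Simple connectivity: every closed curve in U is null-homotopic in U
    (free homotopy of loops through loops to a constant loop).
    Curves/homotopies are given on R resp. R x R and continuous everywhere;
    by precomposing with the clamp to [0,1] this is equivalent to
    continuity on [0,1] resp. [0,1]^2. *)
Definition simply_connected (U : C -> Prop) : Prop :=
  forall gamma : R -> C,
    (forall t, continuous gamma t) ->
    (forall t, 0 <= t <= 1 -> U (gamma t)) ->
    gamma 0 = gamma 1 ->
    exists H : R -> R -> C,
      (forall p : R * R, continuous (fun q : R * R => H (fst q) (snd q)) p) /\
      (forall s t, 0 <= s <= 1 -> 0 <= t <= 1 -> U (H s t)) /\
      (forall t, 0 <= t <= 1 -> H 0 t = gamma t) /\
      (forall t, 0 <= t <= 1 -> H 1 t = H 1 0) /\
      (forall s, 0 <= s <= 1 -> H s 0 = H s 1).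

Definition homeo_onto (f : C -> C) (S V : C -> Prop) : Prop :=
  (forall z, S z -> V (f z)) /\
  (forall z1 z2, S z1 -> S z2 -> f z1 = f z2 -> z1 = z2) /\
  (forall w, V w -> exists z, S z /\ f z = w) /\
  (forall z, S z -> filterlim f (within S (locally z)) (locally (f z))) /\
  exists g : C -> C,
    (forall w, V w -> S (g w) /\ f (g w) = w) /\
    (forall w, V w -> filterlim g (within V (locally w)) (locally (g w))).

Definition covering_map (f : C -> C) (U W : C -> Prop) : Prop :=
  (forall z, U z -> W (f z)) /\
  (forall w, W w -> exists z, U z /\ f z = w) /\
  (forall z, U z -> filterlim f (within U (locally z)) (locally (f z))) /\
  forall w, W w -> exists V : C -> Prop,
    open V /\ V w /\ (forall y, V y -> W y) /\
    exists sheets : (C -> Prop) -> Prop,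
      (forall S, sheets S -> open S /\ (forall z, S z -> U z) /\ homeo_onto f S V) /\
      (forall S1 S2, sheets S1 -> sheets S2 ->
         (exists z, S1 z /\ S2 z) -> forall z, S1 z <-> S2 z) /\
      (forall z, U z -> V (f z) -> exists S, sheets S /\ S z).

Definition universal_covering (f : C -> C) (U W : C -> Prop) : Prop :=
  covering_map f U W /\ connected_set U /\ simply_connected U.

Definition finite_log_asymptotic_value (f : C -> C) (alpha : C) : Prop :=
  exists (r : R) (U : C -> Prop),
    0 < r /\ component_of U (fun z => disk alpha r (f z)) /\
    universal_covering f U (fun w => disk alpha r w /\ w <> alpha).

Definition boundary (G : C -> Prop) : C -> Prop :=
  fun z => closure_set G z /\ ~ G z.

Definition spiders_web (E : C -> Prop) : Prop :=
  connected_set E /\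
  exists G : nat -> C -> Prop,
    (forall n, domain (G n) /\ bounded_set (G n) /\ simply_connected (G n)) /\
    (forall n z, boundary (G n) z -> E z) /\
    (forall n z, G n z -> G (S n) z) /\
    (forall z, exists n, G n z).

(* Main.v *)
Require Import Defs.
From Stdlib Require Import Reals Lra Lia List Classical ClassicalEpsilon.
From Coquelicot Require Import Coquelicot.

(** Let [U] be the tract over the logarithmic asymptotic value [alpha].  All that matters is
    that [U] is a component of the preimage of [B(alpha, r)], that [f] omits [alpha] on [U],
    and that [f(U)] is the whole punctured disc.

    If [G] is a bounded open set containing a large disc, then
    [W = B(alpha, r') \ f(U /\ closure G)] is an open neighbourhood of [alpha] whose boundary
    lies in [f(U /\ boundary G)].  Conversely, let [W] be a bounded neighbourhood of [alpha]
    containing an escaping point [z].  Logarithmic lifts of [exp] through [f o exp] over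
    [|w| > R0] exist because there are no singular values there, and their images contain no
    large disc, since [U] is connected and unbounded and [f] is bounded on it; by Bloch's
    theorem they contract strongly near infinity.  Hence some [f^j(W)] contains a circle
    [|w| = rho] with [rho] as large as we like, and [G = f^j(W) \/ B(0, rho)] is again a
    bounded open set containing a large disc, with [boundary G] in [f^j(boundary W)].

    If the escaping set were a spider's web, then [alpha] would be a limit of escaping points,
    and alternating the two constructions from a loop [boundary G_n] of the web would give
    nested nonempty compact subsets of that loop whose points return to [B(alpha, r)] more and
    more often; a common point of these sets lies on the loop but does not escape.

    The complex analysis is derived from Goursat's theorem in logarithmic coordinates, which
    directly yields the mean value property and hence the maximum principle. *)

(** * Elementary complex analysis *)

(** The topology is kept to openness, compactness and one fact: a bounded open neighbourhood of
    [alpha] has a nonempty boundary. Since each construction traces boundary points back to boundary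
    points, every compact set of starting points on the loop is nonempty.

    The disc [B(0,rho)] is filled in because expansion yields only a circle inside [f^j(W)]. A set
    containing a large disc has points of [U] over the whole circle [|w - alpha| = r'], which
    therefore carries no boundary point of the next neighbourhood: all its boundary points come from
    [f].

    For the contraction, a lift is only known to be holomorphic, not injective, and this is why
    Bloch's theorem is used rather than Koebe's. The discs to be excluded have radius [PI]: a circle
    about 0 that is large enough meets the unbounded connected set [U], and its logarithm is made of
    vertical segments of length [2 * PI]. On [U] the function [f] is bounded by [R0], whereas
    [f o exp] exceeds [R0] on the image of a lift.

    Local theory is obtained without power series: dividing by finitely many zeros and applying the
    maximum principle gives Cauchy estimates, a quadratic Taylor bound and the isolation of
    zeros. *)

Lemma choice (A B : Type) (Q : A -> B -> Prop) :
  (forall x, exists y, Q x y) -> exists g, forall x, Q x (g x).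
Proof.
  intros H. exists (fun x => proj1_sig (constructive_indefinite_description _ (H x))).
  intros x. apply proj2_sig.
Qed.

Arguments choice {A B} Q _.

Lemma Cmod_sub_sym (x y : C) : Cmod (x - y) = Cmod (y - x).
Proof. rewrite <- (Cmod_opp (y - x)). f_equal. ring. Qed.

Lemma Cmod_sub_tri (x y z : C) : Cmod (x - z) <= Cmod (x - y) + Cmod (y - z).
Proof. replace (x - z)%C with ((x - y) + (y - z))%C by ring. apply Cmod_triangle. Qed.

Lemma Cmod_sub_self (x : C) : Cmod (x - x) = 0.
Proof. replace (x - x)%C with (RtoC 0) by ring. apply Cmod_0. Qed.

Lemma Cmod_sub_ge (x y : C) : Cmod x - Cmod y <= Cmod (x - y).
Proof. pose proof (Cmod_triangle (x - y) y) as H.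
  replace (x - y + y)%C with x in H by ring. lra. Qed.

Lemma Csub_eq_0 (x y : C) : (x - y)%C = 0 -> x = y.
Proof. intros H. replace x with ((x - y) + y)%C by ring. rewrite H. ring. Qed.

Lemma Cmod_sub_pos (x y : C) : x <> y -> 0 < Cmod (x - y).
Proof. intros H. apply Cmod_gt_0. intros E. apply H, Csub_eq_0, E. Qed.

Lemma Cmod_sub_lt_eps_eq (x y : C) : (forall e, 0 < e -> Cmod (x - y) <= e) -> x = y.
Proof.
  intros H. destruct (classic (x = y)) as [E | E]; auto.
  pose proof (Cmod_sub_pos x y E) as P. specialize (H (Cmod (x - y) / 2)). lra.
Qed.

Lemma Cmod_fst_le (z : C) : Rabs (fst z) <= Cmod z.
Proof. apply Rle_trans with (2 := Rmax_Cmod z). apply Rmax_l. Qed.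

Lemma Cmod_snd_le (z : C) : Rabs (snd z) <= Cmod z.
Proof. apply Rle_trans with (2 := Rmax_Cmod z). apply Rmax_r. Qed.

Lemma Cmod_le_sum (z : C) : Cmod z <= Rabs (fst z) + Rabs (snd z).
Proof.
  destruct z as [x y]; simpl.
  replace ((x, y) : C) with (RtoC x + Ci * RtoC y)%C
    by (unfold Ci, RtoC, Cplus, Cmult; simpl; f_equal; ring).
  eapply Rle_trans. apply Cmod_triangle.
  rewrite Cmod_mult, Cmod_R, Cmod_R.
  replace (Cmod Ci) with 1. lra.
  unfold Cmod, Ci; simpl. replace (0 * (0 * 1) + 1 * (1 * 1)) with 1 by ring.
  symmetry; apply sqrt_1.
Qed.

Lemma open_Cmod (G : C -> Prop) :
  open G <-> forall z, G z -> exists e, 0 < e /\ forall y, Cmod (y - z) < e -> G y.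
Proof.
  split.
  - intros H z Gz. specialize (H z Gz). apply locally_C in H. destruct H as [e He].
    exists e. split. apply cond_pos. intros y Hy. apply He. exact Hy.
  - intros H z Gz. apply locally_C. destruct (H z Gz) as [e [e0 He]].
    exists (mkposreal e e0). intros y Hy. apply He. exact Hy.
Qed.

(** * Continuity and complex differentiability *)

Definition ccont (f : C -> C) (z : C) : Prop :=
  forall e, 0 < e -> exists d, 0 < d /\ forall y, Cmod (y - z) < d -> Cmod (f y - f z) < e.

(* Caratheodory's form of complex differentiability: the difference quotient extends
   continuously, which makes the rules of calculus purely algebraic. *)
Definition cdiff (f : C -> C) (z l : C) : Prop :=
  exists phi, ccont phi z /\ phi z = l /\
    exists d, 0 < d /\ forall y, Cmod (y - z) < d -> f y = (f z + phi y * (y - z))%C.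

Definition holo (f : C -> C) (z : C) : Prop := exists l, cdiff f z l.

Lemma ccont_const c z : ccont (fun _ => c) z.
Proof. intros e He. exists 1. split. lra. intros. rewrite Cmod_sub_self. auto. Qed.

Lemma ccont_id z : ccont (fun y => y) z.
Proof. intros e He. exists e. split; auto. Qed.

Lemma ccont_ext_loc f g z d : 0 < d -> (forall y, Cmod (y - z) < d -> f y = g y) ->
  ccont f z -> ccont g z.
Proof.
  intros Hd E H e He. destruct (H e He) as [d' [Hd' H']].
  exists (Rmin d d'). split. apply Rmin_glb_lt; auto.
  intros y Hy. rewrite <- (E y), <- (E z).
  - apply H'. eapply Rlt_le_trans. apply Hy. apply Rmin_r.
  - rewrite Cmod_sub_self; auto.
  - eapply Rlt_le_trans. apply Hy. apply Rmin_l.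
Qed.

Lemma ccont_plus f g z : ccont f z -> ccont g z -> ccont (fun y => f y + g y)%C z.
Proof.
  intros Hf Hg e He.
  destruct (Hf (e / 2)) as [d1 [Hd1 H1]]. lra.
  destruct (Hg (e / 2)) as [d2 [Hd2 H2]]. lra.
  exists (Rmin d1 d2). split. apply Rmin_glb_lt; auto.
  intros y Hy.
  assert (Cmod (y - z) < d1) by (eapply Rlt_le_trans; [apply Hy | apply Rmin_l]).
  assert (Cmod (y - z) < d2) by (eapply Rlt_le_trans; [apply Hy | apply Rmin_r]).
  replace (f y + g y - (f z + g z))%C with ((f y - f z) + (g y - g z))%C by ring.
  eapply Rle_lt_trans. apply Cmod_triangle.
  specialize (H1 y ltac:(auto)). specialize (H2 y ltac:(auto)). lra.
Qed.

Lemma ccont_mult f g z : ccont f z -> ccont g z -> ccont (fun y => f y * g y)%C z.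
Proof.
  intros Hf Hg e He.
  set (A := Cmod (f z)). set (B := Cmod (g z)).
  assert (0 <= A) by apply Cmod_ge_0. assert (0 <= B) by apply Cmod_ge_0.
  set (k := Rmin 1 (e / (A + B + 2))).
  assert (Hq : 0 < e / (A + B + 2)) by (apply Rdiv_lt_0_compat; lra).
  assert (Hk : 0 < k) by (apply Rmin_glb_lt; lra).
  assert (Hk1 : k <= 1) by apply Rmin_l.
  assert (Hk2 : k * (A + B + 2) <= e).
  { replace e with (e / (A + B + 2) * (A + B + 2)) by (field; lra).
    apply Rmult_le_compat_r. lra. apply Rmin_r. }
  destruct (Hf k Hk) as [d1 [Hd1 H1]]. destruct (Hg k Hk) as [d2 [Hd2 H2]].
  exists (Rmin d1 d2). split. apply Rmin_glb_lt; auto.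
  intros y Hy.
  assert (P1 : Cmod (y - z) < d1) by (eapply Rlt_le_trans; [apply Hy | apply Rmin_l]).
  assert (P2 : Cmod (y - z) < d2) by (eapply Rlt_le_trans; [apply Hy | apply Rmin_r]).
  specialize (H1 y P1). specialize (H2 y P2).
  replace (f y * g y - f z * g z)%C
    with ((f y - f z) * (g y - g z) + ((f y - f z) * g z + f z * (g y - g z)))%C by ring.
  eapply Rle_lt_trans. apply Cmod_triangle.
  eapply Rle_lt_trans. apply Rplus_le_compat_l, Cmod_triangle.
  rewrite !Cmod_mult. fold A B.
  pose proof (Cmod_ge_0 (f y - f z)). pose proof (Cmod_ge_0 (g y - g z)).
  assert (Cmod (f y - f z) * Cmod (g y - g z) <= k * 1) by (apply Rmult_le_compat; lra).
  assert (Cmod (f y - f z) * B <= k * B) by (apply Rmult_le_compat_r; lra).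
  assert (A * Cmod (g y - g z) <= A * k) by (apply Rmult_le_compat_l; lra).
  nra.
Qed.

Lemma ccont_comp f g z : ccont g z -> ccont f (g z) -> ccont (fun y => f (g y)) z.
Proof.
  intros Hg Hf e He. destruct (Hf e He) as [d [Hd H]]. destruct (Hg d Hd) as [d' [Hd' H']].
  exists d'. split; auto.
Qed.

Lemma ccont_neq_0 f z : ccont f z -> f z <> 0 ->
  exists d, 0 < d /\ forall y, Cmod (y - z) < d -> Cmod (f z) / 2 < Cmod (f y).
Proof.
  intros H N. apply Cmod_gt_0 in N.
  destruct (H (Cmod (f z) / 2)) as [d [Hd H']]. lra.
  exists d. split; auto. intros y Hy. specialize (H' y Hy).
  pose proof (Cmod_sub_ge (f z) (f y)). rewrite Cmod_sub_sym in H0. lra.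
Qed.

Lemma ccont_inv f z : ccont f z -> f z <> 0 -> ccont (fun y => / f y)%C z.
Proof.
  intros H N e He. destruct (ccont_neq_0 f z H N) as [d [Hd H1]].
  assert (P : 0 < Cmod (f z)) by (apply Cmod_gt_0; auto).
  destruct (H (e * (Cmod (f z) * Cmod (f z)) / 2)) as [d' [Hd' H2]].
  { apply Rdiv_lt_0_compat; [|lra]. apply Rmult_lt_0_compat; auto. apply Rmult_lt_0_compat; auto. }
  exists (Rmin d d'). split. apply Rmin_glb_lt; auto.
  intros y Hy.
  assert (P1 : Cmod (y - z) < d) by (eapply Rlt_le_trans; [apply Hy | apply Rmin_l]).
  assert (P2 : Cmod (y - z) < d') by (eapply Rlt_le_trans; [apply Hy | apply Rmin_r]).
  specialize (H1 y P1). specialize (H2 y P2).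
  assert (Ny : f y <> 0) by (apply Cmod_gt_0; lra).
  replace (/ f y - / f z)%C with ((f z - f y) * (/ f y * / f z))%C by (field; auto).
  rewrite !Cmod_mult, !Cmod_inv, (Cmod_sub_sym (f z)) by auto.
  apply (Rmult_lt_reg_r (Cmod (f y) * Cmod (f z))). nra.
  replace (Cmod (f y - f z) * (/ Cmod (f y) * / Cmod (f z)) * (Cmod (f y) * Cmod (f z)))
    with (Cmod (f y - f z)) by (field; split; lra).
  assert (Q : 0 < e * Cmod (f z)) by (apply Rmult_lt_0_compat; auto).
  nra.
Qed.

Lemma cdiff_ccont f z l : cdiff f z l -> ccont f z.
Proof.
  intros [phi [Hp [E [d [Hd H]]]]].
  apply (ccont_ext_loc (fun y => f z + phi y * (y + - z))%C f z d Hd).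
  - intros y Hy. symmetry. rewrite (H y Hy). reflexivity.
  - apply (ccont_plus (fun _ => f z)). apply ccont_const.
    apply (ccont_mult phi); auto. apply (ccont_plus (fun y => y)).
    apply ccont_id. apply ccont_const.
Qed.

Lemma holo_ccont f z : holo f z -> ccont f z.
Proof. intros [l H]. apply (cdiff_ccont f z l H). Qed.

Lemma cdiff_ext_loc f g z l d : 0 < d -> (forall y, Cmod (y - z) < d -> f y = g y) ->
  cdiff f z l -> cdiff g z l.
Proof.
  intros Hd E [phi [Hp [El [d' [Hd' H]]]]].
  exists phi. split; auto. split; auto. exists (Rmin d d').
  split. apply Rmin_glb_lt; auto. intros y Hy. rewrite <- (E y), <- (E z).
  - apply H. eapply Rlt_le_trans. apply Hy. apply Rmin_r.
  - rewrite Cmod_sub_self; auto.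
  - eapply Rlt_le_trans. apply Hy. apply Rmin_l.
Qed.

Lemma holo_ext_loc f g z d : 0 < d -> (forall y, Cmod (y - z) < d -> f y = g y) ->
  holo f z -> holo g z.
Proof. intros Hd E [l H]. exists l. apply (cdiff_ext_loc f g z l d); auto. Qed.

Lemma cdiff_const c z : cdiff (fun _ => c) z 0.
Proof. exists (fun _ => RtoC 0). split. apply ccont_const. split; auto.
  exists 1. split. lra. intros. ring. Qed.

Lemma cdiff_id z : cdiff (fun y => y) z 1.
Proof. exists (fun _ => RtoC 1). split. apply ccont_const. split; auto.
  exists 1. split. lra. intros. ring. Qed.

Lemma cdiff_plus f g z l m : cdiff f z l -> cdiff g z m ->
  cdiff (fun y => f y + g y)%C z (l + m).
Proof.
  intros [p [Hp [Ep [d [Hd H]]]]] [q [Hq [Eq [d' [Hd' H']]]]].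
  exists (fun y => p y + q y)%C. split. apply ccont_plus; auto. split. congruence.
  exists (Rmin d d'). split. apply Rmin_glb_lt; auto. intros y Hy.
  rewrite (H y), (H' y).
  - ring.
  - eapply Rlt_le_trans. apply Hy. apply Rmin_r.
  - eapply Rlt_le_trans. apply Hy. apply Rmin_l.
Qed.

Lemma cdiff_mult f g z l m : cdiff f z l -> cdiff g z m ->
  cdiff (fun y => f y * g y)%C z (l * g z + f z * m).
Proof.
  intros Hf [q [Hq [Eq [d' [Hd' H']]]]].
  pose proof (cdiff_ccont _ _ _ Hf) as Cf.
  destruct Hf as [p [Hp [Ep [d [Hd H]]]]].
  exists (fun y => p y * g z + f y * q y)%C. split.
  { apply (ccont_plus (fun y => p y * g z)%C). apply ccont_mult; auto. apply ccont_const.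
    apply ccont_mult; auto. } split. congruence.
  exists (Rmin d d'). split. apply Rmin_glb_lt; auto. intros y Hy.
  rewrite (H' y).
  2:{ eapply Rlt_le_trans. apply Hy. apply Rmin_r. }
  assert (E := H y ltac:(eapply Rlt_le_trans; [apply Hy | apply Rmin_l])).
  replace (p y * g z * (y - z))%C with (g z * (f y - f z))%C by (rewrite E; ring).
  replace ((p y * g z + f y * q y) * (y - z))%C
    with (g z * (p y * (y - z)) + f y * q y * (y - z))%C by ring.
  replace (p y * (y - z))%C with (f y - f z)%C by (rewrite E; ring). ring.
Qed.

Lemma cdiff_comp f g z l m : cdiff g z l -> cdiff f (g z) m ->
  cdiff (fun y => f (g y)) z (m * l).
Proof.
  intros Hg [q [Hq [Eq [d' [Hd' H']]]]].
  pose proof (cdiff_ccont _ _ _ Hg) as Cg.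
  destruct Hg as [p [Hp [Ep [d [Hd H]]]]].
  exists (fun y => q (g y) * p y)%C. split.
  { apply ccont_mult; auto. apply ccont_comp; auto. } split. congruence.
  destruct (Cg d' Hd') as [d2 [Hd2 H2]].
  exists (Rmin d d2). split. apply Rmin_glb_lt; auto. intros y Hy.
  rewrite (H' (g y)). 2:{ apply H2. eapply Rlt_le_trans. apply Hy. apply Rmin_r. }
  assert (E := H y ltac:(eapply Rlt_le_trans; [apply Hy | apply Rmin_l])).
  replace (q (g y) * p y * (y - z))%C with (q (g y) * (p y * (y - z)))%C by ring.
  replace (p y * (y - z))%C with (g y - g z)%C by (rewrite E; ring). reflexivity.
Qed.

Lemma cdiff_inv f z l : cdiff f z l -> f z <> 0 ->
  cdiff (fun y => / f y)%C z (- l / (f z * f z)).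
Proof.
  intros Hf N. pose proof (cdiff_ccont _ _ _ Hf) as Cf.
  destruct Hf as [p [Hp [Ep [d [Hd H]]]]].
  exists (fun y => (- (1) * p y) * / (f z * f y))%C. split.
  { apply (ccont_mult (fun y => - (1) * p y)%C). apply ccont_mult; auto. apply ccont_const.
    apply (ccont_inv (fun y => f z * f y)%C). apply ccont_mult; auto. apply ccont_const.
    apply Cmult_neq_0; auto. }
  split. { rewrite Ep. field. auto. }
  destruct (ccont_neq_0 f z Cf N) as [d2 [Hd2 H2]].
  exists (Rmin d d2). split. apply Rmin_glb_lt; auto. intros y Hy.
  assert (Ny : f y <> 0).
  { apply Cmod_gt_0. eapply Rlt_trans. 2: apply H2; eapply Rlt_le_trans; [apply Hy|apply Rmin_r].
    apply Cmod_gt_0 in N. lra. }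
  assert (E := H y ltac:(eapply Rlt_le_trans; [apply Hy | apply Rmin_l])).
  replace (- (1) * p y * / (f z * f y) * (y - z))%C
    with (- (p y * (y - z)) * / (f z * f y))%C by (field; auto).
  replace (p y * (y - z))%C with (f y - f z)%C by (rewrite E; ring).
  field. auto.
Qed.

Lemma cdiff_unique f z l m : cdiff f z l -> cdiff f z m -> l = m.
Proof.
  intros [p [Hp [Ep [d [Hd H]]]]] [q [Hq [Eq [d' [Hd' H']]]]].
  apply Cmod_sub_lt_eps_eq. intros e He.
  destruct (Hp (e / 2) ltac:(lra)) as [d1 [Hd1 H1]].
  destruct (Hq (e / 2) ltac:(lra)) as [d2 [Hd2 H2]].
  set (t := Rmin (Rmin d d') (Rmin d1 d2) / 2).
  assert (B : 0 < Rmin (Rmin d d') (Rmin d1 d2)) by (repeat apply Rmin_glb_lt; auto).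
  assert (Ht : Cmod ((z + RtoC t) - z) = t).
  { replace (z + RtoC t - z)%C with (RtoC t) by ring. rewrite Cmod_R.
    apply Rabs_pos_eq. unfold t. lra. }
  assert (K1 := Rmin_l (Rmin d d') (Rmin d1 d2)). assert (K2 := Rmin_r (Rmin d d') (Rmin d1 d2)).
  assert (K3 := Rmin_l d d'). assert (K4 := Rmin_r d d').
  assert (K5 := Rmin_l d1 d2). assert (K6 := Rmin_r d1 d2).
  set (y := (z + RtoC t)%C) in *.
  assert (Et : t = Rmin (Rmin d d') (Rmin d1 d2) / 2) by reflexivity.
  clearbody t.
  assert (Y1 : Cmod (y - z) < d) by lra. assert (Y2 : Cmod (y - z) < d') by lra.
  assert (Y3 : Cmod (y - z) < d1) by lra. assert (Y4 : Cmod (y - z) < d2) by lra.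
  assert (E : p y = q y).
  { assert (Q := H y Y1). rewrite (H' y Y2) in Q.
    assert (Ny : (y - z)%C <> 0) by (apply Cmod_gt_0; lra).
    apply Csub_eq_0. replace (p y - q y)%C with (((f z + p y * (y - z)) - (f z + q y * (y - z))) / (y - z))%C
      by (field; auto). rewrite Q. field. auto. }
  specialize (H1 y Y3). specialize (H2 y Y4). rewrite Ep in H1. rewrite Eq, <- E in H2.
  pose proof (Cmod_sub_tri l (p y) m) as Tr. rewrite (Cmod_sub_sym l (p y)) in Tr. lra.
Qed.

Lemma holo_plus f g z : holo f z -> holo g z -> holo (fun y => f y + g y)%C z.
Proof. intros [l H] [m K]. eexists. apply cdiff_plus; eauto. Qed.
Lemma holo_mult f g z : holo f z -> holo g z -> holo (fun y => f y * g y)%C z.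
Proof. intros [l H] [m K]. eexists. apply cdiff_mult; eauto. Qed.
Lemma holo_comp f g z : holo g z -> holo f (g z) -> holo (fun y => f (g y)) z.
Proof. intros [l H] [m K]. eexists. eapply cdiff_comp; eauto. Qed.
Lemma holo_inv f z : holo f z -> f z <> 0 -> holo (fun y => / f y)%C z.
Proof. intros [l H] N. eexists. apply cdiff_inv; eauto. Qed.
Lemma holo_const c z : holo (fun _ => c) z.
Proof. eexists. apply cdiff_const. Qed.
Lemma holo_id z : holo (fun y => y) z.
Proof. eexists. apply cdiff_id. Qed.
Lemma holo_pow f n z : holo f z -> holo (fun y => Cpow (f y) n) z.
Proof. intros H. induction n; simpl. apply holo_const. apply holo_mult; auto. Qed.

Lemma cdiff_bound f z l : cdiff f z l -> forall e, 0 < e -> exists d, 0 < d /\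
  forall y, Cmod (y - z) < d -> Cmod (f y - f z - l * (y - z)) <= e * Cmod (y - z).
Proof.
  intros [p [Hp [Ep [d [Hd H]]]]] e He. destruct (Hp e He) as [d1 [Hd1 H1]].
  exists (Rmin d d1). split. apply Rmin_glb_lt; auto. intros y Hy.
  rewrite (H y). 2:{ eapply Rlt_le_trans; [apply Hy | apply Rmin_l]. }
  replace (f z + p y * (y - z) - f z - l * (y - z))%C with ((p y - p z) * (y - z))%C
    by (rewrite Ep; ring).
  rewrite Cmod_mult. apply Rmult_le_compat_r. apply Cmod_ge_0.
  left. apply H1. eapply Rlt_le_trans; [apply Hy | apply Rmin_r].
Qed.

Lemma cdiff_of_bound f z l : (forall e, 0 < e -> exists d, 0 < d /\
  forall y, Cmod (y - z) < d -> Cmod (f y - f z - l * (y - z)) <= e * Cmod (y - z)) ->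
  cdiff f z l.
Proof.
  intros H.
  (* The slope function is the difference quotient, completed by [l] at [z]. *)
  exists (fun y => if excluded_middle_informative (y = z) then l else ((f y - f z) / (y - z))%C).
  split; [|split].
  - intros e He. destruct (H (e / 2)) as [d [Hd H']]. lra.
    exists d. split; auto. intros y Hy.
    destruct (excluded_middle_informative (z = z)); [|tauto].
    destruct (excluded_middle_informative (y = z)) as [E | E].
    + rewrite Cmod_sub_self. auto.
    + pose proof (Cmod_sub_pos y z E). specialize (H' y Hy).
      assert (N : (y - z)%C <> 0) by (apply Cmod_gt_0; auto).
      replace ((f y - f z) / (y - z) - l)%C with ((f y - f z - l * (y - z)) * / (y - z))%C
        by (field; auto).
      rewrite Cmod_mult, Cmod_inv by auto.
      apply (Rmult_lt_reg_r (Cmod (y - z))); auto.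
      rewrite Rmult_assoc, Rinv_l by lra. nra.
  - destruct (excluded_middle_informative (z = z)); tauto.
  - exists 1. split. lra. intros y _. destruct (excluded_middle_informative (y = z)) as [E | E].
    + subst. ring.
    + field. intros N. apply E, Csub_eq_0, N.
Qed.

(** Carries the derivatives in [entire] to [cdiff], and back again for [critical_value]. *)
Lemma cdiff_is_derive f z l : @is_derive C_AbsRing C_NormedModule f z l <-> cdiff f z l.
Proof.
  assert (E : forall y, minus (minus (f y) (f z)) (scal (minus y z) l)
    = (f y - f z - l * (y - z))%C :> C).
  { intros y. unfold minus, plus, opp, scal; simpl. unfold mult; simpl. ring. }
  split.
  - intros H. apply cdiff_of_bound. intros e He.
    destruct H as [_ H]. specialize (H z (fun P Q => Q) (mkposreal e He)).
    destruct H as [d Hd]. exists d. split. apply cond_pos.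
    intros y Hy. specialize (Hd y Hy). rewrite <- E. exact Hd.
  - intros H. split. apply is_linear_scal_l.
    intros x Hx e.
    assert (Ex : z = x) by (apply (@is_filter_lim_locally_unique C_AbsRing (AbsRing_NormedModule C_AbsRing)); exact Hx).
    subst x.
    destruct (cdiff_bound f z l H e (cond_pos e)) as [d [Hd Hb]].
    exists (mkposreal d Hd). intros y Hy. specialize (Hb y Hy). rewrite <- E in Hb. exact Hb.
Qed.

Lemma entire_holo f : entire f -> forall z, holo f z.
Proof. intros H z. destruct (H z) as [l Hl]. exists l. apply cdiff_is_derive, Hl. Qed.

(** * Cluster points of bounded sequences *)

Lemma bounded_real_seq_cluster (u : nat -> R) (M : R) : (forall n, Rabs (u n) <= M) ->
  exists l, forall e N, 0 < e -> exists n, (N <= n)%nat /\ Rabs (u n - l) < e.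
Proof.
  intros H. destruct (Bolzano_Weierstrass u (fun x => - M <= x <= M)) as [l Hl].
  - apply compact_P3.
  - intros n. apply Rabs_le_between, H.
  - exists l. intros e N He. destruct (Hl (disc l (mkposreal e He)) N) as [p Hp].
    exists (mkposreal e He). intros x Hx. exact Hx.
    exists p. exact Hp.
Qed.

Lemma bounded_seq_cluster (u : nat -> C) (M : R) : (forall n, Cmod (u n) <= M) ->
  exists z, forall e N, 0 < e -> exists n, (N <= n)%nat /\ Cmod (u n - z) < e.
Proof.
  intros H.
  destruct (bounded_real_seq_cluster (fun n => fst (u n)) M) as [x Hx].
  { intros n. eapply Rle_trans. apply Cmod_fst_le. apply H. }
  (* Indices [p n >= n] along which the real parts converge to [x]; the imaginary parts along them
     then cluster at some [y]. *)
  assert (S : forall n : nat, exists m, (n <= m)%nat /\ Rabs (fst (u m) - x) < / (INR n + 1)).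
  { intros n. apply Hx. apply Rinv_0_lt_compat. pose proof (pos_INR n). lra. }
  apply (choice (fun n m => (n <= m)%nat /\ Rabs (fst (u m) - x) < / (INR n + 1))) in S.
  destruct S as [p Hp].
  destruct (bounded_real_seq_cluster (fun n => snd (u (p n))) M) as [y Hy].
  { intros n. eapply Rle_trans. apply Cmod_snd_le. apply H. }
  exists (x, y). intros e N He.
  destruct (archimed_cor1 (e / 2)) as [k [Hk Hk0]]. lra.
  destruct (Hy (e / 2) (max N k)) as [n [Hn1 Hn2]]. lra.
  destruct (Hp n) as [Q1 Q2]. exists (p n). split. lia.
  eapply Rle_lt_trans. apply Cmod_le_sum. simpl.
  assert (/ (INR n + 1) < / INR k).
  { apply Rinv_lt_contravar. apply Rmult_lt_0_compat. apply lt_0_INR; lia.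
    pose proof (pos_INR n); lra. pose proof (le_INR k n ltac:(lia)). lra. }
  change (Rabs (fst (u (p n)) - x) + Rabs (snd (u (p n)) - y) < e). lra.
Qed.

(** * Exponential *)

Definition cexp (z : C) : C := (exp (fst z) * cos (snd z), exp (fst z) * sin (snd z)).

Lemma cexp_plus z w : cexp (z + w) = (cexp z * cexp w)%C.
Proof.
  unfold cexp, Cmult, Cplus; simpl. rewrite exp_plus, cos_plus, sin_plus. f_equal; ring.
Qed.

Lemma Cmod_cexp z : Cmod (cexp z) = exp (fst z).
Proof.
  unfold Cmod, cexp; simpl.
  replace (exp (fst z) * cos (snd z) * (exp (fst z) * cos (snd z) * 1) +
   exp (fst z) * sin (snd z) * (exp (fst z) * sin (snd z) * 1))
    with (exp (fst z) * exp (fst z) * (Rsqr (sin (snd z)) + Rsqr (cos (snd z))))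
    by (unfold Rsqr; ring).
  rewrite sin2_cos2, Rmult_1_r. apply sqrt_square. left. apply exp_pos.
Qed.

Lemma cexp_neq_0 z : cexp z <> 0.
Proof. apply Cmod_gt_0. rewrite Cmod_cexp. apply exp_pos. Qed.

Lemma cexp_period z : cexp (z + (0, 2 * PI)) = cexp z.
Proof.
  unfold cexp, Cplus; simpl. rewrite Rplus_0_r, cos_plus, sin_plus, cos_2PI, sin_2PI.
  f_equal; ring.
Qed.

Lemma derivable_pt_lim_0_bound f l : derivable_pt_lim f 0 l -> forall e, 0 < e ->
  exists d, 0 < d /\ forall x, Rabs x < d -> Rabs (f x - f 0 - l * x) <= e * Rabs x.
Proof.
  intros H e He. destruct (H e He) as [d Hd]. exists d. split. apply cond_pos.
  intros x Hx. destruct (Req_dec x 0) as [E | E].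
  - subst. rewrite Rmult_0_r, Rminus_0_r. unfold Rminus. rewrite Rplus_opp_r, Rabs_R0. lra.
  - specialize (Hd x E Hx). rewrite Rplus_0_l in Hd.
    replace (f x - f 0 - l * x) with (((f x - f 0) / x - l) * x) by (field; auto).
    rewrite Rabs_mult. apply Rmult_le_compat_r. apply Rabs_pos. lra.
Qed.

Lemma cexp_bound_0 e : 0 < e -> exists d, 0 < d /\
  forall h, Cmod h < d -> Cmod (cexp h - 1 - h) <= e * Cmod h.
Proof.
  (* The four error products below cost [1 + 2 + 3 + 2 = 8] multiples of [k * Cmod h], hence the
     ninth. *)
  intros He. set (k := Rmin 1 (e / 9)).
  assert (Hk : 0 < k) by (apply Rmin_glb_lt; lra).
  assert (Hk1 : k <= 1) by apply Rmin_l. assert (Hk2 : k <= e / 9) by apply Rmin_r.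
  clearbody k.
  destruct (derivable_pt_lim_0_bound exp 1 derivable_pt_lim_exp_0 k Hk) as [d1 [Hd1 H1]].
  destruct (derivable_pt_lim_0_bound sin 1 derivable_pt_lim_sin_0 k Hk) as [d2 [Hd2 H2]].
  destruct (derivable_pt_lim_0_bound cos 0 derivable_pt_lim_cos_0 k Hk) as [d3 [Hd3 H3]].
  exists (Rmin (Rmin d1 d2) (Rmin d3 k)). split. repeat apply Rmin_glb_lt; auto.
  intros [x y] Hh.
  assert (K1 := Rmin_l (Rmin d1 d2) (Rmin d3 k)). assert (K2 := Rmin_r (Rmin d1 d2) (Rmin d3 k)).
  assert (K3 := Rmin_l d1 d2). assert (K4 := Rmin_r d1 d2).
  assert (K5 := Rmin_l d3 k). assert (K6 := Rmin_r d3 k).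
  pose proof (Cmod_fst_le (x, y)) as Mx. pose proof (Cmod_snd_le (x, y)) as My.
  simpl in Mx, My.
  specialize (H1 x ltac:(lra)). specialize (H2 y ltac:(lra)). specialize (H3 y ltac:(lra)).
  rewrite exp_0 in H1. rewrite sin_0 in H2. rewrite cos_0 in H3.
  assert (Px := Rabs_pos x). assert (Py := Rabs_pos y).
  eapply Rle_trans. apply Cmod_le_sum.
  change (Rabs (exp x * cos y - 1 - x) + Rabs (exp x * sin y - 0 - y) <= e * Cmod (x, y)).
  set (p := exp x - 1 - 1 * x) in *. set (q := sin y - 0 - 1 * y) in *.
  set (s := cos y - 1 - 0 * y) in *.
  replace (exp x * cos y - 1 - x) with (p * cos y + (1 + x) * s) by (unfold p, s; ring).
  replace (exp x * sin y - 0 - y) with ((1 + x + p) * q + (x + p) * y) by (unfold p, q; ring).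
  assert (Cb : Rabs (cos y) <= 1) by (apply Rabs_le; apply COS_bound).
  assert (T1 : Rabs (p * cos y) <= k * Rabs x).
  { rewrite Rabs_mult. pose proof (Rabs_pos p). pose proof (Rabs_pos (cos y)). nra. }
  assert (T2 : Rabs ((1 + x) * s) <= 2 * (k * Rabs y)).
  { rewrite Rabs_mult. apply Rmult_le_compat; auto using Rabs_pos.
    eapply Rle_trans. apply Rabs_triang. rewrite Rabs_R1. lra. }
  assert (T3 : Rabs ((1 + x + p) * q) <= 3 * (k * Rabs y)).
  { rewrite Rabs_mult. apply Rmult_le_compat; auto using Rabs_pos.
    eapply Rle_trans. apply Rabs_triang. eapply Rle_trans. apply Rplus_le_compat_r, Rabs_triang.
    rewrite Rabs_R1. nra. }
  assert (T4 : Rabs ((x + p) * y) <= 2 * (k * Rabs y)).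
  { rewrite Rabs_mult, <- Rmult_assoc. apply Rmult_le_compat_r; auto.
    eapply Rle_trans. apply Rabs_triang. nra. }
  pose proof (Rabs_triang (p * cos y) ((1 + x) * s)).
  pose proof (Rabs_triang ((1 + x + p) * q) ((x + p) * y)).
  pose proof (Cmod_ge_0 (x, y)).
  assert (k * Rabs x <= k * Cmod (x, y)) by (apply Rmult_le_compat_l; lra).
  assert (k * Rabs y <= k * Cmod (x, y)) by (apply Rmult_le_compat_l; lra).
  assert (k * Cmod (x, y) <= e / 9 * Cmod (x, y)) by (apply Rmult_le_compat_r; lra).
  assert (0 <= e * Cmod (x, y)) by (apply Rmult_le_pos; lra).
  lra.
Qed.

Lemma cdiff_cexp z : cdiff cexp z (cexp z).
Proof.
  apply cdiff_of_bound. intros e He.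
  assert (P : 0 < Cmod (cexp z)) by (apply Cmod_gt_0, cexp_neq_0).
  destruct (cexp_bound_0 (e / Cmod (cexp z))) as [d [Hd H]].
  { apply Rdiv_lt_0_compat; auto. }
  exists d. split; auto. intros y Hy. specialize (H (y - z)%C Hy).
  replace (cexp y) with (cexp z * cexp (y - z))%C
    by (rewrite <- cexp_plus; f_equal; ring).
  replace (cexp z * cexp (y - z) - cexp z - cexp z * (y - z))%C
    with (cexp z * (cexp (y - z) - 1 - (y - z)))%C by ring.
  rewrite Cmod_mult.
  replace (e * Cmod (y - z)) with (Cmod (cexp z) * (e / Cmod (cexp z) * Cmod (y - z)))
    by (field; lra).
  apply Rmult_le_compat_l; lra.
Qed.

Lemma holo_cexp z : holo cexp z.
Proof. eexists. apply cdiff_cexp. Qed.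

Lemma unit_circle_angle x y : x * x + y * y = 1 ->
  exists t, - PI <= t <= PI /\ cos t = x /\ sin t = y.
Proof.
  intros H. assert (B : -1 <= x <= 1) by nra.
  assert (S : sin (acos x) = Rabs y).
  { rewrite sin_acos by auto. rewrite <- sqrt_Rsqr_abs. f_equal. unfold Rsqr. lra. }
  pose proof (acos_bound x). pose proof PI_RGT_0.
  destruct (Rle_dec 0 y) as [Hy | Hy].
  - exists (acos x). split. lra. split. apply cos_acos; auto. rewrite S. apply Rabs_pos_eq; auto.
  - exists (- acos x). split. lra. split. rewrite cos_neg. apply cos_acos; auto.
    rewrite sin_neg, S, Rabs_left by lra. lra.
Qed.

(** A circle about 0 is the image of a vertical segment of length [2 * PI] centred at any logarithm
    of one of its points. The half-length [PI] becomes the mesh of [log_net]. *)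
Lemma cexp_onto_circle (c w : C) : Cmod w = Cmod (cexp c) ->
  exists t, - PI <= t <= PI /\ cexp (c + (0, t)) = w.
Proof.
  intros E. pose proof (cexp_neq_0 c) as N.
  assert (M : Cmod (w / cexp c) = 1).
  { unfold Cdiv. rewrite Cmod_mult, Cmod_inv, E by auto. apply Rinv_r.
    apply Rgt_not_eq, Cmod_gt_0; auto. }
  remember (w / cexp c)%C as u. destruct u as [x y].
  destruct (unit_circle_angle x y) as [t [Ht [Hc Hs]]].
  { unfold Cmod in M; simpl in M.
    assert (x * (x * 1) + y * (y * 1) = 1).
    { rewrite <- (sqrt_sqrt (x * (x * 1) + y * (y * 1))) by nra. rewrite M. ring. }
    lra. }
  exists t. split; auto. rewrite cexp_plus.
  replace (cexp (0, t)) with ((x, y) : C).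
  - rewrite Hequ. field. auto.
  - unfold cexp; simpl. rewrite exp_0, Hc, Hs. f_equal; ring.
Qed.

Lemma cexp_onto (w : C) : w <> 0 -> exists z, cexp z = w.
Proof.
  intros N. apply Cmod_gt_0 in N.
  destruct (cexp_onto_circle (RtoC (ln (Cmod w))) w) as [t [_ Ht]].
  - rewrite Cmod_cexp. simpl. rewrite exp_ln; auto.
  - eexists. apply Ht.
Qed.

(** * Goursat's theorem and the mean value property *)

Definition rcont (g : R -> C) (t : R) : Prop :=
  forall e, 0 < e -> exists d, 0 < d /\ forall s, Rabs (s - t) < d -> Cmod (g s - g t) < e.

Definition CInt (g : R -> C) (a b : R) : C := @RInt C_R_CompleteNormedModule g a b.

Lemma CInt_ext g h a b : (forall t, g t = h t) -> CInt g a b = CInt h a b.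
Proof. intros E. apply (@RInt_ext C_R_CompleteNormedModule). auto. Qed.

Lemma C_R_norm (z : C) : @norm R_AbsRing C_R_NormedModule z = Cmod z.
Proof.
  unfold norm; simpl. unfold prod_norm, Cmod. f_equal. unfold norm; simpl. unfold abs; simpl.
  f_equal; rewrite Rmult_1_r, Rmult_1_r, <- Rabs_mult; apply Rabs_pos_eq, Rle_0_sqr.
Qed.

Lemma rcont_continuous g t : rcont g t -> @continuous R_UniformSpace C_R_NormedModule g t.
Proof.
  intros H. apply filterlim_locally. intros e. destruct (H e (cond_pos e)) as [d [Hd H']].
  exists (mkposreal d Hd). intros s Hs. specialize (H' s Hs).
  split.
  - eapply Rle_lt_trans. 2: apply H'. apply (Cmod_fst_le (g s - g t)).
  - eapply Rle_lt_trans. 2: apply H'. apply (Cmod_snd_le (g s - g t)).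
Qed.

Lemma rcont_ex_RInt g a b : a <= b -> (forall t, a <= t <= b -> rcont g t) ->
  @ex_RInt C_R_NormedModule g a b.
Proof.
  intros L H. apply (@ex_RInt_continuous C_R_CompleteNormedModule).
  rewrite Rmin_left, Rmax_right by auto. intros. apply rcont_continuous; auto.
Qed.

Lemma CInt_correct g a b : a <= b -> (forall t, a <= t <= b -> rcont g t) ->
  @is_RInt C_R_NormedModule g a b (CInt g a b).
Proof. intros. apply (@RInt_correct C_R_CompleteNormedModule), rcont_ex_RInt; auto. Qed.

Lemma CInt_Chasles g a b c : a <= b <= c -> (forall t, a <= t <= c -> rcont g t) ->
  CInt g a c = (CInt g a b + CInt g b c)%C.
Proof.
  intros L H. symmetry.
  apply (@RInt_Chasles C_R_CompleteNormedModule); apply rcont_ex_RInt; intros; try apply H; lra.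
Qed.

Lemma CInt_bound g a b M : a <= b -> (forall t, a <= t <= b -> rcont g t) ->
  (forall t, a <= t <= b -> Cmod (g t) <= M) -> Cmod (CInt g a b) <= (b - a) * M.
Proof.
  intros L H B. rewrite <- C_R_norm.
  apply (@norm_RInt_le_const C_R_NormedModule g a b); auto.
  - intros. rewrite C_R_norm. auto.
  - apply CInt_correct; auto.
Qed.

Lemma CInt_minus g h a b : a <= b -> (forall t, a <= t <= b -> rcont g t) ->
  (forall t, a <= t <= b -> rcont h t) ->
  CInt (fun t => g t - h t)%C a b = (CInt g a b - CInt h a b)%C.
Proof.
  intros L Hg Hh. apply (@RInt_minus C_R_CompleteNormedModule); apply rcont_ex_RInt; auto.
Qed.

Lemma CInt_affine p q a b :
  CInt (fun t => p + RtoC t * q)%C a b = (RtoC (b - a) * p + RtoC ((b * b - a * a) / 2) * q)%C.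
Proof.
  apply (@is_RInt_unique C_R_CompleteNormedModule).
  replace (RtoC (b - a) * p + RtoC ((b * b - a * a) / 2) * q)%C
    with (plus (@scal R_AbsRing C_R_NormedModule (b - a) p)
               (@scal R_AbsRing C_R_NormedModule ((b * b - a * a) / 2) q)).
  2:{ unfold scal, plus; simpl. unfold prod_scal, prod_plus, scal, mult, plus; simpl.
      unfold mult, RtoC, Cplus, Cmult; simpl. f_equal; ring. }
  apply (is_RInt_ext (fun t => plus p (@scal R_AbsRing C_R_NormedModule t q))).
  { intros t _. unfold scal, plus; simpl. unfold prod_scal, prod_plus, scal, mult, plus; simpl.
      unfold mult, RtoC, Cplus, Cmult; simpl. f_equal; ring. }
  apply (@is_RInt_plus C_R_NormedModule). apply (@is_RInt_const C_R_NormedModule).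
  evar_last. apply (@is_RInt_derive C_R_CompleteNormedModule
    (fun t => @scal R_AbsRing C_R_NormedModule (t * t / 2) q)).
  - intros x _. apply (@is_derive_scal_l R_AbsRing C_R_NormedModule (fun t => t * t / 2)).
    auto_derive; auto. field.
  - intros x _. apply rcont_continuous. intros e He. exists (e / (Cmod q + 1)).
    pose proof (Cmod_ge_0 q). split. apply Rdiv_lt_0_compat; lra. intros s Hs.
    replace (@scal R_AbsRing C_R_NormedModule s q - @scal R_AbsRing C_R_NormedModule x q)%C
      with (RtoC (s - x) * q)%C.
    2:{ unfold scal; simpl. unfold prod_scal, scal; simpl. unfold mult, RtoC, Cminus, Copp, Cplus, Cmult; simpl.
        f_equal; ring. }
    rewrite Cmod_mult, Cmod_R. apply Rle_lt_trans with (Rabs (s - x) * (Cmod q + 1)).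
    apply Rmult_le_compat_l. apply Rabs_pos. lra.
    apply (Rmult_lt_compat_r (Cmod q + 1)) in Hs; [|lra].
    replace (e / (Cmod q + 1) * (Cmod q + 1)) with e in Hs by (field; lra). lra.
  - unfold scal, minus, plus, opp; simpl. unfold prod_scal, prod_plus, prod_opp, scal, mult, plus, opp; simpl.
    unfold mult; simpl. f_equal; field.
Qed.

Lemma ccont_rcont_h G x y : ccont G (x, y) -> rcont (fun t => G (t, y)) x.
Proof.
  intros H e He. destruct (H e He) as [d [Hd H']]. exists d. split; auto.
  intros s Hs. apply H'.
  replace ((s, y) - (x, y))%C with (RtoC (s - x)).
  rewrite Cmod_R; auto. unfold RtoC, Cminus, Cplus, Copp; simpl. f_equal; ring.
Qed.

Lemma Cmod_imag t : Cmod (0, t) = Rabs t.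
Proof.
  unfold Cmod; simpl. rewrite <- sqrt_Rsqr_abs. f_equal. unfold Rsqr. ring.
Qed.

Lemma ccont_rcont_v G x y : ccont G (x, y) -> rcont (fun t => G (x, t)) y.
Proof.
  intros H e He. destruct (H e He) as [d [Hd H']]. exists d. split; auto.
  intros s Hs. apply H'.
  replace ((x, s) - (x, y))%C with ((0, s - y) : C).
  rewrite Cmod_imag; auto. unfold Cminus, Cplus, Copp; simpl. f_equal; ring.
Qed.

(** The counterclockwise contour integral around the rectangle [[a,b] x [c,d]]; on the vertical
    sides [dz = i dy]. *)
Definition bdint (G : C -> C) (a b c d : R) : C :=
  (CInt (fun x => G (x, c)) a b - CInt (fun x => G (x, d)) a b
   + Ci * (CInt (fun y => G (b, y)) c d - CInt (fun y => G (a, y)) c d))%C.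

Definition rect_cont (G : C -> C) a b c d : Prop :=
  forall x y, a <= x <= b -> c <= y <= d -> ccont G (x, y).

Ltac rc := intros; first [apply ccont_rcont_h | apply ccont_rcont_v];
  match goal with H : rect_cont _ _ _ _ _ |- _ => apply H; lra end.

Lemma bdint_split_h G a m b c d : a <= m <= b -> c <= d -> rect_cont G a b c d ->
  bdint G a b c d = (bdint G a m c d + bdint G m b c d)%C.
Proof.
  intros L1 L2 H. unfold bdint.
  rewrite (CInt_Chasles (fun x => G (x, c)) a m b), (CInt_Chasles (fun x => G (x, d)) a m b) by (try lra; rc).
  ring.
Qed.

Lemma bdint_split_v G a b c m d : a <= b -> c <= m <= d -> rect_cont G a b c d ->
  bdint G a b c d = (bdint G a b c m + bdint G a b m d)%C.
Proof.
  intros L1 L2 H. unfold bdint.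
  rewrite (CInt_Chasles (fun y => G (a, y)) c m d), (CInt_Chasles (fun y => G (b, y)) c m d) by (try lra; rc).
  ring.
Qed.

Lemma Cmod_Ci : Cmod Ci = 1.
Proof. unfold Ci. rewrite Cmod_imag. apply Rabs_R1. Qed.

Lemma bdint_bound G a b c d M : a <= b -> c <= d -> rect_cont G a b c d ->
  (forall x y, a <= x <= b -> c <= y <= d -> Cmod (G (x, y)) <= M) ->
  Cmod (bdint G a b c d) <= 2 * ((b - a) + (d - c)) * M.
Proof.
  intros L1 L2 H B. unfold bdint.
  assert (I1 : Cmod (CInt (fun x => G (x, c)) a b) <= (b - a) * M)
    by (apply CInt_bound; auto; [rc | intros; apply B; lra]).
  assert (I2 : Cmod (CInt (fun x => G (x, d)) a b) <= (b - a) * M)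
    by (apply CInt_bound; auto; [rc | intros; apply B; lra]).
  assert (I3 : Cmod (CInt (fun y => G (b, y)) c d) <= (d - c) * M)
    by (apply CInt_bound; auto; [rc | intros; apply B; lra]).
  assert (I4 : Cmod (CInt (fun y => G (a, y)) c d) <= (d - c) * M)
    by (apply CInt_bound; auto; [rc | intros; apply B; lra]).
  eapply Rle_trans. apply Cmod_triangle. rewrite Cmod_mult, Cmod_Ci.
  eapply Rle_trans. apply Rplus_le_compat_r, Cmod_triangle.
  eapply Rle_trans. apply Rplus_le_compat_l, Rmult_le_compat_l. lra. apply Cmod_triangle.
  rewrite !Cmod_opp. lra.
Qed.

(** Affine functions have primitives. In Goursat's theorem this removes the linear part of [G] near
    the limit point. *)
Lemma bdint_affine p q a b c d : bdint (fun z => p + z * q)%C a b c d = 0.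
Proof.
  unfold bdint.
  assert (E1 : forall y, CInt (fun x => p + ((x, y) : C) * q)%C a b
    = CInt (fun x => (p + ((0, y) : C) * q) + RtoC x * q)%C a b).
  { intros y. apply CInt_ext. intros x.
    unfold RtoC, Cplus, Cmult; simpl. f_equal; ring. }
  assert (E2 : forall x, CInt (fun y => p + ((x, y) : C) * q)%C c d
    = CInt (fun y => (p + RtoC x * q) + RtoC y * (Ci * q))%C c d).
  { intros y. apply CInt_ext. intros x.
    unfold Ci, RtoC, Cplus, Cmult; simpl. f_equal; ring. }
  rewrite !E1, !E2, !CInt_affine.
  unfold Ci, RtoC, Cminus, Copp, Cplus, Cmult; simpl. f_equal; field.
Qed.

Lemma bdint_minus G K a b c d : a <= b -> c <= d -> rect_cont G a b c d -> rect_cont K a b c d ->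
  bdint (fun z => G z - K z)%C a b c d = (bdint G a b c d - bdint K a b c d)%C.
Proof.
  intros L1 L2 HG HK. unfold bdint.
  rewrite !CInt_minus; try lra; try ring;
   intros; (first [apply (ccont_rcont_h G), HG | apply (ccont_rcont_h K), HK
     | apply (ccont_rcont_v G), HG | apply (ccont_rcont_v K), HK]); lra.
Qed.

Lemma nested_intervals (a b : nat -> R) :
  (forall n, a n <= a (S n)) -> (forall n, b (S n) <= b n) -> (forall n, a n <= b n) ->
  exists x, forall n, a n <= x <= b n.
Proof.
  intros Ha Hb H.
  assert (Ma : forall n m, (n <= m)%nat -> a n <= a m).
  { intros n m L. induction L. lra. eapply Rle_trans; eauto. }
  assert (Mb : forall n m, (n <= m)%nat -> b m <= b n).
  { intros n m L. induction L. lra. eapply Rle_trans; eauto. }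
  assert (Mab : forall n m, a n <= b m).
  { intros n m. apply Rle_trans with (a (max n m)). apply Ma; lia.
    apply Rle_trans with (b (max n m)). auto. apply Mb; lia. }
  destruct (completeness (fun x => exists n, x = a n)) as [x [U L]].
  - exists (b 0%nat). intros y [n ->]. auto.
  - exists (a 0%nat). eauto.
  - exists x. intros n. split.
    + apply U. eauto.
    + apply L. intros y [m ->]. auto.
Qed.

Record rect := Rect { rl : R; rr : R; rb : R; rt : R }.

(** Quartering: if the integral exceeds [e * D^2], with [D] the half-perimeter, it does so on one of
    the four quarters, whose [D] is halved. The rectangles shrink to a point, where
    differentiability makes the integral too small. *)
Lemma goursat_rectangle G a b c d : a <= b -> c <= d ->
  (forall x y, a <= x <= b -> c <= y <= d -> holo G (x, y)) -> bdint G a b c d = 0.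
Proof.
  intros L1 L2 H.
  assert (HC : rect_cont G a b c d) by (intros x y ? ?; apply holo_ccont, H; auto).
  apply Cmod_sub_lt_eps_eq. intros e0 He0.
  replace (bdint G a b c d - 0)%C with (bdint G a b c d) by ring.
  set (D := fun q => (rr q - rl q) + (rt q - rb q)).
  set (D0 := (b - a) + (d - c)).
  assert (HD0 : 0 <= D0) by (unfold D0; lra).
  (* The [+ 1] covers degenerate rectangles, for which [D0] may vanish. *)
  set (e := e0 / (D0 * D0 + 1)).
  assert (He : 0 < e) by (apply Rdiv_lt_0_compat; nra).
  assert (Hee : e * (D0 * D0) <= e0).
  { unfold e. apply (Rmult_le_reg_r (D0 * D0 + 1)). nra. field_simplify. 2: nra. nra. }
  apply Rle_trans with (2 := Hee).
  set (I := fun q => Cmod (bdint G (rl q) (rr q) (rb q) (rt q))).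
  set (bad := fun q => e * (D q * D q) < I q).
  destruct (Rle_dec (I (Rect a b c d)) (e * (D0 * D0))) as [Q | Q]; [exact Q | exfalso].
  apply Rnot_le_lt in Q.
  set (mh := fun q => (rl q + rr q) / 2). set (mv := fun q => (rb q + rt q) / 2).
  set (q1 := fun q => Rect (rl q) (mh q) (rb q) (mv q)).
  set (q2 := fun q => Rect (mh q) (rr q) (rb q) (mv q)).
  set (q3 := fun q => Rect (rl q) (mh q) (mv q) (rt q)).
  set (q4 := fun q => Rect (mh q) (rr q) (mv q) (rt q)).
  set (step := fun q => if excluded_middle_informative (bad (q1 q)) then q1 q
    else if excluded_middle_informative (bad (q2 q)) then q2 q
    else if excluded_middle_informative (bad (q3 q)) then q3 q else q4 q).
  set (inv := fun q => a <= rl q /\ rl q <= rr q /\ rr q <= b /\ c <= rb q /\ rb q <= rt q /\ rt q <= d).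
  assert (S1 : forall q, inv q -> bad q -> inv (step q) /\ bad (step q)).
  { intros q Iq Bq.
    assert (Bs : bad (step q)).
    { unfold step.
      destruct (excluded_middle_informative (bad (q1 q))) as [X1 | X1]; auto.
      destruct (excluded_middle_informative (bad (q2 q))) as [X2 | X2]; auto.
      destruct (excluded_middle_informative (bad (q3 q))) as [X3 | X3]; auto.
      destruct (classic (bad (q4 q))) as [X4 | X4]; auto. exfalso.
      unfold bad in *. apply Rnot_lt_le in X1, X2, X3, X4.
      unfold inv in Iq.
      assert (E : I q <= I (q1 q) + I (q2 q) + (I (q3 q) + I (q4 q))).
      { unfold I, q1, q2, q3, q4; simpl.
        assert (HQ : rect_cont G (rl q) (rr q) (rb q) (rt q)) by (intros x y ? ?; apply HC; lra).
        assert (R1 : rect_cont G (rl q) (rr q) (rb q) (mv q))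
          by (intros x y ? ?; apply HQ; unfold mv in *; lra).
        assert (R2 : rect_cont G (rl q) (rr q) (mv q) (rt q))
          by (intros x y ? ?; apply HQ; unfold mv in *; lra).
        rewrite (bdint_split_v G (rl q) (rr q) (rb q) (mv q) (rt q)); auto;
          [| lra | unfold mv; lra].
        rewrite (bdint_split_h G (rl q) (mh q) (rr q) (rb q) (mv q)); auto;
          [| unfold mh; lra | unfold mv; lra].
        rewrite (bdint_split_h G (rl q) (mh q) (rr q) (mv q) (rt q)); auto;
          [| unfold mh; lra | unfold mv; lra].
        eapply Rle_trans. apply Cmod_triangle. apply Rplus_le_compat; apply Cmod_triangle. }
      assert (F : forall q', D q' = D q / 2 -> D q' * D q' = D q * D q / 4)
        by (intros q' ->; field).
      rewrite F in X1 by (unfold D, q1, mh, mv; simpl; field).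
      rewrite F in X2 by (unfold D, q2, mh, mv; simpl; field).
      rewrite F in X3 by (unfold D, q3, mh, mv; simpl; field).
      rewrite F in X4 by (unfold D, q4, mh, mv; simpl; field).
      lra. }
    split; auto. unfold step.
    destruct (excluded_middle_informative (bad (q1 q)));
    [|destruct (excluded_middle_informative (bad (q2 q)));
    [|destruct (excluded_middle_informative (bad (q3 q)))]];
    unfold inv, q1, q2, q3, q4, mh, mv in *; simpl; lra. }
  set (s := fix s n := match n with O => Rect a b c d | S m => step (s m) end).
  assert (IB : forall n, inv (s n) /\ bad (s n)).
  { induction n; simpl.
    - split. unfold inv; simpl; lra. exact Q.
    - apply S1; apply IHn. }
  assert (Hst : forall q, inv q -> rl q <= rl (step q) /\ rr (step q) <= rr q /\
     rb q <= rb (step q) /\ rt (step q) <= rt q /\ D (step q) = D q / 2).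
  { intros q Iq. unfold step.
    destruct (excluded_middle_informative (bad (q1 q)));
    [|destruct (excluded_middle_informative (bad (q2 q)));
    [|destruct (excluded_middle_informative (bad (q3 q)))]];
    unfold inv, D, q1, q2, q3, q4, mh, mv in *; simpl; lra. }
  destruct (nested_intervals (fun n => rl (s n)) (fun n => rr (s n))) as [x Hx];
    try (intros n; destruct (IB n) as [In _]; specialize (Hst _ In); unfold inv in In; simpl; lra).
  destruct (nested_intervals (fun n => rb (s n)) (fun n => rt (s n))) as [y Hy];
    try (intros n; destruct (IB n) as [In _]; specialize (Hst _ In); unfold inv in In; simpl; lra).
  assert (HD : forall n, D (s n) = D0 / 2 ^ n).
  { induction n; simpl. unfold D, D0; simpl. field.
    destruct (IB n) as [In _]. destruct (Hst _ In) as [_ [_ [_ [_ Hd]]]]. rewrite Hd, IHn. field.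
    apply pow_nonzero; lra. }
  destruct (H x y) as [l Hl]. apply (Hx 0%nat). apply (Hy 0%nat).
  (* With relative error [e / 4] and perimeter [2 * D] the integral is at most [e / 2 * D^2], half
     of what a bad rectangle requires. *)
  destruct (cdiff_bound G (x, y) l Hl (e / 4)) as [dl [Hdl Hb]]. lra.
  assert (HN : exists n, D0 / 2 ^ n < dl).
  { destruct (pow_lt_1_zero (/ 2) ltac:(rewrite Rabs_pos_eq; lra) (dl / (D0 + 1))) as [N HN].
    apply Rdiv_lt_0_compat; lra.
    exists N. specialize (HN N (Nat.le_refl _)).
    rewrite Rabs_pos_eq in HN by (apply pow_le; lra).
    rewrite pow_inv in HN.
    assert (0 < / 2 ^ N) by (apply Rinv_0_lt_compat, pow_lt; lra).
    apply Rle_lt_trans with ((D0 + 1) * / 2 ^ N). unfold Rdiv; nra.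
    apply (Rmult_lt_compat_l (D0 + 1)) in HN; [|lra].
    replace ((D0 + 1) * (dl / (D0 + 1))) with dl in HN by (field; lra). lra. }
  destruct HN as [n Hn]. rewrite <- HD in Hn.
  destruct (IB n) as [In Bn]. unfold inv in In. specialize (Hx n). specialize (Hy n).
  simpl in Hx, Hy.
  set (q := s n) in *. unfold bad in Bn.
  assert (HQ : rect_cont G (rl q) (rr q) (rb q) (rt q)) by (intros u v ? ?; apply HC; lra).
  assert (CA : forall p w, rect_cont (fun z => p + z * w)%C (rl q) (rr q) (rb q) (rt q)).
  { intros p w u v ? ?. apply (ccont_plus (fun _ => p)). apply ccont_const.
    apply (ccont_mult (fun z => z)). apply ccont_id. apply ccont_const. }
  set (p := (G (x, y) - (x, y) * l)%C).
  assert (E : bdint G (rl q) (rr q) (rb q) (rt q)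
     = bdint (fun z => G z - (p + z * l))%C (rl q) (rr q) (rb q) (rt q)).
  { rewrite (bdint_minus G (fun z => p + z * l)%C); auto; try lra. rewrite bdint_affine. ring. }
  assert (B : I q <= 2 * D q * (e / 4 * D q)).
  { unfold I. rewrite E. apply bdint_bound; try lra.
    - intros u v Hu Hv. apply (ccont_plus G). apply HQ; auto.
      apply (ccont_ext_loc (fun z => - (1) * (p + z * l))%C _ _ 1). lra. intros; ring.
      apply (ccont_mult (fun _ => (- (1))%C)). apply ccont_const. apply (CA p l); auto.
    - intros u v Hu Hv.
      assert (N : Cmod ((u, v) - (x, y)) <= D q).
      { eapply Rle_trans. apply Cmod_le_sum. simpl. unfold D.
        apply Rplus_le_compat; apply Rabs_le; lra. }
      unfold p. replace (G (u, v) - (G (x, y) - (x, y) * l + (u, v) * l))%C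
        with (G (u, v) - G (x, y) - l * ((u, v) - (x, y)))%C by ring.
      eapply Rle_trans. apply Hb. lra. apply Rmult_le_compat_l; lra. }
  assert (0 <= e * (D q * D q)) by (apply Rmult_le_pos; nra).
  lra.
Qed.

(** In the coordinate [a + cexp z] circles about [a] become vertical segments of height [2 * PI].
    Goursat's theorem on a rectangle whose horizontal sides cancel by periodicity shows that the
    circle averages do not depend on the radius, and for small radii they are close to [f a]. *)
Lemma mean_value_bound f a rho M : 0 < rho ->
  (forall z, Cmod (z - a) <= rho -> holo f z) ->
  (forall z, Cmod (z - a) = rho -> Cmod (f z) <= M) -> Cmod (f a) <= M.
Proof.
  intros Hr H B.
  set (G := fun z => f (a + cexp z)%C).
  assert (HG : forall z, fst z <= ln rho -> holo G z).
  { intros z Hz. apply (holo_comp f (fun z => a + cexp z)%C).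
    - apply holo_plus. apply holo_const. apply holo_cexp.
    - apply H. replace (a + cexp z - a)%C with (cexp z) by ring. rewrite Cmod_cexp.
      rewrite <- (exp_ln rho) by auto. destruct Hz as [Hz | Hz].
      left; apply exp_increasing; auto. right; rewrite Hz; auto. }
  pose proof PI_RGT_0 as Ppi.
  set (V := fun s => CInt (fun y => G (s, y)) 0 (2 * PI)).
  assert (RC : forall s t, s <= ln rho -> rcont (fun y => G (s, y)) t).
  { intros s t Hs. apply ccont_rcont_v, holo_ccont, HG; auto. }
  assert (HV : forall s, s <= ln rho -> V s = V (ln rho)).
  { intros s Hs.
    assert (E := goursat_rectangle G s (ln rho) 0 (2 * PI) Hs ltac:(lra)
      (fun x y Hx _ => HG (x, y) (proj2 Hx))).
    unfold bdint in E.
    replace (CInt (fun x => G (x, 2 * PI)) s (ln rho)) with (CInt (fun x => G (x, 0)) s (ln rho)) in E.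
    2:{ apply CInt_ext. intros x. unfold G.
        rewrite <- (cexp_period (x, 0)). do 3 f_equal. unfold Cplus; simpl. f_equal; ring. }
    fold (V s) (V (ln rho)) in E. symmetry. apply Csub_eq_0.
    replace (V (ln rho) - V s)%C with (- Ci * (Ci * (V (ln rho) - V s)))%C.
    2:{ unfold Ci, Cmult, Copp, Cminus, Cplus; simpl; destruct (V s), (V (ln rho)); simpl; f_equal; ring. }
    replace (Ci * (V (ln rho) - V s))%C with (RtoC 0).
    ring. rewrite <- E. ring. }
  assert (BV : Cmod (V (ln rho)) <= 2 * PI * M).
  { replace (2 * PI) with (2 * PI - 0) by ring. apply CInt_bound. lra.
    intros; apply RC; lra. intros t _. apply B.
    replace (a + cexp (ln rho, t) - a)%C with (cexp (ln rho, t)) by ring.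
    rewrite Cmod_cexp; simpl. apply exp_ln; auto. }
  assert (LV : forall e, 0 < e -> Cmod (V (ln rho) - RtoC (2 * PI) * f a) <= 2 * PI * e).
  { intros e He. destruct (holo_ccont f a (H a ltac:(rewrite Cmod_sub_self; lra)) e He) as [d [Hd Hc]].
    set (s := ln (Rmin rho (d / 2))).
    assert (P : 0 < Rmin rho (d / 2)) by (apply Rmin_glb_lt; lra).
    assert (Hs : s <= ln rho).
    { unfold s. apply ln_le; auto. apply Rmin_l. }
    rewrite <- (HV s Hs).
    assert (Ec : CInt (fun _ => f a) 0 (2 * PI) = (RtoC (2 * PI) * f a)%C).
    { transitivity (CInt (fun t => f a + RtoC t * 0)%C 0 (2 * PI)).
      apply CInt_ext. intros x. ring.
      rewrite CInt_affine. rewrite Rminus_0_r. ring. }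
    assert (RCc : forall t, rcont (fun _ => f a) t).
    { intros t e' He'. exists 1. split. lra. intros. rewrite Cmod_sub_self; auto. }
    rewrite <- Ec. unfold V. rewrite <- CInt_minus; try (intros; auto); try lra.
    replace (2 * PI) with (2 * PI - 0) at 2 by ring.
    apply CInt_bound. lra.
    - intros t _ e' He'. destruct (RC s t Hs e' He') as [d' [Hd' K]]. exists d'. split; auto.
      intros u Hu. replace (G (s, u) - f a - (G (s, t) - f a))%C with (G (s, u) - G (s, t))%C by ring. auto.
    - intros t _. left. apply Hc.
      replace (a + cexp (s, t) - a)%C with (cexp (s, t)) by ring.
      rewrite Cmod_cexp; simpl. unfold s. rewrite exp_ln by auto.
      pose proof (Rmin_r rho (d / 2)). lra. }
  assert (E : V (ln rho) = (RtoC (2 * PI) * f a)%C).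
  { apply Cmod_sub_lt_eps_eq. intros e He. eapply Rle_trans. apply (LV (e / (2 * PI))).
    apply Rdiv_lt_0_compat; lra. right. field. lra. }
  rewrite E, Cmod_mult, Cmod_R, Rabs_pos_eq in BV by lra.
  apply (Rmult_le_reg_l (2 * PI)); lra.
Qed.

(** * Maximum principle and division by zeros *)

Lemma Cmod_sqr (z : C) : Cmod z * Cmod z = fst z * fst z + snd z * snd z.
Proof. unfold Cmod. rewrite sqrt_sqrt; simpl; nra. Qed.

(** Compares numerator and denominator of the disc automorphism [(u + c) / (1 + Cconj c * u)]: equal
    moduli for [|u| = 1], and modulus of the quotient at most 1 when [|u|] and [|c|] are at most
    1. *)
Lemma mobius_identity (u c : C) :
  Cmod (1 + Cconj c * u) * Cmod (1 + Cconj c * u)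
  = Cmod (u + c) * Cmod (u + c) + (1 - Cmod u * Cmod u) * (1 - Cmod c * Cmod c).
Proof. rewrite !Cmod_sqr. destruct u, c; simpl. ring. Qed.

(** The mean value bound at the centre is transported to [b] by the Moebius map of the unit disc
    onto the given disc that sends 0 to [b]. *)
Lemma max_principle f a rho M b :
  (forall z, Cmod (z - a) <= rho -> holo f z) ->
  (forall z, Cmod (z - a) = rho -> Cmod (f z) <= M) ->
  Cmod (b - a) < rho -> Cmod (f b) <= M.
Proof.
  intros H B Hb.
  assert (Hr : 0 < rho) by (pose proof (Cmod_ge_0 (b - a)); lra).
  assert (Nr : RtoC rho <> 0) by (intros E; apply (f_equal fst) in E; simpl in E; lra).
  set (c := ((b - a) / RtoC rho)%C).
  assert (Hc : Cmod c < 1).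
  { unfold c, Cdiv. rewrite Cmod_mult, Cmod_inv, Cmod_R, Rabs_pos_eq by (auto; lra).
    apply (Rmult_lt_reg_r rho); auto. rewrite Rmult_assoc, Rinv_l; lra. }
  pose proof (Cmod_ge_0 c) as Hc0.
  assert (ND : forall u, Cmod u <= 1 -> (1 + Cconj c * u)%C <> 0).
  { intros u Hu. apply Cmod_gt_0.
    assert (K : Cmod (- (Cconj c * u)) < 1).
    { rewrite Cmod_opp, Cmod_mult, Cmod_conj. pose proof (Cmod_ge_0 u). nra. }
    pose proof (Cmod_sub_ge 1 (- (Cconj c * u))) as K2. rewrite Cmod_1 in K2.
    replace (1 + Cconj c * u)%C with (1 - - (Cconj c * u))%C by ring. lra. }
  set (phi := fun u => (a + RtoC rho * ((u + c) * / (1 + Cconj c * u)))%C).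
  assert (Mp : forall u, Cmod u <= 1 ->
    Cmod (phi u - a) = rho * (Cmod (u + c) * / Cmod (1 + Cconj c * u))).
  { intros u Hu. unfold phi.
    replace (a + RtoC rho * ((u + c) * / (1 + Cconj c * u)) - a)%C
      with (RtoC rho * ((u + c) * / (1 + Cconj c * u)))%C by ring.
    rewrite !Cmod_mult, Cmod_inv, Cmod_R, Rabs_pos_eq; auto. lra. }
  assert (E0 : phi 0 = b).
  { unfold phi, c. rewrite Cmult_0_r. field. auto. }
  rewrite <- E0. change (Cmod ((fun u => f (phi u)) 0) <= M).
  apply (mean_value_bound (fun u => f (phi u)) 0 1). lra.
  - intros u Hu. rewrite <- (Cplus_0_r u) in Hu. replace (u + 0 - 0)%C with u in Hu by ring.
    apply (holo_comp f phi).
    + unfold phi. apply holo_plus. apply holo_const. apply holo_mult. apply holo_const.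
      apply holo_mult. apply holo_plus. apply holo_id. apply holo_const.
      apply (holo_inv (fun u => 1 + Cconj c * u)%C); auto. apply holo_plus. apply holo_const.
      apply holo_mult. apply holo_const. apply holo_id.
    + apply H. rewrite Mp by auto.
      pose proof (mobius_identity u c) as Id. pose proof (Cmod_ge_0 u). pose proof (Cmod_ge_0 (u + c)).
      assert (P : 0 < Cmod (1 + Cconj c * u)) by (apply Cmod_gt_0; auto).
      assert (Q : 0 <= (1 - Cmod u * Cmod u) * (1 - Cmod c * Cmod c)) by (apply Rmult_le_pos; nra).
      assert (L : Cmod (u + c) <= Cmod (1 + Cconj c * u)) by nra.
      apply (Rmult_le_reg_r (Cmod (1 + Cconj c * u))); auto.
      rewrite !Rmult_assoc, Rinv_l by lra. nra.
  - intros u Hu. replace (u - 0)%C with u in Hu by ring. apply B. rewrite Mp by lra.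
    pose proof (mobius_identity u c) as Id. rewrite Hu in Id. pose proof (Cmod_ge_0 (u + c)).
    assert (P : 0 < Cmod (1 + Cconj c * u)) by (apply Cmod_gt_0, ND; lra).
    assert (L : Cmod (u + c) = Cmod (1 + Cconj c * u)) by nra.
    rewrite L, Rinv_r; lra.
Qed.

(** If [y < x], Bernoulli's inequality makes the powers of [x / y] unbounded. *)
Lemma pow_growth_le A B x y : 0 < A -> 0 <= x -> 0 <= y ->
  (forall N, A * x ^ N <= B * y ^ N) -> x <= y.
Proof.
  intros HA Hx Hy H. destruct (Rle_dec x y) as [L | L]; auto. exfalso. apply Rnot_le_lt in L.
  destruct (Req_dec y 0) as [E | E].
  { specialize (H 1%nat). subst. simpl in H. nra. }
  assert (Py : 0 < y) by lra.
  set (k := x / y - 1).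
  assert (Hk : 0 < k).
  { unfold k. apply (Rmult_lt_reg_r y); auto. field_simplify; lra. }
  destruct (INR_unbounded (B / A / k)) as [N HN].
  specialize (H N).
  assert (P : 1 + INR N * k <= (1 + k) ^ N) by (apply poly; auto).
  replace (1 + k) with (x / y) in P by (unfold k; field; lra).
  unfold Rdiv in P. rewrite Rpow_mult_distr, pow_inv in P.
  assert (Q : 0 < y ^ N) by (apply pow_lt; auto).
  assert (A * (1 + INR N * k) <= B).
  { apply Rle_trans with (A * (x ^ N * / y ^ N)). apply Rmult_le_compat_l; lra.
    apply (Rmult_le_reg_r (y ^ N)); auto.
    replace (A * (x ^ N * / y ^ N) * y ^ N) with (A * x ^ N) by (field; lra). lra. }
  assert (B / A / k * (A * k) = B) by (field; lra).
  assert (0 < A * k) by (apply Rmult_lt_0_compat; auto).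
  nra.
Qed.

Fixpoint prod_roots (zs : list C) (z : C) : C :=
  match zs with nil => 1 | w :: l => ((z - w) * prod_roots l z)%C end.

Lemma prod_roots_app l1 l2 z : prod_roots (l1 ++ l2) z = (prod_roots l1 z * prod_roots l2 z)%C.
Proof. induction l1; simpl. ring. rewrite IHl1. ring. Qed.

Lemma prod_roots_neq_0 l z : ~ In z l -> prod_roots l z <> 0.
Proof.
  induction l; simpl; intros H.
  - intros E. apply (f_equal fst) in E. simpl in E. lra.
  - apply Cmult_neq_0. intros E. apply H. left. symmetry. apply Csub_eq_0, E.
    apply IHl. tauto.
Qed.

Lemma prod_roots_holo l z : holo (prod_roots l) z.
Proof.
  induction l; simpl. apply holo_const.
  apply (holo_mult (fun z => z - a)%C); auto. apply (holo_plus (fun z => z)). apply holo_id. apply holo_const.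
Qed.

Lemma ccont_pow f n z : ccont f z -> ccont (fun y => Cpow (f y) n) z.
Proof. intros H. induction n; simpl. apply ccont_const. apply ccont_mult; auto. Qed.

Lemma Cmod_pow z n : Cmod (Cpow z n) = Cmod z ^ n.
Proof. induction n; simpl. apply Cmod_1. rewrite Cmod_mult, IHn. auto. Qed.

(* [f * (f/P)^N] is holomorphic even at the roots of [P], so the maximum principle applies
   to it; letting [N] tend to infinity transfers the bound to [f/P] without any theorem on
   removable singularities. *)
Lemma divide_by_zeros f a rho M p zs b :
  (forall z, Cmod (z - a) <= rho -> holo f z) ->
  (forall z, Cmod (z - a) = rho -> Cmod (f z) <= M) ->
  NoDup zs -> (forall z, In z zs -> Cmod (z - a) < rho /\ f z = 0) ->
  0 < p -> (forall z, Cmod (z - a) = rho -> p <= Cmod (prod_roots zs z)) ->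
  Cmod (b - a) < rho -> Cmod (f b) * p <= Cmod (prod_roots zs b) * M.
Proof.
  intros H B ND Hz Hp HP Hb.
  assert (Hr : 0 < rho) by (pose proof (Cmod_ge_0 (b - a)); lra).
  assert (HM : 0 <= M).
  { apply Rle_trans with (Cmod (f (a + RtoC rho)%C)). apply Cmod_ge_0. apply B.
    replace (a + RtoC rho - a)%C with (RtoC rho) by ring. rewrite Cmod_R, Rabs_pos_eq; lra. }
  destruct (classic (In b zs)) as [I | I].
  { rewrite (proj2 (Hz b I)), Cmod_0, Rmult_0_l. apply Rmult_le_pos; auto. apply Cmod_ge_0. }
  assert (NPb := prod_roots_neq_0 zs b I).
  assert (PPb := NPb). apply Cmod_gt_0 in PPb.
  destruct (Req_dec (Cmod (f b)) 0) as [Z | Z].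
  { rewrite Z, Rmult_0_l. apply Rmult_le_pos; auto. apply Cmod_ge_0. }
  pose proof (Cmod_ge_0 (f b)) as Pf.
  set (T := fun N z => (f z * Cpow (f z * / prod_roots zs z) N)%C).
  assert (HT : forall N z, Cmod (z - a) <= rho -> holo (T N) z).
  { intros N z Lz. destruct (classic (In z zs)) as [Iz | Iz].
    - destruct (in_split z zs Iz) as [l1 [l2 Ez]].
      destruct (Hz z Iz) as [_ Fz].
      destruct (H z Lz) as [l [phi [Hphi [_ [d [Hd Ef]]]]]].
      rewrite Fz in Ef.
      assert (Nz : ~ In z (l1 ++ l2)) by (apply NoDup_remove_2; rewrite <- Ez; auto).
      (* Near a root [z], [f y = phi y * (y - z)], and [NoDup] leaves exactly one factor [y - z] in
         the product, so it cancels in the quotient. At [z] itself the quotient is a default value,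
         but the extra factor [f] makes [T N z] vanish, as it should. *)
      exists (phi z * Cpow (phi z * / prod_roots (l1 ++ l2) z) N)%C.
      exists (fun y => phi y * Cpow (phi y * / prod_roots (l1 ++ l2) y) N)%C. split; [|split].
      + apply ccont_mult; auto. apply (ccont_pow (fun y => phi y * / prod_roots (l1 ++ l2) y)%C).
        apply ccont_mult; auto. apply ccont_inv. apply holo_ccont, prod_roots_holo.
        apply prod_roots_neq_0; auto.
      + auto.
      + assert (Cq := holo_ccont _ _ (prod_roots_holo (l1 ++ l2) z)).
        destruct (ccont_neq_0 _ _ Cq (prod_roots_neq_0 _ _ Nz)) as [d2 [Hd2 H2]].
        exists (Rmin d d2). split. apply Rmin_glb_lt; auto.
        intros y Hy. unfold T.
        assert (Y1 : Cmod (y - z) < d) by (eapply Rlt_le_trans; [apply Hy | apply Rmin_l]).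
        assert (Y2 : Cmod (y - z) < d2) by (eapply Rlt_le_trans; [apply Hy | apply Rmin_r]).
        rewrite Fz. rewrite (Ef y Y1).
        destruct (classic (y = z)) as [Eyz | Eyz].
        { subst y. ring. }
        assert (Nyz : (y - z)%C <> 0) by (intros E; apply Eyz, Csub_eq_0, E).
        assert (Nq : prod_roots (l1 ++ l2) y <> 0).
        { specialize (H2 y Y2). apply Cmod_gt_0. pose proof (Cmod_ge_0 (prod_roots (l1 ++ l2) z)). lra. }
        replace ((0 + phi y * (y - z)) * / prod_roots zs y)%C
          with (phi y * / prod_roots (l1 ++ l2) y)%C.
        ring. rewrite Ez, !prod_roots_app. simpl. rewrite prod_roots_app in Nq. field.
        repeat split; auto; intros E; apply Nq; rewrite E; ring.
    - apply holo_mult; auto. apply holo_pow. apply holo_mult; auto.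
      apply holo_inv. apply prod_roots_holo. apply prod_roots_neq_0; auto. }
  assert (L : Cmod (f b) * / Cmod (prod_roots zs b) <= M * / p).
  { apply (pow_growth_le (Cmod (f b)) M).
    - lra.
    - apply Rmult_le_pos; auto. left. apply Rinv_0_lt_compat; auto.
    - apply Rmult_le_pos; auto. left. apply Rinv_0_lt_compat; auto.
    - intros N. rewrite <- Cmod_inv, <- Cmod_mult, <- Cmod_pow, <- Cmod_mult by auto.
      apply (max_principle (T N) a rho); auto.
      intros z Lz. unfold T. specialize (HP z Lz).
      assert (Np : prod_roots zs z <> 0) by (apply Cmod_gt_0; lra).
      rewrite Cmod_mult, Cmod_pow, Cmod_mult, Cmod_inv by auto.
      apply Rmult_le_compat; auto using Cmod_ge_0.
      apply pow_le, Rmult_le_pos. apply Cmod_ge_0. left; apply Rinv_0_lt_compat; lra.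
      apply pow_incr. split. apply Rmult_le_pos. apply Cmod_ge_0. left; apply Rinv_0_lt_compat; lra.
      apply Rmult_le_compat; auto using Cmod_ge_0. left; apply Rinv_0_lt_compat; lra.
      apply Rinv_le_contravar; auto. }
  apply (Rmult_le_compat_r (p * Cmod (prod_roots zs b))) in L.
  2:{ apply Rmult_le_pos; lra. }
  replace (Cmod (f b) * / Cmod (prod_roots zs b) * (p * Cmod (prod_roots zs b)))
    with (Cmod (f b) * p) in L by (field; lra).
  replace (M * / p * (p * Cmod (prod_roots zs b))) with (Cmod (prod_roots zs b) * M) in L
    by (field; lra).
  exact L.
Qed.

(** * Compact subsets of the plane *)

Definition ccompact (K : C -> Prop) : Prop :=
  bounded_set K /\ forall z, closure_set K z -> K z.

Lemma ccompact_cluster K (u : nat -> C) : ccompact K -> (forall n, K (u n)) ->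
  exists z, K z /\ forall e N, 0 < e -> exists n, (N <= n)%nat /\ Cmod (u n - z) < e.
Proof.
  intros [[M HM] HK] H. destruct (bounded_seq_cluster u M) as [z Hz]. auto.
  exists z. split; auto. apply HK. intros e He. destruct (Hz e 0%nat He) as [n [_ Hn]]. eauto.
Qed.

Lemma ccompact_bound K f : ccompact K -> (forall z, K z -> ccont f z) ->
  exists M, forall z, K z -> Cmod (f z) <= M.
Proof.
  intros HK Hf. apply NNPP. intros N.
  assert (S : forall n : nat, exists z, K z /\ INR n < Cmod (f z)).
  { intros n. apply NNPP. intros Q. apply N. exists (INR n). intros z Kz.
    apply Rnot_lt_le. intros L. apply Q. eauto. }
  apply (choice (fun n z => K z /\ INR n < Cmod (f z))) in S. destruct S as [u Hu].
  destruct (ccompact_cluster K u HK) as [z [Kz Hz]]. apply Hu.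
  destruct (Hf z Kz 1) as [d [Hd Hc]]. lra.
  destruct (INR_unbounded (Cmod (f z) + 1)) as [m Hm].
  destruct (Hz d m Hd) as [n [Hn Hn']].
  specialize (Hc _ Hn'). pose proof (Cmod_sub_ge (f (u n)) (f z)). destruct (Hu n) as [_ L].
  apply le_INR in Hn. lra.
Qed.

Lemma ccompact_min K f : ccompact K -> (forall z, K z -> ccont f z) -> (forall z, K z -> f z <> 0) ->
  exists m, 0 < m /\ forall z, K z -> m <= Cmod (f z).
Proof.
  intros HK Hf Nf. destruct (ccompact_bound K (fun z => / f z)%C HK) as [M HM].
  { intros z Kz. apply ccont_inv; auto. }
  exists (/ (Rabs M + 1)). assert (P : 0 < Rabs M + 1) by (pose proof (Rabs_pos M); lra).
  split. apply Rinv_0_lt_compat; auto.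
  intros z Kz. specialize (HM z Kz). rewrite Cmod_inv in HM by auto.
  assert (Q : 0 < Cmod (f z)) by (apply Cmod_gt_0; auto).
  rewrite <- (Rinv_inv (Cmod (f z))). apply Rinv_le_contravar.
  apply Rinv_0_lt_compat; auto. pose proof (Rle_abs M). lra.
Qed.

Lemma ccompact_disc a rho : ccompact (fun z => Cmod (z - a) <= rho).
Proof.
  split.
  - exists (rho + Cmod a). intros z Hz. pose proof (Cmod_sub_ge z a). lra.
  - intros z H. apply Rnot_lt_le. intros L.
    destruct (H (Cmod (z - a) - rho)) as [y [Hy Hy']]. lra.
    pose proof (Cmod_sub_tri z y a). rewrite (Cmod_sub_sym z y) in H0. lra.
Qed.

Lemma ccompact_circle a rho : ccompact (fun z => Cmod (z - a) = rho).
Proof.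
  split.
  - exists (rho + Cmod a). intros z Hz. pose proof (Cmod_sub_ge z a). lra.
  - intros z H. apply Rle_antisym; apply Rnot_lt_le; intros L.
    + destruct (H (Cmod (z - a) - rho)) as [y [Hy Hy']]. lra.
      pose proof (Cmod_sub_tri z y a) as T. rewrite (Cmod_sub_sym z y) in T. lra.
    + destruct (H (rho - Cmod (z - a))) as [y [Hy Hy']]. lra.
      pose proof (Cmod_sub_tri y z a) as T. lra.
Qed.

(** * Cauchy estimates and a quadratic Taylor bound *)

Lemma holo_sub_const f w z : holo f z -> holo (fun y => f y - w)%C z.
Proof. intros. apply (holo_plus f); auto. apply holo_const. Qed.

(** Division of [f - f a] by its zero [a]: on the circle the numerator is at most [2 * M] and
    [|y - a|] is at least [rho / 2]. *)
Lemma lipschitz_of_bound f c rho M a z :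
  (forall y, Cmod (y - c) <= rho -> holo f y) ->
  (forall y, Cmod (y - c) = rho -> Cmod (f y) <= M) ->
  Cmod (a - c) < rho / 2 -> Cmod (z - c) < rho / 2 ->
  Cmod (f z - f a) <= 4 * M / rho * Cmod (z - a).
Proof.
  intros H B Ha Hz. pose proof (Cmod_ge_0 (a - c)) as Pa.
  assert (Bd := max_principle f c rho M a H B ltac:(lra)).
  assert (L : Cmod (f z - f a) * (rho / 2) <= Cmod (prod_roots (a :: nil) z) * (2 * M)).
  { apply (divide_by_zeros (fun y => f y - f a)%C c rho).
    - intros y Hy. apply holo_sub_const; auto.
    - intros y Hy. eapply Rle_trans. apply Cmod_triangle. rewrite Cmod_opp.
      specialize (B y Hy). lra.
    - constructor; auto. constructor.
    - intros y [E | []]. subst. split. lra. ring.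
    - lra.
    - intros y Hy. simpl. rewrite Cmult_1_r. pose proof (Cmod_sub_tri y a c). lra.
    - lra. }
  simpl in L. rewrite Cmult_1_r in L.
  apply (Rmult_le_reg_r (rho / 2)). lra. eapply Rle_trans. apply L. right. field. lra.
Qed.

Lemma cdiff_norm_le f a l D d : 0 < d -> cdiff f a l ->
  (forall y, Cmod (y - a) < d -> Cmod (f y - f a) <= D * Cmod (y - a)) -> Cmod l <= D.
Proof.
  intros Hd H B. apply le_epsilon. intros e He.
  destruct (cdiff_bound f a l H e He) as [d2 [Hd2 H2]].
  set (t := Rmin d d2 / 2). assert (P : 0 < Rmin d d2) by (apply Rmin_glb_lt; auto).
  pose proof (Rmin_l d d2). pose proof (Rmin_r d d2).
  assert (Ht : 0 < t) by (unfold t; lra).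
  assert (Et : Cmod ((a + RtoC t) - a) = t).
  { replace (a + RtoC t - a)%C with (RtoC t) by ring. rewrite Cmod_R, Rabs_pos_eq; lra. }
  assert (T1 : t < d) by (unfold t; lra). assert (T2 : t < d2) by (unfold t; lra).
  specialize (H2 (a + RtoC t)%C ltac:(lra)). specialize (B (a + RtoC t)%C ltac:(lra)).
  rewrite Et in *.
  assert (K : Cmod (l * ((a + RtoC t) - a)) <= D * t + e * t).
  { replace (l * (a + RtoC t - a))%C
      with ((f (a + RtoC t) - f a) - (f (a + RtoC t) - f a - l * (a + RtoC t - a)))%C by ring.
    eapply Rle_trans. apply Cmod_triangle. rewrite Cmod_opp. lra. }
  rewrite Cmod_mult, Et in K. apply (Rmult_le_reg_r t); lra.
Qed.

Lemma cauchy_estimate f c rho M l : 0 < rho ->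
  (forall y, Cmod (y - c) <= rho -> holo f y) ->
  (forall y, Cmod (y - c) = rho -> Cmod (f y) <= M) ->
  cdiff f c l -> Cmod l <= 4 * M / rho.
Proof.
  intros Hr H B Hl. apply (cdiff_norm_le f c l _ (rho / 2)); auto. lra.
  intros y Hy. apply (lipschitz_of_bound f c rho); auto. rewrite Cmod_sub_self. lra.
Qed.

(* The interpolation polynomial of [f] at [c] and a second node [b] has an error divisible
   by [(z - c) * (z - b)]; then [b] tends to [c]. *)
Lemma taylor_quadratic f c rho M l z :
  (forall y, Cmod (y - c) <= rho -> holo f y) ->
  (forall y, Cmod (y - c) = rho -> Cmod (f y) <= M) ->
  cdiff f c l -> Cmod (z - c) < rho ->
  Cmod (f z - f c - l * (z - c)) <= 12 * M / (rho * rho) * (Cmod (z - c) * Cmod (z - c)).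
Proof.
  intros H B Hl Hz. pose proof (Cmod_ge_0 (z - c)) as Pz.
  assert (Hr : 0 < rho) by lra.
  assert (Bc := max_principle f c rho M c H B ltac:(rewrite Cmod_sub_self; lra)).
  assert (HM : 0 <= M) by (pose proof (Cmod_ge_0 (f c)); lra).
  set (K := 12 * M / (rho * rho)).
  assert (HK : 0 <= K) by (apply Rmult_le_pos; [lra | left; apply Rinv_0_lt_compat; nra]).
  apply le_epsilon. intros e He.
  (* Two errors remain: at most [k * rho] from replacing [q] by [l], and at most [K * rho * k] from
     replacing [b] by [c]. Together they do not exceed [e]. *)
  set (k := e / ((1 + K) * (rho + 1))).
  assert (Hk : 0 < k) by (apply Rdiv_lt_0_compat; auto; nra).
  destruct (cdiff_bound f c l Hl k Hk) as [d [Hd Hb]].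
  set (t := Rmin (Rmin (d / 2) k) (rho / 4)).
  assert (Ht : 0 < t) by (repeat apply Rmin_glb_lt; lra).
  assert (T1 : t <= d / 2) by (eapply Rle_trans; [apply Rmin_l | apply Rmin_l]).
  assert (T2 : t <= k) by (eapply Rle_trans; [apply Rmin_l | apply Rmin_r]).
  assert (T3 : t <= rho / 4) by apply Rmin_r. clearbody t.
  set (b := (c + RtoC t)%C).
  assert (Eb : Cmod (b - c) = t).
  { unfold b. replace (c + RtoC t - c)%C with (RtoC t) by ring. rewrite Cmod_R, Rabs_pos_eq; lra. }
  assert (Nb : (b - c)%C <> 0) by (apply Cmod_gt_0; lra).
  set (q := ((f b - f c) / (b - c))%C).
  assert (Hq : Cmod q <= 4 * M / rho).
  { unfold q, Cdiv. rewrite Cmod_mult, Cmod_inv by auto. apply (Rmult_le_reg_r (Cmod (b - c))). lra.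
    rewrite Rmult_assoc, Rinv_l, Rmult_1_r by lra.
    apply (lipschitz_of_bound f c rho); auto; rewrite ?Cmod_sub_self; lra. }
  assert (Hql : Cmod (q - l) <= k).
  { apply (Rmult_le_reg_r (Cmod (b - c))). lra. rewrite <- Cmod_mult.
    replace ((q - l) * (b - c))%C with (f b - f c - l * (b - c))%C by (unfold q; field; auto).
    apply Hb. lra. }
  (* On the circle the interpolation error is at most [2 * M] from the values of [f] plus [4 * M]
     from the linear term, and the product of the two factors is at least [rho * (rho / 2)]; hence
     the constant 12. *)
  assert (L : Cmod (f z - f c - q * (z - c)) * (rho * (rho / 2)) <= Cmod (prod_roots (c :: b :: nil) z) * (6 * M)).
  { apply (divide_by_zeros (fun y => f y - f c - q * (y - c))%C c rho); auto.
    - intros y Hy. apply (holo_plus (fun y => f y - f c)%C (fun y => - (q * (y - c)))%C).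
      apply holo_sub_const; auto.
      apply (holo_ext_loc (fun y => (- q) * (y - c))%C _ _ 1). lra. intros; ring.
      apply (holo_mult (fun _ => - q)%C (fun y => y - c)%C). apply holo_const. apply (holo_sub_const (fun y => y)). apply holo_id.
    - intros y Hy. eapply Rle_trans. apply Cmod_triangle. rewrite Cmod_opp, Cmod_mult, Hy.
      eapply Rle_trans. apply Rplus_le_compat_r, Cmod_triangle. rewrite Cmod_opp.
      specialize (B y Hy). apply (Rmult_le_compat_r rho) in Hq; [|lra].
      replace (4 * M / rho * rho) with (4 * M) in Hq by (field; lra). lra.
    - constructor. intros [E | []]. apply Nb. rewrite E. ring. constructor; auto. constructor.
    - intros y [<- | [<- | []]].
      + rewrite Cmod_sub_self. split. lra. ring.
      + split. lra. unfold q. field. auto.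
    - nra.
    - intros y Hy. simpl. rewrite Cmult_1_r, Cmod_mult, Hy.
      apply Rmult_le_compat_l. lra. pose proof (Cmod_sub_tri y b c). lra. }
  simpl in L. rewrite Cmult_1_r, Cmod_mult in L.
  assert (L2 : Cmod (f z - f c - q * (z - c)) <= K * (Cmod (z - c) * Cmod (z - b))).
  { apply (Rmult_le_reg_r (rho * (rho / 2))). nra. eapply Rle_trans. apply L. right. unfold K. field. lra. }
  assert (Zb : Cmod (z - b) <= Cmod (z - c) + t).
  { pose proof (Cmod_sub_tri z c b) as Tr. rewrite (Cmod_sub_sym c b) in Tr. lra. }
  assert (L3 : K * (Cmod (z - c) * Cmod (z - b)) <= K * (Cmod (z - c) * (Cmod (z - c) + t)))
    by (apply Rmult_le_compat_l; auto; apply Rmult_le_compat_l; auto).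
  replace (f z - f c - l * (z - c))%C with ((f z - f c - q * (z - c)) + (q - l) * (z - c))%C by ring.
  eapply Rle_trans. apply Cmod_triangle. rewrite Cmod_mult.
  assert (X1 : Cmod (q - l) * Cmod (z - c) <= k * rho) by (apply Rmult_le_compat; auto using Cmod_ge_0; lra).
  assert (X2 : K * (Cmod (z - c) * t) <= K * (rho * k)).
  { apply Rmult_le_compat_l; auto. apply Rmult_le_compat; lra. }
  assert (X3 : k * ((1 + K) * (rho + 1)) = e) by (unfold k; field; lra).
  nra.
Qed.

(** * Open mapping and local injectivity *)

(** If [w] were omitted, [1 / (g - w)] would be holomorphic and at most [2 / m] on the circle, yet
    larger than [2 / m] at the centre. *)
Lemma min_modulus_image g a s m w :
  (forall z, Cmod (z - a) <= s -> holo g z) ->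
  0 < s -> (forall z, Cmod (z - a) = s -> m <= Cmod (g z - g a)) ->
  Cmod (w - g a) < m / 2 -> exists z, Cmod (z - a) < s /\ g z = w.
Proof.
  intros H Hs Hm Hw. apply NNPP. intros N.
  assert (Hm0 : 0 < m) by (pose proof (Cmod_ge_0 (w - g a)); lra).
  assert (Bc : forall z, Cmod (z - a) = s -> m / 2 <= Cmod (g z - w)).
  { intros z Hz. specialize (Hm z Hz). pose proof (Cmod_sub_tri (g z) w (g a)). lra. }
  assert (Nz : forall z, Cmod (z - a) <= s -> (g z - w)%C <> 0).
  { intros z [Hz | Hz] E.
    - apply N. exists z. split; auto. apply Csub_eq_0, E.
    - specialize (Bc z Hz). rewrite E, Cmod_0 in Bc. lra. }
  assert (L : Cmod (/ (g a - w)) <= / (m / 2)).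
  { apply (mean_value_bound (fun z => / (g z - w))%C a s); auto.
    - intros z Hz. apply (holo_inv (fun z => g z - w)%C); auto. apply holo_sub_const; auto.
    - intros z Hz. rewrite Cmod_inv by (apply Nz; lra). apply Rinv_le_contravar. lra. auto. }
  assert (Na := Nz a ltac:(rewrite Cmod_sub_self; lra)).
  rewrite Cmod_inv in L by auto. rewrite (Cmod_sub_sym (g a) w) in L.
  apply Cmod_gt_0 in Na. rewrite (Cmod_sub_sym (g a) w) in Na.
  apply Rinv_lt_contravar in Hw. lra. apply Rmult_lt_0_compat; lra.
Qed.

Definition nonconstant (f : C -> C) : Prop := exists z w, f z <> f w.

Lemma prod_roots_bounds l (z : C) x y : 0 <= x ->
  (forall w, In w l -> x <= Cmod (z - w) <= y) ->
  x ^ length l <= Cmod (prod_roots l z) <= y ^ length l.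
Proof.
  intros Hx H. induction l; simpl.
  - rewrite Cmod_1. lra.
  - rewrite Cmod_mult. destruct IHl as [I1 I2]. intros; apply H; right; auto.
    destruct (H a (or_introl eq_refl)) as [J1 J2].
    pose proof (Cmod_ge_0 (z - a)). pose proof (pow_le x (length l) Hx).
    split; apply Rmult_le_compat; auto using Cmod_ge_0.
Qed.

(** Divide [f - c] by [n] zeros near [a]: each factor is at least [rho / 2] on a large circle but at
    most [rho / 4] at [b], so [|f b - c| <= M / 2^n] for every [n]. *)
Lemma entire_many_zeros_const f a c s0 :
  (forall z, holo f z) ->
  (forall n, exists l, NoDup l /\ length l = n /\ forall z, In z l -> Cmod (z - a) < s0 /\ f z = c) ->
  forall b, f b = c.
Proof.
  intros H HZ b.
  assert (Hs0 : 0 < s0).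
  { destruct (HZ 1%nat) as [[|z l] [_ [Hl Q]]]. discriminate.
    destruct (Q z (or_introl eq_refl)). pose proof (Cmod_ge_0 (z - a)). lra. }
  set (rho := 8 * (s0 + Cmod (b - a) + 1)).
  pose proof (Cmod_ge_0 (b - a)) as Pb.
  assert (Hr : rho = 8 * (s0 + Cmod (b - a) + 1)) by reflexivity. clearbody rho.
  destruct (ccompact_bound _ (fun z => f z - c)%C (ccompact_circle a rho)) as [M HM].
  { intros z _. apply holo_ccont, holo_sub_const, H. }
  apply Cmod_sub_lt_eps_eq. intros e He.
  assert (HM0 : 0 <= M).
  { apply Rle_trans with (2 := HM (a + RtoC rho)%C ltac:(replace (a + RtoC rho - a)%C with (RtoC rho) by ring; rewrite Cmod_R, Rabs_pos_eq; lra)).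
    apply Cmod_ge_0. }
  destruct (pow_lt_1_zero (/ 2) ltac:(rewrite Rabs_pos_eq; lra) (e / (M + 1))) as [n Hn].
  { apply Rdiv_lt_0_compat; lra. }
  specialize (Hn n (Nat.le_refl n)). rewrite Rabs_pos_eq in Hn by (apply pow_le; lra).
  destruct (HZ n) as [l [ND [Hl HL]]].
  assert (P2 : 0 < (rho / 2) ^ n) by (apply pow_lt; lra).
  assert (L : Cmod (f b - c) * (rho / 2) ^ n <= Cmod (prod_roots l b) * M).
  { apply (divide_by_zeros (fun z => f z - c)%C a rho); auto.
    - intros z _. apply holo_sub_const, H.
    - intros z Iz. destruct (HL z Iz) as [L1 L2]. split. lra. rewrite L2. ring.
    - intros z Hz. rewrite <- Hl. apply (prod_roots_bounds l z (rho / 2) (rho + s0)). lra.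
      intros w Iw. destruct (HL w Iw) as [L1 _].
      pose proof (Cmod_sub_tri z w a). pose proof (Cmod_sub_tri z a w).
      rewrite (Cmod_sub_sym a w) in H1. lra.
    - lra. }
  assert (U : Cmod (prod_roots l b) <= (rho / 4) ^ n).
  { rewrite <- Hl. apply (prod_roots_bounds l b 0). lra. intros w Iw. split. apply Cmod_ge_0.
    destruct (HL w Iw) as [L1 _]. pose proof (Cmod_sub_tri b a w).
    rewrite (Cmod_sub_sym a w) in H0. lra. }
  replace (rho / 4) with (rho / 2 * / 2) in U by field. rewrite Rpow_mult_distr in U.
  apply (Rmult_le_reg_r ((rho / 2) ^ n)); auto.
  eapply Rle_trans. apply L. apply Rle_trans with ((rho / 2) ^ n * (/ 2) ^ n * M).
  apply Rmult_le_compat_r; auto.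
  rewrite Rmult_assoc, (Rmult_comm e). apply Rmult_le_compat_l. lra.
  apply (Rmult_lt_compat_r (M + 1)) in Hn; [|lra].
  replace (e / (M + 1) * (M + 1)) with e in Hn by (field; lra).
  assert (0 < (/ 2) ^ n) by (apply pow_lt; lra). nra.
Qed.

(** Otherwise the value [f a] is taken on each circle of radius below [s0]. The increasing radii
    [s0 * n / (n + 1)] then produce arbitrarily many distinct zeros of [f - f a] in a fixed disc, so
    [f] is constant. *)
Lemma nonconst_circle f a s0 : (forall z, holo f z) -> nonconstant f -> 0 < s0 ->
  exists s, 0 < s < s0 /\ forall z, Cmod (z - a) = s -> f z <> f a.
Proof.
  intros H [z1 [z2 N]] Hs0. apply NNPP. intros Q.
  assert (HS : forall s, 0 < s < s0 -> exists z, Cmod (z - a) = s /\ f z = f a).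
  { intros s Hs. apply NNPP. intros X. apply Q. exists s. split; auto. intros z Hz E. apply X. eauto. }
  assert (C1 : forall b, f b = f a).
  { apply (entire_many_zeros_const f a (f a) s0 H).
    assert (HL : forall n, exists l, NoDup l /\ length l = n /\
      forall z, In z l -> Cmod (z - a) < s0 * INR (S n) / (INR (S n) + 1) /\ f z = f a).
    { induction n.
      - exists nil. split. constructor. split; auto. intros z [].
      - destruct IHn as [l [ND [Hl HL]]].
        assert (Pn := pos_INR (S n)).
        assert (E : s0 * INR (S n) / (INR (S n) + 1) < s0 * INR (S (S n)) / (INR (S (S n)) + 1)).
        { rewrite (S_INR (S n)). apply (Rmult_lt_reg_r ((INR (S n) + 1) * (INR (S n) + 1 + 1))). nra.
          field_simplify; nra. }
        destruct (HS (s0 * INR (S n) / (INR (S n) + 1))) as [z [Hz Fz]].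
        { split. apply Rdiv_lt_0_compat. apply Rmult_lt_0_compat; auto. apply lt_0_INR; lia. lra.
          apply (Rmult_lt_reg_r (INR (S n) + 1)). lra. field_simplify; lra. }
        exists (z :: l). split; [|split].
        + constructor; auto. intros I. destruct (HL z I). lra.
        + simpl. auto.
        + intros y [<- | I]. split; auto. lra. destruct (HL y I). split; auto. lra. }
    intros n. destruct (HL n) as [l [ND [Hl HL']]]. exists l. split; auto. split; auto.
    intros z I. destruct (HL' z I) as [L1 L2]. split; auto. eapply Rlt_le_trans. apply L1.
    assert (Pn := pos_INR (S n)).
    apply (Rmult_le_reg_r (INR (S n) + 1)). lra. field_simplify; lra. }
  apply N. rewrite (C1 z1), (C1 z2). auto.
Qed.

Lemma open_mapping f a e : (forall z, holo f z) -> nonconstant f -> 0 < e ->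
  exists m, 0 < m /\ forall w, Cmod (w - f a) < m -> exists z, Cmod (z - a) < e /\ f z = w.
Proof.
  intros H N He. destruct (nonconst_circle f a e H N He) as [s [Hs Hn]].
  destruct (ccompact_min _ (fun z => f z - f a)%C (ccompact_circle a s)) as [m [Hm Hb]].
  { intros z _. apply holo_ccont, holo_sub_const, H. }
  { intros z Hz E. apply (Hn z Hz), Csub_eq_0, E. }
  exists (m / 2). split. lra. intros w Hw.
  destruct (min_modulus_image f a s m w) as [z [Hz Ez]]; auto. lra.
  exists z. split; auto. lra.
Qed.

(** Without its linear part, [f] is at most [|l| / 8 * (d / 2)] on the circle of radius [d / 2],
    hence Lipschitz with constant [|l| / 2] on the disc of half that radius. This leaves half of the
    linear term. *)
Lemma local_injectivity f z0 l : (forall z, holo f z) -> cdiff f z0 l -> l <> 0 ->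
  exists d, 0 < d /\ forall a z, Cmod (a - z0) < d -> Cmod (z - z0) < d ->
    Cmod l / 2 * Cmod (z - a) <= Cmod (f z - f a).
Proof.
  intros H Hl Nl. assert (Pl := Nl). apply Cmod_gt_0 in Pl.
  destruct (cdiff_bound f z0 l Hl (Cmod l / 8)) as [d [Hd Hb]]. lra.
  set (g := fun z => (f z - f z0 - l * (z - z0))%C).
  exists (d / 4). split. lra. intros a z Ha Hz.
  assert (Hg : forall z, holo g z).
  { intros y. apply (holo_plus (fun y => f y - f z0)%C (fun y => - (l * (y - z0)))%C).
    apply holo_sub_const; auto.
    apply (holo_ext_loc (fun y => (- l) * (y - z0))%C _ _ 1). lra. intros; ring.
    apply (holo_mult (fun _ => - l)%C (fun y => y - z0)%C). apply holo_const.
    apply (holo_sub_const (fun y => y)). apply holo_id. }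
  assert (L := lipschitz_of_bound g z0 (d / 2) (Cmod l / 8 * (d / 2)) a z
    (fun y _ => Hg y) ltac:(intros y Hy; rewrite <- Hy; apply Hb; lra) ltac:(lra) ltac:(lra)).
  replace (4 * (Cmod l / 8 * (d / 2)) / (d / 2)) with (Cmod l / 2) in L by (field; lra).
  replace (g z - g a)%C with ((f z - f a) - l * (z - a))%C in L by (unfold g; ring).
  pose proof (Cmod_sub_ge (l * (z - a)) (f z - f a)) as T. rewrite Cmod_mult in T.
  rewrite (Cmod_sub_sym (l * (z - a)) (f z - f a)) in T. lra.
Qed.

(** * Bloch's theorem *)

Lemma segment_lipschitz f (a b : C) D :
  (forall t, 0 <= t <= 1 -> exists l, cdiff f (a + RtoC t * (b - a)) l /\ Cmod l <= D) ->
  Cmod (f b - f a) <= D * Cmod (b - a).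
Proof.
  intros H.
  set (g := fun t => (a + RtoC t * (b - a))%C).
  assert (Hc : exists L : R -> C, forall t, 0 <= t <= 1 -> cdiff f (g t) (L t) /\ Cmod (L t) <= D).
  { apply (choice (fun t l => 0 <= t <= 1 -> cdiff f (g t) l /\ Cmod l <= D)).
    intros t. destruct (classic (0 <= t <= 1)) as [Ht | Ht].
    destruct (H t Ht) as [l Hl]. exists l. auto. exists (RtoC 0). tauto. }
  destruct Hc as [L HL].
  set (u := (f b - f a)%C).
  (* Projecting [f] onto the direction [u = f b - f a] reduces the claim to the real mean value
     theorem, since [h 1 - h 0 = |u|^2]. *)
  set (h := fun t => fst (Cconj u * f (g t))%C).
  assert (Hd : forall t, 0 <= t <= 1 -> is_derive h t (fst (Cconj u * (L t * (b - a)))%C)).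
  { intros t Ht. destruct (HL t Ht) as [Dt _]. apply is_derive_Reals. intros e He.
    set (A := Cmod u * Cmod (b - a)). pose proof (Cmod_ge_0 u). pose proof (Cmod_ge_0 (b - a)).
    assert (HA : 0 <= A) by (apply Rmult_le_pos; auto).
    set (k := e / (A + 1)). assert (Hk : 0 < k) by (apply Rdiv_lt_0_compat; lra).
    assert (HkA : k * A < e).
    { assert (k * (A + 1) = e) by (unfold k; field; lra). lra. }
    destruct (cdiff_bound f (g t) (L t) Dt k Hk) as [d [Hd Hb]].
    assert (Hd' : 0 < d / (Cmod (b - a) + 1)) by (apply Rdiv_lt_0_compat; lra).
    exists (mkposreal _ Hd'). intros s Ns Hs. simpl in Hs.
    assert (Eg : (g (t + s)%R - g t = RtoC s * (b - a))%C) by (unfold g; rewrite RtoC_plus; ring).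
    assert (Mg : Cmod (g (t + s)%R - g t) = Rabs s * Cmod (b - a)) by (rewrite Eg, Cmod_mult, Cmod_R; auto).
    assert (Lg : Cmod (g (t + s)%R - g t) < d).
    { rewrite Mg. apply Rle_lt_trans with (Rabs s * (Cmod (b - a) + 1)).
      apply Rmult_le_compat_l. apply Rabs_pos. lra.
      apply (Rmult_lt_compat_r (Cmod (b - a) + 1)) in Hs; [|lra].
      replace (d / (Cmod (b - a) + 1) * (Cmod (b - a) + 1)) with d in Hs by (field; lra). auto. }
    specialize (Hb _ Lg). rewrite Mg in Hb. rewrite Eg in Hb.
    replace ((h (t + s) - h t) / s - fst (Cconj u * (L t * (b - a)))%C)
      with (fst (Cconj u * (f (g (t + s)%R) - f (g t) - L t * (RtoC s * (b - a))))%C / s).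
    2:{ unfold h. generalize (f (g (t + s))), (f (g t)), (L t), (Cconj u), (b - a)%C.
        intros [? ?] [? ?] [? ?] [? ?] [? ?]; simpl. field. auto. }
    unfold Rdiv. rewrite Rabs_mult, Rabs_inv.
    assert (Ps : 0 < Rabs s) by (apply Rabs_pos_lt; auto).
    apply (Rmult_lt_reg_r (Rabs s)); auto. rewrite Rmult_assoc, Rinv_l, Rmult_1_r by lra.
    eapply Rle_lt_trans. apply Cmod_fst_le. rewrite Cmod_mult, Cmod_conj.
    apply Rle_lt_trans with (Cmod u * (k * (Rabs s * Cmod (b - a)))).
    apply Rmult_le_compat_l; auto.
    replace (Cmod u * (k * (Rabs s * Cmod (b - a)))) with (k * A * Rabs s) by (unfold A; ring).
    apply Rmult_lt_compat_r; auto. }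
  destruct (MVT_gen h 0 1 (fun t => fst (Cconj u * (L t * (b - a)))%C)) as [c [Hc1 Hc2]].
  { rewrite Rmin_left, Rmax_right by lra. intros x Hx. apply Hd. lra. }
  { rewrite Rmin_left, Rmax_right by lra. intros x Hx.
    apply continuity_pt_filterlim. apply (ex_derive_continuous h x). eexists. apply Hd; auto. }
  rewrite Rmin_left, Rmax_right in Hc1 by lra.
  assert (E : h 1 - h 0 = Cmod u * Cmod u).
  { unfold h, g. replace (a + 1 * (b - a))%C with b by ring. replace (a + 0 * (b - a))%C with a by ring.
    rewrite Cmod_sqr. unfold u. destruct (f a), (f b); simpl. ring. }
  rewrite E in Hc2. destruct (HL c Hc1) as [_ Lc].
  assert (B : Cmod u * Cmod u <= Cmod u * (D * Cmod (b - a))).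
  { rewrite Hc2, Rminus_0_r, Rmult_1_r. eapply Rle_trans. apply Rle_abs.
    eapply Rle_trans. apply Cmod_fst_le. rewrite !Cmod_mult, Cmod_conj.
    apply Rmult_le_compat_l. apply Cmod_ge_0. apply Rmult_le_compat_r; auto. apply Cmod_ge_0. }
  fold u. destruct (Cmod_ge_0 u) as [P | P].
  - apply (Rmult_le_reg_l (Cmod u)); auto.
  - rewrite <- P. apply Rmult_le_pos. pose proof (Cmod_ge_0 (L c)); lra. apply Cmod_ge_0.
Qed.

Lemma convex_comb_disc (a b c : C) rho t : 0 <= t <= 1 -> Cmod (a - c) <= rho -> Cmod (b - c) <= rho ->
  Cmod (a + RtoC t * (b - a) - c) <= rho.
Proof.
  intros Ht Ha Hb.
  replace (a + RtoC t * (b - a) - c)%C with (RtoC (1 - t) * (a - c) + RtoC t * (b - c))%C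
    by (rewrite RtoC_minus; ring).
  eapply Rle_trans. apply Cmod_triangle. rewrite !Cmod_mult, !Cmod_R, !Rabs_pos_eq by lra. nra.
Qed.

(** Choose [w] where [|Phi'| * (rho - |w - z0|)] exceeds half its supremum [S]. On the disc of
    radius [t] about [w], half the distance to the circle, [|Phi'|] is then at most four times its
    value [M1] at [w], so at a small scale the linear term dominates and the image contains a disc
    about [Phi w]. *)
Lemma bloch Phi z0 rho l : 0 < rho -> (forall v, Cmod (v - z0) <= rho -> holo Phi v) ->
  cdiff Phi z0 l -> l <> 0 ->
  exists c, forall w, Cmod (w - c) < Cmod l * rho / 1536 ->
    exists v, Cmod (v - z0) < rho /\ Phi v = w.
Proof.
  intros Hr H Hl Nl. apply Cmod_gt_0 in Nl.
  destruct (ccompact_bound _ Phi (ccompact_disc z0 rho)) as [M HM].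
  { intros v Hv. apply holo_ccont; auto. }
  set (E := fun x => exists v l', Cmod (v - z0) < rho /\ cdiff Phi v l' /\ x = Cmod l' * (rho - Cmod (v - z0))).
  assert (E0 : E (Cmod l * rho)).
  { exists z0, l. rewrite Cmod_sub_self, Rminus_0_r. auto. }
  destruct (completeness E) as [S [SU SL]].
  { exists (4 * M). intros x [v [l' [Hv [Hl' ->]]]].
    assert (B : Cmod l' <= 4 * M / (rho - Cmod (v - z0))).
    { apply (cauchy_estimate Phi v); auto. lra.
      - intros y Hy. apply H. pose proof (Cmod_sub_tri y v z0). lra.
      - intros y Hy. apply HM. pose proof (Cmod_sub_tri y v z0). lra. }
    apply (Rmult_le_compat_r (rho - Cmod (v - z0))) in B; [|lra].
    replace (4 * M / (rho - Cmod (v - z0)) * (rho - Cmod (v - z0))) with (4 * M) in B by (field; lra). auto. }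
  { exists (Cmod l * rho); auto. }
  assert (HS : Cmod l * rho <= S) by (apply SU; auto).
  assert (HS0 : 0 < Cmod l * rho) by (apply Rmult_lt_0_compat; auto).
  assert (Hex : exists x, E x /\ S / 2 < x).
  { apply NNPP. intros N. assert (S <= S / 2). apply SL. intros x Ex. apply Rnot_lt_le. intros L. apply N. eauto. lra. }
  destruct Hex as [x [[w [l1 [Hw [Hl1 Ex]]]] Lx]].
  set (M1 := Cmod l1) in *. set (t := (rho - Cmod (w - z0)) / 2).
  assert (Ht : 0 < t) by (unfold t; lra).
  assert (Ex' : x = M1 * (2 * t)) by (rewrite Ex; unfold t; field).
  assert (HM1 : 0 <= M1) by apply Cmod_ge_0.
  assert (Dv : forall v l', Cmod (v - w) <= t -> cdiff Phi v l' -> Cmod l' <= 4 * M1).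
  { intros v l' Hv Dl'. pose proof (Cmod_sub_tri v w z0).
    assert (Cmod l' * (rho - Cmod (v - z0)) <= S).
    { apply SU. exists v, l'. split; auto. unfold t in Hv; lra. }
    pose proof (Cmod_ge_0 l'). assert (t <= rho - Cmod (v - z0)) by (unfold t in *; lra).
    assert (Cmod l' * t <= Cmod l' * (rho - Cmod (v - z0))) by (apply Rmult_le_compat_l; auto).
    apply (Rmult_le_reg_r t); auto. lra. }
  assert (In : forall v, Cmod (v - w) <= t -> Cmod (v - z0) <= rho).
  { intros v Hv. pose proof (Cmod_sub_tri v w z0). unfold t in *; lra. }
  assert (Bt : forall v, Cmod (v - w) <= t -> Cmod (Phi v - Phi w) <= 4 * M1 * Cmod (v - w)).
  { intros v Hv. apply segment_lipschitz. intros s Hs.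
    assert (Cs : Cmod (w + RtoC s * (v - w) - w) <= t).
    { apply convex_comb_disc; auto. rewrite Cmod_sub_self; lra. }
    destruct (H (w + RtoC s * (v - w))%C) as [l' Hl']. auto. exists l'. split; eauto. }
  (* The Taylor error at scale [s] is [48 * M1 * s^2 / t]; the factor 96 makes it half of the linear
     term [M1 * s]. *)
  set (s := t / 96).
  exists (Phi w). intros w' Hw'.
  destruct (min_modulus_image Phi w s (M1 * s / 2) w') as [v [Hv Ev]].
  - intros v Hv. apply H, In. unfold s in Hv; lra.
  - unfold s; lra.
  - intros v Hv.
    assert (T := taylor_quadratic (fun y => Phi y - Phi w)%C w t (4 * M1 * t) l1 v).
    assert (T' : Cmod (Phi v - Phi w - (Phi w - Phi w) - l1 * (v - w))
       <= 12 * (4 * M1 * t) / (t * t) * (Cmod (v - w) * Cmod (v - w))).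
    { apply T.
      - intros y Hy. apply holo_sub_const. apply H, In, Hy.
      - intros y Hy. rewrite <- Hy at 1. apply Bt. lra.
      - assert (X := cdiff_plus Phi (fun _ => - Phi w)%C w l1 0 Hl1 (cdiff_const _ _)).
        rewrite Cplus_0_r in X. exact X.
      - unfold s in Hv. lra. }
    rewrite Hv in T'.
    replace (12 * (4 * M1 * t) / (t * t) * (s * s)) with (M1 * s / 2) in T' by (unfold s; field; lra).
    replace (Phi v - Phi w - (Phi w - Phi w) - l1 * (v - w))%C with ((Phi v - Phi w) - l1 * (v - w))%C in T' by ring.
    pose proof (Cmod_sub_ge (l1 * (v - w)) (Phi v - Phi w)) as G.
    rewrite Cmod_mult, Hv in G. rewrite (Cmod_sub_sym (l1 * (v - w))) in G. fold M1 in G. lra.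
  (* The image disc has radius [x / 768], and [x > S / 2] turns 768 into 1536. *)
  - assert (M1 * s / 2 / 2 = M1 * (2 * t) / 768) by (unfold s; field). lra.
  - exists v. split; auto. pose proof (Cmod_sub_tri v w z0). unfold s, t in *. lra.
Qed.

(** * Lifting of maps on convex domains *)

(** The supremum of the initial intervals on which [Q] holds must be 1. For [t = 0] the inner
    hypothesis is void, so the base case is included. *)
Lemma real_induction (Q : R -> Prop) :
  (forall t, 0 <= t <= 1 -> (forall s, 0 <= s < t -> Q s) ->
     exists e, 0 < e /\ forall s, t <= s < t + e -> s <= 1 -> Q s) ->
  forall t, 0 <= t <= 1 -> Q t.
Proof.
  intros H.
  set (E := fun t => 0 <= t <= 1 /\ forall s, 0 <= s <= t -> Q s).
  destruct (H 0) as [e0 [He0 H0]]. lra. intros; lra.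
  assert (E0 : E 0). { split. lra. intros s Hs. apply H0; lra. }
  destruct (completeness E) as [T [TU TL]].
  { exists 1. intros t [Ht _]. lra. } { exists 0; auto. }
  assert (T0 : 0 <= T) by (apply TU; auto).
  assert (T1 : T <= 1). { apply TL. intros t [Ht _]. lra. }
  assert (B : forall s, 0 <= s < T -> Q s).
  { intros s Hs. apply NNPP. intros N. assert (T <= s). apply TL. intros t [Ht Qt].
    apply Rnot_lt_le. intros L. apply N, Qt. lra. lra. }
  destruct (H T) as [e [He HT]]; auto.
  set (T2 := Rmin 1 (T + e / 2)).
  assert (ET2 : E T2).
  { split. split. apply Rmin_glb; lra. apply Rmin_l.
    intros s Hs. assert (T2 <= 1) by apply Rmin_l. assert (T2 <= T + e / 2) by apply Rmin_r.
    destruct (Rlt_dec s T). apply B; lra. apply HT; lra. }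
  assert (T2 <= T) by (apply TU; auto).
  assert (T2 = 1). { unfold T2 in *. apply Rmin_left. apply Rnot_lt_le. intros L. rewrite Rmin_right in *; lra. }
  intros t Ht. apply ET2. lra.
Qed.

Definition seg (a b : C) (t : R) : C := (a + RtoC t * (b - a))%C.

Lemma seg_0 a b : seg a b 0 = a.
Proof. unfold seg. ring. Qed.
Lemma seg_1 a b : seg a b 1 = b.
Proof. unfold seg. ring. Qed.
Lemma seg_dist a b s t : Cmod (seg a b s - seg a b t) = Rabs (s - t) * Cmod (b - a).
Proof.
  unfold seg. replace (a + RtoC s * (b - a) - (a + RtoC t * (b - a)))%C with (RtoC (s - t) * (b - a))%C
    by (rewrite RtoC_minus; ring). rewrite Cmod_mult, Cmod_R; auto.
Qed.
Lemma seg_seg a b s t : seg a (seg a b s) t = seg a b (t * s).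
Proof. unfold seg. rewrite RtoC_mult. ring. Qed.

Definition local_sections (p : C -> C) (P : C -> Prop) : Prop :=
  forall z, P z -> exists d h g, 0 < d /\ 0 < h /\
    (forall w, Cmod (w - p z) < h -> Cmod (g w - z) < d /\ P (g w) /\ p (g w) = w /\ ccont g w) /\
    (forall z1 z2, Cmod (z1 - z) < d -> Cmod (z2 - z) < d -> p z1 = p z2 -> z1 = z2).

(** Agreement passes to limit times by continuity of both lifts, and beyond them by local
    injectivity of [p]. *)
Lemma unique_lift p P (L1 L2 : C -> C) a b : local_sections p P ->
  (forall t, 0 <= t <= 1 -> ccont L1 (seg a b t) /\ ccont L2 (seg a b t) /\ P (L1 (seg a b t)) /\
     p (L1 (seg a b t)) = p (L2 (seg a b t))) ->
  L1 a = L2 a -> L1 b = L2 b.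
Proof.
  intros HP H E. rewrite <- (seg_1 a b).
  apply (real_induction (fun t => L1 (seg a b t) = L2 (seg a b t))); [|lra].
  intros t Ht Q. destruct (H t Ht) as [C1 [C2 [Pz _]]].
  assert (D0 : 0 < Cmod (b - a) + 1) by (pose proof (Cmod_ge_0 (b - a)); lra).
  assert (Near : forall d s, 0 < d -> Rabs (s - t) < d / (Cmod (b - a) + 1) -> Cmod (seg a b s - seg a b t) < d).
  { intros d s Hd Hs. rewrite seg_dist. apply Rle_lt_trans with (Rabs (s - t) * (Cmod (b - a) + 1)).
    apply Rmult_le_compat_l. apply Rabs_pos. lra.
    apply (Rmult_lt_compat_r (Cmod (b - a) + 1)) in Hs; auto.
    replace (d / (Cmod (b - a) + 1) * (Cmod (b - a) + 1)) with d in Hs by (field; lra). auto. }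
  assert (Et : L1 (seg a b t) = L2 (seg a b t)).
  { destruct (Req_dec t 0) as [-> | Nt]. rewrite seg_0; auto.
    apply Cmod_sub_lt_eps_eq. intros e He.
    destruct (C1 (e / 2) ltac:(lra)) as [d1 [Hd1 H1]]. destruct (C2 (e / 2) ltac:(lra)) as [d2 [Hd2 H2]].
    set (d := Rmin d1 d2). assert (Hd : 0 < d) by (apply Rmin_glb_lt; auto).
    set (k := Rmin (t / 2) (d / (Cmod (b - a) + 1) / 2)).
    assert (Hq : 0 < d / (Cmod (b - a) + 1)) by (apply Rdiv_lt_0_compat; auto).
    assert (Hk : 0 < k) by (apply Rmin_glb_lt; lra).
    assert (K1 : k <= t / 2) by apply Rmin_l. assert (K2 : k <= d / (Cmod (b - a) + 1) / 2) by apply Rmin_r.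
    assert (N : Cmod (seg a b (t - k) - seg a b t) < d).
    { apply Near; auto. replace (t - k - t) with (- k) by ring. rewrite Rabs_Ropp, Rabs_pos_eq; lra. }
    specialize (Q (t - k) ltac:(lra)).
    specialize (H1 _ (Rlt_le_trans _ _ _ N (Rmin_l _ _))). specialize (H2 _ (Rlt_le_trans _ _ _ N (Rmin_r _ _))).
    rewrite <- Q in H2.
    pose proof (Cmod_sub_tri (L1 (seg a b t)) (L1 (seg a b (t - k))) (L2 (seg a b t))) as T.
    rewrite (Cmod_sub_sym (L1 (seg a b t)) (L1 (seg a b (t - k)))) in T. lra. }
  destruct (HP _ Pz) as [d [h [g [Hd [_ [_ Inj]]]]]].
  destruct (C1 d Hd) as [d1 [Hd1 H1]]. destruct (C2 d Hd) as [d2 [Hd2 H2]].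
  set (dd := Rmin d1 d2). assert (Hdd : 0 < dd) by (apply Rmin_glb_lt; auto).
  exists (dd / (Cmod (b - a) + 1)). split. apply Rdiv_lt_0_compat; auto.
  intros s Hs Hs1.
  assert (N : Cmod (seg a b s - seg a b t) < dd) by (apply Near; auto; rewrite Rabs_pos_eq; lra).
  apply Inj.
  - apply H1. eapply Rlt_le_trans. apply N. apply Rmin_l.
  - rewrite Et. apply H2. eapply Rlt_le_trans. apply N. apply Rmin_r.
  - apply H. lra.
Qed.

(** Lifting over neighbourhoods of initial pieces of the segment, rather than over the segment,
    makes the lifts continuous in the complex variable. *)
Definition tube (a b : C) (t e : R) (v : C) : Prop :=
  exists s, 0 <= s <= t /\ Cmod (v - seg a b s) < e.

(** Replaces evenly covered neighbourhoods: a local homeomorphism lifts paths as soon as a partial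
    lift cannot escape before its end time. A cluster point suffices, because a local section there
    already extends the lift. *)
Definition lift_limits (p e : C -> C) (P Om : C -> Prop) (a : C) : Prop :=
  forall b T lam, Om b -> 0 < T <= 1 ->
    (forall t, 0 <= t < T -> P (lam t) /\ p (lam t) = e (seg a b t) /\
       forall k, 0 < k -> exists d, 0 < d /\
         forall s, 0 <= s < T -> Rabs (s - t) < d -> Cmod (lam s - lam t) < k) ->
    exists z, P z /\ p z = e (seg a b T) /\
      forall k s, 0 < k -> 0 <= s < T -> exists t, s < t < T /\ Cmod (lam t - z) < k.

Definition is_lift (p e : C -> C) (P D : C -> Prop) (L : C -> C) : Prop :=
  forall v, D v -> P (L v) /\ p (L v) = e v /\ ccont L v.

(** Real induction on the end time. The lifts over shorter tubes agree on the segment and form one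
    path; at a cluster point of it a local section is glued to a lift over a slightly shorter tube.
    Passing beyond [t] only costs half of the tube's radius. *)
Lemma tube_lift p e (P Om : C -> Prop) (a b z0 : C) :
  (forall v, Om v -> exists k, 0 < k /\ forall y, Cmod (y - v) < k -> Om y) ->
  (forall v, Om v -> ccont e v) ->
  local_sections p P -> lift_limits p e P Om a -> P z0 -> p z0 = e a ->
  Om b -> (forall t, 0 <= t <= 1 -> Om (seg a b t)) ->
  exists k L, 0 < k /\ is_lift p e P (tube a b 1 k) L /\ L a = z0.
Proof.
  intros Oo He HP HL Pz0 Ez0 Hb Hs.
  set (Q := fun t => exists k L, 0 < k /\ is_lift p e P (tube a b t k) L /\ L a = z0).
  change (Q 1).
  assert (D0 : 0 < Cmod (b - a) + 1) by (pose proof (Cmod_ge_0 (b - a)); lra).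
  pose proof (Cmod_ge_0 (b - a)) as Pab.
  assert (Loc : forall t z, 0 <= t <= 1 -> P z -> p z = e (seg a b t) ->
    exists d k g, 0 < d /\ 0 < k /\
      (forall v, Cmod (v - seg a b t) < k -> Cmod (g v - z) < d /\ P (g v) /\ p (g v) = e v /\ ccont g v) /\
      (forall z1 z2, Cmod (z1 - z) < d -> Cmod (z2 - z) < d -> p z1 = p z2 -> z1 = z2)).
  { intros t z Ht Pz Ez. destruct (HP z Pz) as [d [h [g [Hd [Hh [Hg Inj]]]]]].
    destruct (Oo _ (Hs t Ht)) as [k1 [Hk1 O1]].
    destruct (He _ (Hs t Ht) h Hh) as [k2 [Hk2 O2]].
    exists d, (Rmin k1 k2), (fun v => g (e v)). split; auto. split. apply Rmin_glb_lt; auto.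
    split; auto. intros v Hv.
    assert (V1 : Cmod (v - seg a b t) < k1) by (eapply Rlt_le_trans; [apply Hv | apply Rmin_l]).
    assert (V2 : Cmod (v - seg a b t) < k2) by (eapply Rlt_le_trans; [apply Hv | apply Rmin_r]).
    specialize (O2 v V2). rewrite <- Ez in O2. destruct (Hg (e v) O2) as [G1 [G2 [G3 G4]]].
    split; auto. split; auto. split; auto. apply (ccont_comp g e); auto. }
  assert (Q0 : Q 0).
  { destruct (Loc 0 z0) as [d [k [g [Hd [Hk [Hg Inj]]]]]]; auto. lra. rewrite seg_0; auto.
    exists k, g. split; auto. split.
    - intros v [s [Hs' Hv]]. apply Hg. replace 0 with s by lra. auto.
    - rewrite seg_0 in Hg. destruct (Hg a) as [G1 [_ [G3 _]]]. rewrite Cmod_sub_self; auto.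
      apply Inj; auto. rewrite Cmod_sub_self; auto. congruence. }
  assert (Cons : forall t1 t2 k1 k2 L1 L2 s, 0 < k1 -> 0 < k2 ->
    is_lift p e P (tube a b t1 k1) L1 -> is_lift p e P (tube a b t2 k2) L2 ->
    L1 a = z0 -> L2 a = z0 -> 0 <= s -> s <= t1 -> s <= t2 -> L1 (seg a b s) = L2 (seg a b s)).
  { intros t1 t2 k1 k2 L1 L2 s K1 K2 I1 I2 E1 E2 S0 S1 S2.
    apply (unique_lift p P L1 L2 a); auto. 2: congruence.
    intros t Ht. rewrite seg_seg.
    assert (0 <= t * s <= s) by nra.
    assert (U1 : tube a b t1 k1 (seg a b (t * s))).
    { exists (t * s). split. lra. rewrite Cmod_sub_self; auto. }
    assert (U2 : tube a b t2 k2 (seg a b (t * s))).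
    { exists (t * s). split. lra. rewrite Cmod_sub_self; auto. }
    destruct (I1 _ U1) as [? [? ?]]. destruct (I2 _ U2) as [? [? ?]].
    split; auto. split; auto. split; auto. congruence. }
  assert (Step : forall t, 0 < t <= 1 -> (forall s, 0 <= s < t -> Q s) -> Q t).
  { intros t Ht QB.
    assert (Ch : forall s, exists kL : R * (C -> C), 0 <= s < t ->
      0 < fst kL /\ is_lift p e P (tube a b s (fst kL)) (snd kL) /\ snd kL a = z0).
    { intros s. destruct (classic (0 <= s < t)) as [S1 | S1].
      - destruct (QB s S1) as [k [L HkL]]. exists (k, L). auto.
      - exists (0, fun z => z). tauto. }
    apply choice in Ch. destruct Ch as [kL HkL].
    set (lam := fun s => snd (kL s) (seg a b s)).
    assert (Lam : forall s s', 0 <= s' <= s -> s < t -> lam s' = snd (kL s) (seg a b s')).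
    { intros s s' S1 S2. unfold lam.
      destruct (HkL s ltac:(lra)) as [K1 [I1 E1]]. destruct (HkL s' ltac:(lra)) as [K2 [I2 E2]].
      apply (Cons s' s (fst (kL s')) (fst (kL s))); auto; lra. }
    destruct (HL b t lam) as [z [Pz [Ez Hz]]]; auto.
    { intros s S1. destruct (HkL s S1) as [K1 [I1 E1]].
      assert (U1 : tube a b s (fst (kL s)) (seg a b s)).
      { exists s. split. lra. rewrite Cmod_sub_self; auto. }
      destruct (I1 _ U1) as [X1 [X2 _]]. split; auto. split; auto.
      intros k Hk. set (s2 := (s + t) / 2).
      assert (S2 : s < s2 < t) by (unfold s2; lra).
      destruct (HkL s2 ltac:(lra)) as [K2 [I2 E2]].
      assert (U2 : tube a b s2 (fst (kL s2)) (seg a b s)).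
      { exists s. split. lra. rewrite Cmod_sub_self; auto. }
      destruct (I2 _ U2) as [_ [_ C2]]. destruct (C2 k Hk) as [d [Hd Hd']].
      exists (Rmin (s2 - s) (d / (Cmod (b - a) + 1))). split. apply Rmin_glb_lt. lra. apply Rdiv_lt_0_compat; auto.
      intros s' S' Hs'. pose proof (Rmin_l (s2 - s) (d / (Cmod (b - a) + 1))). pose proof (Rmin_r (s2 - s) (d / (Cmod (b - a) + 1))).
      assert (s' <= s2) by (pose proof (Rle_abs (s' - s)); lra).
      rewrite (Lam s2 s'), (Lam s2 s) by lra. apply Hd'. rewrite seg_dist.
      apply Rle_lt_trans with (Rabs (s' - s) * (Cmod (b - a) + 1)).
      apply Rmult_le_compat_l. apply Rabs_pos. lra.
      assert (Hs2 : Rabs (s' - s) < d / (Cmod (b - a) + 1)) by lra.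
      apply (Rmult_lt_compat_r (Cmod (b - a) + 1)) in Hs2; auto.
      replace (d / (Cmod (b - a) + 1) * (Cmod (b - a) + 1)) with d in Hs2 by (field; lra). auto. }
    destruct (Loc t z) as [d [k [g [Hd [Hk [Hg Inj]]]]]]; auto. lra.
    destruct (Hz d (Rmax 0 (t - k / (Cmod (b - a) + 1)))) as [s [S1 S2]]; auto.
    { assert (0 < k / (Cmod (b - a) + 1)) by (apply Rdiv_lt_0_compat; auto).
      split. apply Rmax_l. apply Rmax_lub_lt; lra. }
    pose proof (Rmax_l 0 (t - k / (Cmod (b - a) + 1))). pose proof (Rmax_r 0 (t - k / (Cmod (b - a) + 1))).
    set (r := Cmod (seg a b s - seg a b t)).
    assert (Hr : r < k).
    { unfold r. rewrite seg_dist. rewrite Rabs_left by lra.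
      apply Rle_lt_trans with (- (s - t) * (Cmod (b - a) + 1)). apply Rmult_le_compat_l; lra.
      assert (Hs2 : - (s - t) < k / (Cmod (b - a) + 1)) by lra.
      apply (Rmult_lt_compat_r (Cmod (b - a) + 1)) in Hs2; auto.
      replace (k / (Cmod (b - a) + 1) * (Cmod (b - a) + 1)) with k in Hs2 by (field; lra). auto. }
    destruct (HkL s ltac:(lra)) as [K1 [I1 E1]].
    set (k1 := fst (kL s)) in *. set (L := snd (kL s)) in *.
    assert (Us : tube a b s k1 (seg a b s)). { exists s. split. lra. rewrite Cmod_sub_self; auto. }
    assert (Eg : g (seg a b s) = L (seg a b s)).
    { destruct (Hg _ Hr) as [G1 [_ [G3 _]]]. apply Inj; auto. rewrite G3. symmetry. apply I1; auto. }
    (* The old tube and the new disc are both convex and contain [seg a b s], so the straight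
       segment from there to [v] stays in both. *)
    assert (Agree : forall v, tube a b s k1 v -> Cmod (v - seg a b t) < k -> g v = L v).
    { intros v [s1 [Hs1 Hv]] Hvk. symmetry. apply (unique_lift p P L g (seg a b s) v); auto.
      intros tau Htau. set (y := seg (seg a b s) v tau).
      assert (Ty : tube a b s k1 y).
      { exists (s + tau * (s1 - s)). split. nra.
        replace (y - seg a b (s + tau * (s1 - s)))%C with (RtoC tau * (v - seg a b s1))%C.
        rewrite Cmod_mult, Cmod_R, Rabs_pos_eq by lra. pose proof (Cmod_ge_0 (v - seg a b s1)).
        apply Rle_lt_trans with (1 * Cmod (v - seg a b s1)). apply Rmult_le_compat_r; lra. lra.
        unfold y, seg. rewrite RtoC_plus, RtoC_mult, RtoC_minus. ring. }
      assert (By : Cmod (y - seg a b t) < k).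
      { apply Rle_lt_trans with (Rmax r (Cmod (v - seg a b t))).
        apply convex_comb_disc; auto. apply Rmax_l. apply Rmax_r. apply Rmax_lub_lt; auto. }
      destruct (I1 y Ty) as [? [? ?]]. destruct (Hg y By) as [? [? [? ?]]].
      split; auto. split; auto. split; auto. congruence. }
    set (L' := fun v => if Rlt_dec (Cmod (v - seg a b t)) k then g v else L v).
    (* With radius at most [k - r], a point of the new tube near a time later than [s] lies in the
       disc where [g] is defined. *)
    exists (Rmin k1 (k - r)), L'. split. apply Rmin_glb_lt; lra. split.
    - intros v [s1 [Hs1 Hv]].
      destruct (Rlt_dec (Cmod (v - seg a b t)) k) as [Lv | Lv].
      + destruct (Hg v Lv) as [_ [G2 [G3 G4]]].
        assert (Ev : L' v = g v) by (unfold L'; destruct (Rlt_dec (Cmod (v - seg a b t)) k); tauto).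
        rewrite Ev. split; auto. split; auto.
        apply (ccont_ext_loc g L' v (k - Cmod (v - seg a b t))); auto. lra.
        intros y Hy. unfold L'. destruct (Rlt_dec (Cmod (y - seg a b t)) k) as [Ly | Ly]; auto.
        exfalso. apply Ly. pose proof (Cmod_sub_tri y v (seg a b t)). lra.
      + assert (S3 : s1 <= s).
        { apply Rnot_lt_le. intros Ls. apply Lv.
          eapply Rle_lt_trans. apply (Cmod_sub_tri v (seg a b s1)).
          assert (Cmod (seg a b s1 - seg a b t) <= r).
          { unfold r. rewrite !seg_dist. apply Rmult_le_compat_r; auto.
            rewrite !Rabs_left1 by lra. lra. }
          pose proof (Rmin_r k1 (k - r)). lra. }
        assert (Hv1 : Cmod (v - seg a b s1) < k1) by (eapply Rlt_le_trans; [apply Hv | apply Rmin_l]).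
        assert (Tv : tube a b s k1 v) by (exists s1; split; auto; lra).
        destruct (I1 v Tv) as [X1 [X2 X3]].
        assert (Ev : L' v = L v) by (unfold L'; destruct (Rlt_dec (Cmod (v - seg a b t)) k); tauto).
        rewrite Ev. split; auto. split; auto.
        apply (ccont_ext_loc L L' v (k1 - Cmod (v - seg a b s1))); auto. lra.
        intros y Hy. unfold L'. destruct (Rlt_dec (Cmod (y - seg a b t)) k) as [Ly | Ly]; auto.
        symmetry. apply Agree; auto. exists s1. split. lra.
        pose proof (Cmod_sub_tri y v (seg a b s1)). lra.
    - unfold L'. destruct (Rlt_dec (Cmod (a - seg a b t)) k) as [La | La]; auto.
      rewrite Agree; auto. exists 0. split. lra. rewrite seg_0, Cmod_sub_self; auto. }
  apply (real_induction Q); [|lra]. intros t Ht QB.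
  assert (Qt : Q t). { destruct (Req_dec t 0) as [-> | N]; auto. apply Step; auto. lra. }
  destruct Qt as [k [L [Hk [HLt EL]]]].
  exists (k / 2 / (Cmod (b - a) + 1)). split. apply Rdiv_lt_0_compat; lra.
  intros s S1 S2. exists (k / 2), L. split. lra. split; auto.
  intros v [s1 [Hs1 Hv]]. apply HLt.
  destruct (Rle_dec s1 t) as [C | C].
  - exists s1. split; lra.
  - exists t. split. lra. eapply Rle_lt_trans. apply (Cmod_sub_tri v (seg a b s1)).
    rewrite seg_dist, Rabs_pos_eq by lra.
    assert ((s1 - t) * Cmod (b - a) <= k / 2).
    { apply Rle_trans with ((s1 - t) * (Cmod (b - a) + 1)). apply Rmult_le_compat_l; lra.
      apply Rle_trans with (k / 2 / (Cmod (b - a) + 1) * (Cmod (b - a) + 1)).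
      apply Rmult_le_compat_r; lra. right; field; lra. }
    lra.
Qed.

(** The value at [b] is read off from a lift over a tube about the segment from [a] to [b]. For [y]
    near [b] the segment to [y] lies in the same tube, and uniqueness of lifts gives continuity at
    [b]. *)
Lemma convex_lift p e (P Om : C -> Prop) (a z0 : C) :
  (forall v, Om v -> exists k, 0 < k /\ forall y, Cmod (y - v) < k -> Om y) ->
  (forall b t, Om b -> 0 <= t <= 1 -> Om (seg a b t)) ->
  (forall v, Om v -> ccont e v) ->
  local_sections p P -> lift_limits p e P Om a -> Om a -> P z0 -> p z0 = e a ->
  exists Phi, Phi a = z0 /\ is_lift p e P Om Phi.
Proof.
  intros Oo Oc He HP HL Oa Pz0 Ez0.
  assert (Ch : forall b, exists kL : R * (C -> C), Om b ->
      0 < fst kL /\ is_lift p e P (tube a b 1 (fst kL)) (snd kL) /\ snd kL a = z0).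
  { intros b. destruct (classic (Om b)) as [Ob | Ob].
    - destruct (tube_lift p e P Om a b z0) as [k [L H]]; auto. exists (k, L). auto.
    - exists (0, fun z => z). tauto. }
  apply choice in Ch. destruct Ch as [kL H].
  exists (fun b => snd (kL b) b). split. apply H; auto.
  intros b Ob. destruct (H b Ob) as [K1 [I1 E1]].
  set (k := fst (kL b)) in *. set (L := snd (kL b)) in *.
  assert (Tb : tube a b 1 k b). { exists 1. split. lra. rewrite seg_1, Cmod_sub_self; auto. }
  destruct (I1 b Tb) as [X1 [X2 X3]]. split; auto. split; auto.
  destruct (Oo b Ob) as [k2 [K2 O2]].
  apply (ccont_ext_loc L _ b (Rmin k k2)); auto. apply Rmin_glb_lt; auto.
  intros y Hy.
  assert (Y1 : Cmod (y - b) < k) by (eapply Rlt_le_trans; [apply Hy | apply Rmin_l]).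
  assert (Oy : Om y) by (apply O2; eapply Rlt_le_trans; [apply Hy | apply Rmin_r]).
  destruct (H y Oy) as [K3 [I3 E3]].
  apply (unique_lift p P L (snd (kL y)) a y); auto. 2: congruence.
  intros t Ht.
  assert (T1 : tube a b 1 k (seg a y t)).
  { exists t. split; auto. unfold seg.
    replace (a + RtoC t * (y - a) - (a + RtoC t * (b - a)))%C with (RtoC t * (y - b))%C by ring.
    rewrite Cmod_mult, Cmod_R, Rabs_pos_eq by lra. pose proof (Cmod_ge_0 (y - b)).
    apply Rle_lt_trans with (1 * Cmod (y - b)). apply Rmult_le_compat_r; lra. lra. }
  assert (T2 : tube a y 1 (fst (kL y)) (seg a y t)).
  { exists t. split; auto. rewrite Cmod_sub_self; auto. }
  destruct (I1 _ T1) as [? [? ?]]. destruct (I3 _ T2) as [? [? ?]].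
  split; auto. split; auto. split; auto. congruence.
Qed.

(** * Logarithmic lifts over the complement of the singular values *)

Lemma IVT_on (h : R -> R) a b y : a <= b ->
  (forall t, a <= t <= b -> forall k, 0 < k -> exists d, 0 < d /\
     forall s, a <= s <= b -> Rabs (s - t) < d -> Rabs (h s - h t) < k) ->
  h a <= y <= h b -> exists c, a <= c <= b /\ h c = y.
Proof.
  intros Lab Hc Hy.
  (* Clamping turns continuity relative to [[a,b]] into continuity on the line. *)
  set (cl := fun t => Rmax a (Rmin t b)).
  assert (C1 : forall t, a <= cl t <= b).
  { intros t. split. apply Rmax_l. apply Rmax_lub; auto. apply Rmin_r. }
  assert (C2 : forall s t, Rabs (cl s - cl t) <= Rabs (s - t)).
  { intros s t. unfold cl, Rmax, Rmin.
    destruct (Rle_dec s b), (Rle_dec t b);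
    repeat (match goal with |- context [Rle_dec ?x ?y] => destruct (Rle_dec x y) end);
    unfold Rabs; repeat (match goal with |- context [Rcase_abs ?x] => destruct (Rcase_abs x) end); lra. }
  assert (C3 : forall t, a <= t <= b -> cl t = t).
  { intros t Ht. unfold cl. rewrite Rmin_left, Rmax_right; lra. }
  destruct (IVT_gen (fun t => h (cl t)) a b y) as [c [Hc1 Hc2]].
  - intros t k Hk. destruct (Hc (cl t) (C1 t) k Hk) as [d [Hd Hd']].
    exists d. split; auto. intros s [_ Hs]. apply Hd'; auto. eapply Rle_lt_trans. apply C2. exact Hs.
  - rewrite !C3 by lra. rewrite Rmin_left, Rmax_right; lra.
  - exists (cl c). auto.
Qed.

Lemma cluster_at_end T (u : R -> C) M : 0 < T ->
  (forall s, 0 <= s < T -> exists t, s < t < T /\ Cmod (u t) <= M) ->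
  exists z, forall k s, 0 < k -> 0 <= s < T -> exists t, s < t < T /\ Cmod (u t - z) < k.
Proof.
  intros HT H.
  assert (Sn : forall n : nat, 0 <= T - T / (INR n + 1) < T).
  { intros n. pose proof (pos_INR n). assert (0 < T / (INR n + 1)) by (apply Rdiv_lt_0_compat; lra).
    split; [|lra]. assert (T / (INR n + 1) <= T). apply (Rmult_le_reg_r (INR n + 1)). lra.
    field_simplify; nra. lra. }
  assert (Ch : forall n : nat, exists t, T - T / (INR n + 1) < t < T /\ Cmod (u t) <= M) by (intros; apply H; auto).
  apply (choice (fun n t => T - T / (INR n + 1) < t < T /\ Cmod (u t) <= M)) in Ch. destruct Ch as [tt Htt].
  destruct (bounded_seq_cluster (fun n => u (tt n)) M) as [z Hz]. { intros n. apply Htt. }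
  exists z. intros k s Hk Hs.
  destruct (INR_unbounded (T / (T - s))) as [N HN].
  destruct (Hz k N Hk) as [n [Hn1 Hn2]]. exists (tt n). split; auto.
  destruct (Htt n) as [[T1 T2] _]. split; auto. apply Rle_lt_trans with (2 := T1).
  apply le_INR in Hn1.
  assert (T / (INR n + 1) <= T - s); [|lra].
  apply (Rmult_le_reg_r (INR n + 1)). pose proof (pos_INR n); lra.
  replace (T / (INR n + 1) * (INR n + 1)) with T by (field; pose proof (pos_INR n); lra).
  assert (E : T = T / (T - s) * (T - s)) by (field; lra). rewrite E at 1.
  rewrite (Rmult_comm (T - s)). apply Rmult_le_compat_r; lra.
Qed.

Definition path_cont (u : R -> C) (T : R) : Prop :=
  forall t, 0 <= t < T -> forall k, 0 < k -> exists d, 0 < d /\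
    forall s, 0 <= s < T -> Rabs (s - t) < d -> Cmod (u s - u t) < k.

Lemma path_cont_comp f u T : path_cont u T -> (forall t, 0 <= t < T -> ccont f (u t)) ->
  path_cont (fun t => f (u t)) T.
Proof.
  intros Hu Hf t Ht k Hk. destruct (Hf t Ht k Hk) as [d [Hd H]].
  destruct (Hu t Ht d Hd) as [d2 [Hd2 H2]]. exists d2. split; auto.
Qed.

Lemma asymptotic_of_path f (sg : R -> C) (T : R) (w : C) : 0 < T -> path_cont sg T ->
  (forall X, exists s, 0 <= s < T /\ forall t, s < t < T -> X < Cmod (sg t)) ->
  (forall k, 0 < k -> exists s, 0 <= s < T /\ forall t, s < t < T -> Cmod (f (sg t) - w) < k) ->
  asymptotic_value f w.
Proof.
  intros HT Hc Hi Hw.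
  (* A Lipschitz reparametrization of the line with values in [[0,T)] that tends to [T] at infinity,
     as [asymptotic_value] asks for a curve on all of [R]. *)
  set (tau := fun x => T * (Rabs x / (1 + Rabs x))).
  assert (T1 : forall x, 0 <= tau x < T).
  { intros x. unfold tau. pose proof (Rabs_pos x).
    assert (0 <= Rabs x / (1 + Rabs x)) by (apply Rmult_le_pos; [auto | left; apply Rinv_0_lt_compat; lra]).
    assert (Rabs x / (1 + Rabs x) < 1) by (apply (Rmult_lt_reg_r (1 + Rabs x)); [lra | field_simplify; lra]).
    nra. }
  assert (T2 : forall x y, Rabs (tau x - tau y) <= T * Rabs (x - y)).
  { intros x y. unfold tau. pose proof (Rabs_pos x). pose proof (Rabs_pos y).
    replace (T * (Rabs x / (1 + Rabs x)) - T * (Rabs y / (1 + Rabs y)))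
      with (T * ((Rabs x - Rabs y) * / ((1 + Rabs x) * (1 + Rabs y)))) by (field; lra).
    assert (P : 1 <= (1 + Rabs x) * (1 + Rabs y)) by nra.
    rewrite Rabs_mult, (Rabs_pos_eq T) by lra. apply Rmult_le_compat_l. lra.
    rewrite Rabs_mult, (Rabs_pos_eq (/ _)) by (left; apply Rinv_0_lt_compat; lra).
    apply Rle_trans with (Rabs (x - y) * 1).
    apply Rmult_le_compat; auto using Rabs_pos. left; apply Rinv_0_lt_compat; lra.
    apply Rabs_triang_inv2. rewrite <- Rinv_1. apply Rinv_le_contravar; lra. lra. }
  assert (T3 : forall s, 0 <= s < T -> forall x, s / (T - s) < x -> s < tau x).
  { intros s Hs x Hx.
    assert (0 <= s / (T - s)) by (apply Rmult_le_pos; [lra | left; apply Rinv_0_lt_compat; lra]).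
    unfold tau. rewrite Rabs_pos_eq by lra. apply (Rmult_lt_reg_r (1 + x)). lra.
    replace (T * (x / (1 + x)) * (1 + x)) with (T * x) by (field; lra).
    assert (s / (T - s) * (T - s) = s) by (field; lra). nra. }
  exists (fun x => sg (tau x)). split; [|split].
  - intros x. apply filterlim_locally. intros k.
    destruct (Hc (tau x) (T1 x) k (cond_pos k)) as [d [Hd H]].
    assert (Hd' : 0 < d / T) by (apply Rdiv_lt_0_compat; auto).
    exists (mkposreal _ Hd'). intros y Hy.
    assert (B : Cmod (sg (tau y) - sg (tau x)) < k).
    { apply H; auto. eapply Rle_lt_trans. apply T2.
      assert (Hy' : Rabs (y - x) < d / T) by exact Hy.
      apply (Rmult_lt_compat_l T) in Hy'; auto. replace (T * (d / T)) with d in Hy' by (field; lra). auto. }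
    split.
    + eapply Rle_lt_trans. 2: apply B. apply (Cmod_fst_le (sg (tau y) - sg (tau x))).
    + eapply Rle_lt_trans. 2: apply B. apply (Cmod_snd_le (sg (tau y) - sg (tau x))).
  - intros Q [M HM]. destruct (Hi M) as [s [Hs H]].
    exists (s / (T - s)). intros x Hx. apply HM. apply H. split; auto. apply T1.
  - apply filterlim_locally. intros k. destruct (Hw k (cond_pos k)) as [s [Hs H]].
    exists (s / (T - s)). intros x Hx.
    assert (B : Cmod (f (sg (tau x)) - w) < k) by (apply H; split; auto; apply T1).
    split.
    + eapply Rle_lt_trans. 2: apply B. apply (Cmod_fst_le (f (sg (tau x)) - w)).
    + eapply Rle_lt_trans. 2: apply B. apply (Cmod_snd_le (f (sg (tau x)) - w)).
Qed.

(** The bound on [f 0] keeps 0, which has no logarithm, out of the preimage of [|w| > R0]. *)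
Definition regular_outside (f : C -> C) (R0 : R) : Prop :=
  (forall z, holo f z) /\ nonconstant f /\ 0 < R0 /\ Cmod (f 0) <= R0 /\
  (forall z l, R0 < Cmod (f z) -> cdiff f z l -> l <> 0) /\
  (forall w, R0 < Cmod w -> ~ asymptotic_value f w).

Definition flog (f : C -> C) (z : C) : C := f (cexp z).

Lemma cdiff_flog f z l : cdiff f (cexp z) l -> cdiff (flog f) z (l * cexp z).
Proof. intros H. apply (cdiff_comp f cexp); auto. apply cdiff_cexp. Qed.

Lemma holo_flog f : (forall z, holo f z) -> forall z, holo (flog f) z.
Proof. intros H z. apply (holo_comp f cexp). apply holo_cexp. auto. Qed.

(** [cexp] misses only 0, and a value of [f] at 0 that differs from [w] still differs from [w] at
    nearby points. *)
Lemma flog_nonconstant f : (forall z, holo f z) -> nonconstant f -> nonconstant (flog f).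
Proof.
  intros H [z1 [z2 N]].
  assert (K : forall z w, f z <> w -> exists v, flog f v <> w).
  { intros z w Nz. destruct (classic (z = 0)) as [E | E].
    - assert (Cf : ccont (fun y => f y - w)%C z) by (apply holo_ccont, holo_sub_const, H).
      destruct (ccont_neq_0 _ _ Cf) as [d [Hd Hd']]. intros Q. apply Nz, Csub_eq_0, Q.
      destruct (cexp_onto (RtoC (d / 2))) as [v Hv].
      { apply Cmod_gt_0. rewrite Cmod_R, Rabs_pos_eq; lra. }
      exists v. unfold flog. rewrite Hv. intros Q. specialize (Hd' (RtoC (d / 2))).
      rewrite Q in Hd'. replace (w - w)%C with (RtoC 0) in Hd' by ring. rewrite Cmod_0 in Hd'.
      pose proof (Cmod_ge_0 (f z - w)). assert (Cmod (f z - w) / 2 < 0); [|lra]. apply Hd'.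
      rewrite E. replace (RtoC (d / 2) - 0)%C with (RtoC (d / 2)) by ring. rewrite Cmod_R, Rabs_pos_eq; lra.
    - destruct (cexp_onto z E) as [v Hv]. exists v. unfold flog. rewrite Hv. auto. }
  destruct (K z1 (f z2) N) as [v Hv].
  destruct (K z2 (flog f v) ltac:(congruence)) as [v' Hv']. exists v', v. auto.
Qed.

(** Openness provides the section; the lower bound in [local_injectivity] makes it continuous. *)
Lemma entire_local_sections F (P : C -> Prop) :
  (forall z, holo F z) -> nonconstant F ->
  (forall z, P z -> exists k, 0 < k /\ forall y, Cmod (F y - F z) < k -> P y) ->
  (forall z l, P z -> cdiff F z l -> l <> 0) -> local_sections F P.
Proof.
  intros H N Po Hd z Pz. destruct (H z) as [l Hl]. assert (Nl := Hd z l Pz Hl).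
  destruct (local_injectivity F z l H Hl Nl) as [d [Hd0 Inj]].
  apply Cmod_gt_0 in Nl.
  destruct (open_mapping F z d H N Hd0) as [m [Hm Hop]].
  destruct (Po z Pz) as [k [Hk Hk']].
  assert (Ch : forall w, exists y, Cmod (w - F z) < m -> Cmod (y - z) < d /\ F y = w).
  { intros w. destruct (classic (Cmod (w - F z) < m)) as [L | L].
    - destruct (Hop w L) as [y Hy]. eauto.
    - exists z. tauto. }
  apply choice in Ch. destruct Ch as [g Hg].
  exists d, (Rmin m k), g. split; auto. split. apply Rmin_glb_lt; auto. split.
  - intros w Hw.
    assert (W1 : Cmod (w - F z) < m) by (eapply Rlt_le_trans; [apply Hw | apply Rmin_l]).
    assert (W2 : Cmod (w - F z) < k) by (eapply Rlt_le_trans; [apply Hw | apply Rmin_r]).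
    destruct (Hg w W1) as [G1 G2]. split; auto. split. apply Hk'. rewrite G2; auto. split; auto.
    intros e He. exists (Rmin (m - Cmod (w - F z)) (Cmod l / 2 * e)). split.
    apply Rmin_glb_lt. lra. apply Rmult_lt_0_compat; lra.
    intros y Hy. pose proof (Rmin_l (m - Cmod (w - F z)) (Cmod l / 2 * e)).
    pose proof (Rmin_r (m - Cmod (w - F z)) (Cmod l / 2 * e)).
    pose proof (Cmod_sub_tri y w (F z)).
    destruct (Hg y ltac:(lra)) as [Y1 Y2].
    specialize (Inj (g w) (g y) G1 Y1). rewrite G2, Y2 in Inj.
    apply (Rmult_lt_reg_l (Cmod l / 2)); lra.
  - intros z1 z2 Z1 Z2 E. specialize (Inj z2 z1 Z2 Z1). rewrite E, Cmod_sub_self in Inj.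
    apply Csub_eq_0, Cmod_eq_0. pose proof (Cmod_ge_0 (z1 - z2)). nra.
Qed.

Lemma flog_local_sections f R0 : regular_outside f R0 ->
  local_sections (flog f) (fun z => R0 < Cmod (flog f z)).
Proof.
  intros [H [N [HR [_ [Hcr _]]]]]. apply entire_local_sections.
  - apply holo_flog, H.
  - apply flog_nonconstant; auto.
  - intros z Hz. exists (Cmod (flog f z) - R0). split. lra. intros y Hy.
    pose proof (Cmod_sub_ge (flog f z) (flog f y)) as T.
    rewrite (Cmod_sub_sym (flog f z)) in T. lra.
  - intros z l Hz Hl. destruct (H (cexp z)) as [m Hm].
    assert (E := cdiff_unique _ _ _ _ Hl (cdiff_flog f z m Hm)). rewrite E.
    apply Cmult_neq_0. apply (Hcr (cexp z)); auto. apply cexp_neq_0.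
Qed.

Lemma cexp_seg_cont a b T k : 0 < k -> exists d, 0 < d /\ forall t, Rabs (t - T) < d -> Cmod (cexp (seg a b t) - cexp (seg a b T)) < k.
Proof.
  intros Hk. destruct (holo_ccont _ _ (holo_cexp (seg a b T)) k Hk) as [d [Hd H]].
  assert (D0 : 0 < Cmod (b - a) + 1) by (pose proof (Cmod_ge_0 (b - a)); lra).
  exists (d / (Cmod (b - a) + 1)). split. apply Rdiv_lt_0_compat; auto.
  intros t Ht. apply H. rewrite seg_dist. apply Rle_lt_trans with (Rabs (t - T) * (Cmod (b - a) + 1)).
  apply Rmult_le_compat_l. apply Rabs_pos. lra.
  apply (Rmult_lt_compat_r (Cmod (b - a) + 1)) in Ht; auto.
  replace (d / (Cmod (b - a) + 1) * (Cmod (b - a) + 1)) with d in Ht by (field; lra). auto.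
Qed.

Lemma cexp_antipode z y : fst z = fst y -> Rabs (snd z - snd y) = PI -> cexp z = (- cexp y)%C.
Proof.
  intros E H. unfold cexp. rewrite E. unfold Copp; simpl.
  assert (S : snd z = snd y + PI \/ snd z = snd y - PI).
  { unfold Rabs in H. destruct (Rcase_abs (snd z - snd y)); lra. }
  destruct S as [-> | ->].
  - rewrite neg_cos, neg_sin. f_equal; ring.
  - rewrite cos_minus, sin_minus, cos_PI, sin_PI. f_equal; ring.
Qed.

(* Points of [B(q,k)], [k < |q|], are never antipodal, so the argument along the path varies
   by at most [PI]. *)
Lemma log_path_bounded (lam : R -> C) T t1 q k : path_cont lam T -> 0 <= t1 < T -> k < Cmod q ->
  (forall t, t1 <= t < T -> Cmod (cexp (lam t) - q) < k) ->
  exists M, forall t, t1 <= t < T -> Cmod (lam t) <= M.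
Proof.
  intros Hc Ht1 Hk H.
  assert (Im : forall t, t1 <= t < T -> Rabs (snd (lam t) - snd (lam t1)) <= PI).
  { intros t Ht. apply Rnot_lt_le. intros L.
    destruct (IVT_on (fun t => Rabs (snd (lam t) - snd (lam t1))) t1 t PI) as [c [Hc1 Hc2]]. lra.
    - intros x Hx e He. destruct (Hc x ltac:(lra) e He) as [d [Hd Hd']].
      exists d. split; auto. intros s Hs Hsx. eapply Rle_lt_trans. apply Rabs_triang_inv2.
      replace (snd (lam s) - snd (lam t1) - (snd (lam x) - snd (lam t1))) with (snd (lam s - lam x)%C)
        by (simpl; ring).
      eapply Rle_lt_trans. apply Cmod_snd_le. apply Hd'; auto. lra.
    - replace (snd (lam t1) - snd (lam t1)) with 0 by ring. rewrite Rabs_R0. pose proof PI_RGT_0. lra.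
    - set (y := (fst (lam c), snd (lam t1)) : C).
      assert (E : cexp (lam c) = (- cexp y)%C) by (apply cexp_antipode; auto).
      set (A := exp (fst (lam t1))). set (B := exp (fst (lam c))).
      assert (PA : 0 < A) by apply exp_pos. assert (PB : 0 < B) by apply exp_pos.
      (* Antipodal directions make this positive combination vanish, although both points are within
         [k < |q|] of [q]. *)
      assert (E2 : (RtoC B * cexp (lam t1) + RtoC A * cexp (lam c))%C = 0).
      { rewrite E. unfold A, B, cexp, y, RtoC, Cplus, Cmult, Copp; simpl. f_equal; ring. }
      assert (K1 := H t1 ltac:(lra)). assert (K2 := H c ltac:(lra)).
      assert (K3 : (B + A) * Cmod q < (B + A) * k).
      { replace ((B + A) * Cmod q) with (Cmod (RtoC B * (cexp (lam t1) - q) + RtoC A * (cexp (lam c) - q))).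
        - eapply Rle_lt_trans. apply Cmod_triangle. rewrite !Cmod_mult, !Cmod_R, !Rabs_pos_eq by lra. nra.
        - replace (RtoC B * (cexp (lam t1) - q) + RtoC A * (cexp (lam c) - q))%C
            with ((RtoC B * cexp (lam t1) + RtoC A * cexp (lam c)) + - (RtoC (B + A) * q))%C
            by (rewrite RtoC_plus; ring).
          rewrite E2, Cplus_0_l, Cmod_opp, Cmod_mult, Cmod_R, Rabs_pos_eq; lra. }
      nra. }
  exists (Rmax (Rabs (ln (Cmod q - k))) (Rabs (ln (Cmod q + k))) + (Rabs (snd (lam t1)) + PI)).
  intros t Ht. eapply Rle_trans. apply Cmod_le_sum. apply Rplus_le_compat.
  - specialize (H t Ht).
    pose proof (Cmod_sub_ge (cexp (lam t)) q) as G1. pose proof (Cmod_sub_ge q (cexp (lam t))) as G2.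
    rewrite (Cmod_sub_sym q) in G2. rewrite Cmod_cexp in G1, G2.
    assert (L1 : ln (Cmod q - k) < fst (lam t)).
    { rewrite <- (ln_exp (fst (lam t))). apply ln_increasing; lra. }
    assert (L2 : fst (lam t) < ln (Cmod q + k)).
    { rewrite <- (ln_exp (fst (lam t))) at 1. apply ln_increasing; try lra. }
    pose proof (Rmax_l (Rabs (ln (Cmod q - k))) (Rabs (ln (Cmod q + k)))).
    pose proof (Rmax_r (Rabs (ln (Cmod q - k))) (Rabs (ln (Cmod q + k)))).
    pose proof (Rle_abs (ln (Cmod q + k))). pose proof (Rle_abs (- ln (Cmod q - k))). rewrite Rabs_Ropp in *.
    apply Rabs_le. lra.
  - specialize (Im t Ht). replace (snd (lam t)) with (snd (lam t1) + (snd (lam t) - snd (lam t1))) by ring.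
    eapply Rle_trans. apply Rabs_triang. lra.
Qed.

(** Here both kinds of singular values enter. If [cexp] of the lift tended to infinity, the end
    point [w] would be an asymptotic value; so it clusters at some [q] with [f q = w]. As [q] is not
    critical, the path is trapped in a small disc about [q] that avoids 0, and its logarithm stays
    bounded. *)
Lemma flog_lift_limits f R0 a : regular_outside f R0 -> ln R0 < fst a ->
  lift_limits (flog f) cexp (fun z => R0 < Cmod (flog f z)) (fun z => ln R0 < fst z) a.
Proof.
  intros Reg Ha. assert (Reg' := Reg). destruct Reg' as [H [N [HR [H0 [Hcr Has]]]]].
  intros b T lam Hb HT Hlam.
  assert (Pc : path_cont lam T) by (intros t Ht; apply Hlam, Ht).
  set (w := cexp (seg a b T)).
  assert (Hw : R0 < Cmod w).
  { unfold w. rewrite Cmod_cexp. rewrite <- (exp_ln R0) by auto. apply exp_increasing.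
    unfold seg; simpl. nra. }
  set (sg := fun t => cexp (lam t)).
  assert (Sc : path_cont sg T) by (apply path_cont_comp; auto; intros; apply holo_ccont, holo_cexp).
  assert (Lw : forall k, 0 < k -> exists s, 0 <= s < T /\ forall t, s < t < T -> Cmod (f (sg t) - w) < k).
  { intros k Hk. destruct (cexp_seg_cont a b T k Hk) as [d [Hd Hd']].
    exists (Rmax 0 (T - d)). split. split. apply Rmax_l. apply Rmax_lub_lt; lra.
    intros t Ht. pose proof (Rmax_l 0 (T - d)). pose proof (Rmax_r 0 (T - d)).
    destruct (Hlam t ltac:(lra)) as [_ [E _]]. unfold sg. unfold flog in E. rewrite E.
    apply Hd'. rewrite Rabs_left; lra. }
  assert (Cl : forall (g : C -> C) (u : R -> C) z, ccont g z ->
     (forall t, 0 <= t < T -> g (u t) = f (sg t)) ->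
     (forall k s, 0 < k -> 0 <= s < T -> exists t, s < t < T /\ Cmod (u t - z) < k) -> g z = w).
  { intros g u z Cg Eg Hz. apply Cmod_sub_lt_eps_eq. intros e He.
    destruct (Cg (e / 2) ltac:(lra)) as [d [Hd Hd']].
    destruct (Lw (e / 2) ltac:(lra)) as [s [Hs Hs']].
    destruct (Hz d s Hd Hs) as [t [Ht Ht']].
    specialize (Hd' _ Ht'). specialize (Hs' t Ht). rewrite <- Eg in Hs' by lra.
    pose proof (Cmod_sub_tri (g z) (g (u t)) w) as Tr. rewrite (Cmod_sub_sym (g z) (g (u t))) in Tr. lra. }
  assert (Bd : exists X, forall s, 0 <= s < T -> exists t, s < t < T /\ Cmod (sg t) <= X).
  { apply NNPP. intros Q. apply (Has w Hw). apply (asymptotic_of_path f sg T w); auto. lra.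
    intros X. apply NNPP. intros Q'. apply Q. exists X. intros s Hs. apply NNPP. intros Q2. apply Q'.
    exists s. split; auto. intros t Ht. apply Rnot_le_lt. intros L. apply Q2. eauto. }
  destruct Bd as [X HX]. destruct (cluster_at_end T sg X) as [q Hq]; auto. lra.
  assert (Fq : f q = w) by (apply (Cl f sg q); auto; apply holo_ccont, H).
  assert (Nq : q <> 0) by (intros E; rewrite <- Fq, E in Hw; lra).
  apply Cmod_gt_0 in Nq.
  destruct (H q) as [l Hl]. assert (Nl := Hcr q l ltac:(rewrite Fq; auto) Hl).
  destruct (local_injectivity f q l H Hl Nl) as [d [Hd Inj]]. apply Cmod_gt_0 in Nl.
  set (k := Rmin (d / 2) (Cmod q / 2)).
  assert (Hk : 0 < k) by (apply Rmin_glb_lt; lra).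
  assert (K1 : k <= d / 2) by apply Rmin_l. assert (K2 : k <= Cmod q / 2) by apply Rmin_r. clearbody k.
  destruct (Lw (Cmod l / 2 * k)) as [s [Hs Hs']]. nra.
  destruct (Hq k s Hk Hs) as [t1 [Ht1 Ht1']].
  (* On the circle of radius [k] about [q], [f] differs from [w] by at least [|l| / 2 * k], so the
     path cannot cross it at these late times. *)
  assert (In : forall t, t1 <= t < T -> Cmod (sg t - q) < k).
  { intros t Ht. apply Rnot_le_lt. intros L.
    destruct (IVT_on (fun t => Cmod (sg t - q)) t1 t k) as [c [Hc1 Hc2]]; try lra.
    - intros x Hx e He. destruct (Sc x ltac:(lra) e He) as [d' [Hd' Hd2]].
      exists d'. split; auto. intros y Hy Hyx. specialize (Hd2 y ltac:(lra) Hyx).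
      pose proof (Cmod_sub_tri (sg y) (sg x) q). pose proof (Cmod_sub_tri (sg x) (sg y) q).
      rewrite (Cmod_sub_sym (sg x) (sg y)) in *. apply Rabs_def1; lra.
    - specialize (Inj q (sg c) ltac:(rewrite Cmod_sub_self; lra) ltac:(lra)).
      specialize (Hs' c ltac:(lra)). rewrite Hc2, Fq in Inj. lra. }
  destruct (log_path_bounded lam T t1 q k) as [M HM]; auto; try lra.
  destruct (cluster_at_end T lam M) as [z Hz]. lra.
  { intros s0 Hs0. exists ((Rmax s0 t1 + T) / 2).
    pose proof (Rmax_l s0 t1). pose proof (Rmax_r s0 t1).
    assert (Rmax s0 t1 < T) by (apply Rmax_lub_lt; lra). split. lra. apply HM. lra. }
  assert (Fz : flog f z = w).
  { apply (Cl (flog f) lam z); auto. apply holo_ccont, holo_flog, H. }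
  exists z. split. rewrite Fz; auto. split; auto.
Qed.

(** Dividing the slope function of [e] by that of [F], evaluated along [Phi], gives a slope function
    for [Phi]; continuity of [Phi] makes it continuous. *)
Lemma cdiff_lift F e Phi v l m k : 0 < k -> ccont Phi v ->
  (forall y, Cmod (y - v) < k -> F (Phi y) = e y) -> cdiff F (Phi v) l -> l <> 0 -> cdiff e v m ->
  cdiff Phi v (m / l).
Proof.
  intros Hk Hc E [p [Hp [Ep [d1 [Hd1 H1]]]]] Nl [q [Hq [Eq [d2 [Hd2 H2]]]]].
  assert (Cp : ccont (fun y => p (Phi y)) v) by (apply ccont_comp; auto).
  exists (fun y => q y * / p (Phi y))%C. split; [|split].
  - apply ccont_mult; auto. apply (ccont_inv (fun y => p (Phi y))); auto. rewrite Ep; auto.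
  - rewrite Ep, Eq. reflexivity.
  - destruct (ccont_neq_0 _ _ Cp) as [d3 [Hd3 H3]]. rewrite Ep; auto.
    destruct (Hc d1 Hd1) as [d4 [Hd4 H4]].
    exists (Rmin (Rmin d2 d3) (Rmin d4 k)). split. repeat apply Rmin_glb_lt; auto.
    intros y Hy.
    assert (Y1 : Cmod (y - v) < d2) by (eapply Rlt_le_trans; [apply Hy | eapply Rle_trans; [apply Rmin_l | apply Rmin_l]]).
    assert (Y2 : Cmod (y - v) < d3) by (eapply Rlt_le_trans; [apply Hy | eapply Rle_trans; [apply Rmin_l | apply Rmin_r]]).
    assert (Y3 : Cmod (y - v) < d4) by (eapply Rlt_le_trans; [apply Hy | eapply Rle_trans; [apply Rmin_r | apply Rmin_l]]).
    assert (Y4 : Cmod (y - v) < k) by (eapply Rlt_le_trans; [apply Hy | eapply Rle_trans; [apply Rmin_r | apply Rmin_r]]).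
    assert (Np : p (Phi y) <> 0).
    { apply Cmod_gt_0. specialize (H3 y Y2). pose proof (Cmod_ge_0 (p (Phi v))). lra. }
    assert (A1 := H1 (Phi y) (H4 y Y3)). rewrite (E y Y4) in A1.
    rewrite (E v) in A1 by (rewrite Cmod_sub_self; auto). rewrite (H2 y Y1) in A1.
    assert (A2 : (q y * (y - v) = p (Phi y) * (Phi y - Phi v))%C).
    { replace (q y * (y - v))%C with ((e v + q y * (y - v)) - e v)%C by ring. rewrite A1. ring. }
    replace (q y * / p (Phi y) * (y - v))%C with (q y * (y - v) * / p (Phi y))%C by ring.
    rewrite A2. field. auto.
Qed.

Lemma log_lift f R0 a z0 : regular_outside f R0 -> ln R0 < fst a -> flog f z0 = cexp a ->
  exists Phi, Phi a = z0 /\ forall v, ln R0 < fst v ->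
    flog f (Phi v) = cexp v /\ R0 < Cmod (flog f (Phi v)) /\ holo Phi v.
Proof.
  intros Reg Ha E. assert (Reg' := Reg). destruct Reg' as [H [N [HR [H0 [Hcr Has]]]]].
  assert (Op : forall v : C, ln R0 < fst v -> exists k, 0 < k /\ forall y : C, Cmod (y - v) < k -> ln R0 < fst y).
  { intros v Hv. exists (fst v - ln R0). split. lra. intros y Hy.
    pose proof (Cmod_fst_le (y - v)) as F. simpl in F.
    assert (Rabs (fst y + - fst v) < fst v - ln R0) by lra. apply Rabs_def2 in H1. lra. }
  destruct (convex_lift (flog f) cexp (fun z => R0 < Cmod (flog f z)) (fun z => ln R0 < fst z) a z0) as [Phi [E0 HL]]; auto.
  - intros b t Hb Ht. unfold seg; simpl. destruct (Req_dec t 0) as [-> | Nt]; nra.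
  - intros v _. apply holo_ccont, holo_cexp.
  - apply flog_local_sections; auto.
  - apply flog_lift_limits; auto.
  - rewrite E, Cmod_cexp, <- (exp_ln R0) by auto. apply exp_increasing; auto.
  - exists Phi. split; auto. intros v Hv. destruct (HL v Hv) as [L1 [L2 L3]].
    split; auto. split; auto. destruct (Op v Hv) as [k [Hk Hk']].
    destruct (H (cexp (Phi v))) as [l Hl].
    eexists. apply (cdiff_lift (flog f) cexp Phi v (l * cexp (Phi v)) (cexp v) k); auto.
    + intros y Hy. apply HL, Hk', Hy.
    + apply cdiff_flog; auto.
    + apply Cmult_neq_0. apply (Hcr (cexp (Phi v))); auto. apply cexp_neq_0.
    + apply cdiff_cexp.
Qed.

(** * Expansion along escaping orbits *)

Lemma Cplus_minus_l (a b : C) : (a + b - a)%C = b.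
Proof. ring. Qed.

Lemma iter_ccont f n z : (forall z, ccont f z) -> ccont (iter n f) z.
Proof. intros H. induction n; simpl. apply ccont_id. apply (ccont_comp f (iter n f)); auto. Qed.

Lemma iter_add f m n z : iter (m + n) f z = iter m f (iter n f z).
Proof. induction m; simpl; congruence. Qed.

Lemma iter_open f n z e : (forall z, holo f z) -> nonconstant f -> 0 < e ->
  exists m, 0 < m /\ forall w, Cmod (w - iter n f z) < m -> exists y, Cmod (y - z) < e /\ iter n f y = w.
Proof.
  intros H N. revert e. induction n; intros e He; simpl.
  - exists e. split; auto. intros w Hw. eauto.
  - destruct (IHn e He) as [m1 [Hm1 H1]].
    destruct (open_mapping f (iter n f z) m1 H N Hm1) as [m [Hm H2]].
    exists m. split; auto. intros w Hw. destruct (H2 w Hw) as [y1 [Y1 Y2]].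
    destruct (H1 y1 Y1) as [y [Z1 Z2]]. exists y. split; auto. congruence.
Qed.

Lemma escaping_spec f z : escaping_set f z ->
  forall M, exists N, forall n, (N <= n)%nat -> M < Cmod (iter n f z).
Proof.
  intros H M. apply is_lim_seq_spec in H. destruct (H M) as [N HN]. exists N. auto.
Qed.

Lemma escaping_image f z : escaping_set f z -> escaping_set f (f z).
Proof.
  intros H. unfold escaping_set in *. apply is_lim_seq_incr_1 in H.
  eapply is_lim_seq_ext. 2: apply H. intros n. simpl. f_equal.
  induction n; simpl; congruence.
Qed.

(** What keeps large discs out of the image of a lift, on which [Cmod (flog f)] exceeds [R0]. *)
Definition log_net (f : C -> C) (R0 : R) : Prop :=
  forall c, exists v, Cmod (v - c) <= PI /\ Cmod (flog f v) <= R0.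

Lemma log_lift_derivative f R0 Phi v rho l : log_net f R0 -> 0 < rho -> ln R0 + rho < fst v ->
  (forall y, ln R0 < fst y -> R0 < Cmod (flog f (Phi y)) /\ holo Phi y) ->
  cdiff Phi v l -> Cmod l <= 1536 * PI / rho.
Proof.
  intros Net Hr Hv HP Hl. apply Rnot_lt_le. intros L. pose proof PI_RGT_0.
  assert (Pl : 0 < Cmod l).
  { eapply Rle_lt_trans. 2: apply L. apply Rmult_le_pos. lra. left; apply Rinv_0_lt_compat; auto. }
  assert (In : forall y, Cmod (y - v) <= rho -> ln R0 < fst y).
  { intros y Hy. pose proof (Cmod_fst_le (y - v)) as F. simpl in F.
    assert (F2 : Rabs (fst y + - fst v) <= rho) by lra. apply Rabs_le_between in F2. lra. }
  destruct (bloch Phi v rho l) as [c Hc]; auto.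
  { intros y Hy. apply HP; auto. } { apply Cmod_gt_0; auto. }
  destruct (Net c) as [u [U1 U2]].
  destruct (Hc u) as [y [Y1 Y2]].
  - eapply Rle_lt_trans. apply U1. apply (Rmult_lt_compat_r (rho / 1536)) in L; [|lra].
    replace (1536 * PI / rho * (rho / 1536)) with PI in L by (field; lra). lra.
  - destruct (HP y) as [Q _]. apply In; lra. rewrite Y2 in Q. lra.
Qed.

(** Let [c j] be a logarithm of the [j]-th orbit point. The lift sending [c (S j)] to [c j] halves
    distances near [c (S j)], so the disc about [c j] whose exponential is covered by an iterate of
    the given disc doubles at each step, up to radius 10. Since [10 > PI], it finally contains a
    vertical segment over a full circle. *)
Lemma escaping_expansion f R0 R2 z e0 : regular_outside f R0 -> log_net f R0 ->
  escaping_set f z -> 0 < e0 ->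
  exists j rho, R2 < rho /\ forall w, Cmod w = rho -> exists y, Cmod (y - z) < e0 /\ iter j f y = w.
Proof.
  intros Reg Net Esc He0. assert (Reg' := Reg). destruct Reg' as [H [N [HR [H0 [Hcr Has]]]]].
  pose proof PI_RGT_0 as Ppi.
  (* Makes the derivative bound [1536 * PI / rho] equal to [1 / 2]. *)
  set (rho := 3072 * PI). assert (Hrho : 0 < rho) by (unfold rho; lra).
  (* From time [j0] on, the whole disc of radius 10 about [c j] keeps distance [rho] from the line
     [Re v = ln R0], and the final radius exceeds [R2]. *)
  set (R1 := Rmax R2 (R0 * exp (10 + rho))).
  destruct (escaping_spec f z Esc R1) as [j0 Hj0].
  assert (Hbig : forall j, (j0 <= j)%nat -> R2 < Cmod (iter j f z) /\ R0 * exp (10 + rho) < Cmod (iter j f z)).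
  { intros j Hj. specialize (Hj0 j Hj).
    pose proof (Rmax_l R2 (R0 * exp (10 + rho))). pose proof (Rmax_r R2 (R0 * exp (10 + rho))).
    fold R1 in H1, H2. lra. }
  assert (Pex : 0 < R0 * exp (10 + rho)) by (apply Rmult_lt_0_compat; auto; apply exp_pos).
  assert (Ch : forall j, exists c, (j0 <= j)%nat -> cexp c = iter j f z).
  { intros j. destruct (classic (j0 <= j)%nat) as [L | L].
    - destruct (cexp_onto (iter j f z)) as [c Hc]. apply Cmod_gt_0. destruct (Hbig j L). lra. eauto.
    - exists 0%C. tauto. }
  apply choice in Ch. destruct Ch as [c Hc].
  assert (Hre : forall j, (j0 <= j)%nat -> ln R0 + rho + 10 < fst (c j)).
  { intros j Hj. destruct (Hbig j Hj) as [_ L]. rewrite <- (Hc j Hj), Cmod_cexp in L.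
    rewrite <- (ln_exp (fst (c j))). replace (ln R0 + rho + 10) with (ln (R0 * exp (10 + rho))).
    apply ln_increasing; auto. rewrite ln_mult, ln_exp; auto. ring. apply exp_pos. }
  destruct (iter_open f j0 z e0 H N He0) as [m [Hm Hop]].
  destruct (holo_ccont _ _ (holo_cexp (c j0)) m Hm) as [d0 [Hd0 Hd0']].
  assert (Claim : forall k v, Cmod (v - c (k + j0)%nat) < Rmin (2 ^ k * d0) 10 ->
    exists y, Cmod (y - z) < e0 /\ iter (k + j0) f y = cexp v).
  { induction k; intros v Hv; simpl plus in *.
    - apply Hop. rewrite <- Hc by lia. apply Hd0'. eapply Rlt_le_trans. apply Hv.
      eapply Rle_trans. apply Rmin_l. simpl; lra.
    - set (j := (k + j0)%nat) in *.
      assert (Hj : (j0 <= j)%nat) by (unfold j; lia). assert (HSj : (j0 <= S j)%nat) by lia.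
      destruct (log_lift f R0 (c (S j)) (c j)) as [Phi [E0 HPhi]]; auto.
      { specialize (Hre _ HSj). lra. }
      { unfold flog. rewrite (Hc j Hj), (Hc _ HSj). reflexivity. }
      assert (Lip : Cmod (Phi v - Phi (c (S j))) <= 1 / 2 * Cmod (v - c (S j))).
      { apply segment_lipschitz. intros t Ht.
        set (y := (c (S j) + RtoC t * (v - c (S j)))%C).
        assert (Ly : ln R0 + rho < fst y).
        { assert (B : Cmod (y - c (S j)) <= 10).
          { apply convex_comb_disc; auto. rewrite Cmod_sub_self; lra.
            left. eapply Rlt_le_trans. apply Hv. apply Rmin_r. }
          pose proof (Cmod_fst_le (y - c (S j))) as F. simpl in F.
          assert (F2 : Rabs (fst y + - fst (c (S j))) <= 10) by (simpl; lra).
          apply Rabs_le_between in F2. specialize (Hre _ HSj). lra. }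
        destruct (HPhi y) as [_ [_ [l Hl]]]. lra.
        exists l. split; auto.
        eapply Rle_trans. apply (log_lift_derivative f R0 Phi y rho l); auto.
        - intros y' Hy'. destruct (HPhi y' Hy') as [_ [P2 P3]]. auto.
        - right. unfold rho. field. lra. }
      rewrite E0 in Lip.
      destruct (IHk (Phi v)) as [y [Y1 Y2]].
      { assert (V1 : Cmod (v - c (S j)) < 2 ^ S k * d0) by (eapply Rlt_le_trans; [apply Hv | apply Rmin_l]).
        assert (V2 : Cmod (v - c (S j)) < 10) by (eapply Rlt_le_trans; [apply Hv | apply Rmin_r]).
        simpl in V1. apply Rmin_glb_lt; lra. }
      exists y. split; auto. change (f (iter j f y) = cexp v). rewrite Y2. apply (HPhi v).
      assert (V2 : Cmod (v - c (S j)) < 10) by (eapply Rlt_le_trans; [apply Hv | apply Rmin_r]).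
      pose proof (Cmod_fst_le (v - c (S j))) as F. simpl in F.
      assert (F2 : Rabs (fst v + - fst (c (S j))) <= 10) by lra.
      apply Rabs_le_between in F2. specialize (Hre _ HSj). lra. }
  assert (Hk : exists k, 10 <= 2 ^ k * d0).
  { destruct (Pow_x_infinity 2 ltac:(rewrite Rabs_pos_eq; lra) (10 / d0)) as [k Hk]. exists k.
    specialize (Hk k (Nat.le_refl k)). rewrite Rabs_pos_eq in Hk by (apply pow_le; lra).
    apply Rge_le in Hk. apply (Rmult_le_compat_r d0) in Hk; [|lra].
    replace (10 / d0 * d0) with 10 in Hk by (field; lra). auto. }
  destruct Hk as [k Hk]. exists (k + j0)%nat, (Cmod (iter (k + j0) f z)).
  assert (Hkj : (j0 <= k + j0)%nat) by lia.
  split. apply Hbig; auto. intros w Hw.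
  rewrite <- (Hc _ Hkj) in Hw. destruct (cexp_onto_circle _ _ Hw) as [t [Ht Et]].
  rewrite <- Et. apply Claim. rewrite Rmin_right by auto.
  rewrite Cplus_minus_l, Cmod_imag. apply Rle_lt_trans with PI. apply Rabs_le; lra. pose proof PI_4. lra.
Qed.

(** * The tract over the asymptotic value *)

Definition punctured_tract (f : C -> C) (alpha : C) (r : R) (U : C -> Prop) : Prop :=
  0 < r /\ component_of U (fun z => disk alpha r (f z)) /\
  (forall u, U u -> f u <> alpha) /\
  (forall w, Cmod (w - alpha) < r -> w <> alpha -> exists u, U u /\ f u = w).

(** In a separation the disc lies on the side of its centre [u], and that side meets [U] because [u]
    is in the closure of [U]. *)
Lemma connected_union_disc (U : C -> Prop) u e : connected_set U -> 0 < e -> closure_set U u ->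
  connected_set (fun z => U z \/ Cmod (z - u) < e).
Proof.
  intros HU He Hu [O1 [O2 [P1 [P2 [Cov [[z1 [E1 F1]] [[z2 [E2 F2]] Dis]]]]]]].
  rewrite open_Cmod in P1, P2.
  assert (Disc : forall A B : C -> Prop,
    (forall z, A z -> exists e, 0 < e /\ forall y, Cmod (y - z) < e -> A y) ->
    (forall z, B z -> exists e, 0 < e /\ forall y, Cmod (y - z) < e -> B y) ->
    (forall z, Cmod (z - u) < e -> A z \/ B z) -> (forall z, Cmod (z - u) < e -> A z -> B z -> False) ->
    forall y, A u -> Cmod (y - u) < e -> A y).
  { intros A B HA HB HAB HD y Au Hy. rewrite <- (seg_1 u y).
    assert (Iny : forall t, 0 <= t <= 1 -> Cmod (seg u y t - u) < e).
    { intros t Ht. eapply Rle_lt_trans. 2: apply Hy. apply convex_comb_disc; auto.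
      rewrite Cmod_sub_self. apply Cmod_ge_0. lra. }
    assert (D0 : 0 < Cmod (y - u) + 1) by (pose proof (Cmod_ge_0 (y - u)); lra).
    assert (Near : forall k s t, 0 < k -> Rabs (s - t) < k / (Cmod (y - u) + 1) -> Cmod (seg u y s - seg u y t) < k).
    { intros k s t Hk Hs. rewrite seg_dist. apply Rle_lt_trans with (Rabs (s - t) * (Cmod (y - u) + 1)).
      apply Rmult_le_compat_l. apply Rabs_pos. lra.
      apply (Rmult_lt_compat_r (Cmod (y - u) + 1)) in Hs; auto.
      replace (k / (Cmod (y - u) + 1) * (Cmod (y - u) + 1)) with k in Hs by (field; lra). auto. }
    apply (real_induction (fun t => A (seg u y t))); [|lra].
    intros t Ht Q.
    assert (At : A (seg u y t)).
    { destruct (Req_dec t 0) as [-> | Nt]. rewrite seg_0; auto.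
      destruct (HAB _ (Iny t Ht)) as [X | X]; auto. exfalso.
      destruct (HB _ X) as [k [Hk Hk']].
      set (q := Rmin t (k / (Cmod (y - u) + 1)) / 2).
      assert (0 < k / (Cmod (y - u) + 1)) by (apply Rdiv_lt_0_compat; auto).
      assert (0 < Rmin t (k / (Cmod (y - u) + 1))) by (apply Rmin_glb_lt; lra).
      pose proof (Rmin_l t (k / (Cmod (y - u) + 1))). pose proof (Rmin_r t (k / (Cmod (y - u) + 1))).
      assert (Hq : 0 < q < t /\ q < k / (Cmod (y - u) + 1)) by (unfold q; lra).
      apply (HD (seg u y (t - q))). apply Iny; lra. apply Q; lra.
      apply Hk', Near; auto. replace (t - q - t) with (- q) by ring. rewrite Rabs_Ropp, Rabs_pos_eq; lra. }
    destruct (HA _ At) as [k [Hk Hk']]. exists (k / (Cmod (y - u) + 1)). split. apply Rdiv_lt_0_compat; auto.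
    intros s Hs Hs1. apply Hk', Near; auto. rewrite Rabs_pos_eq; lra. }
  assert (Side : forall A B : C -> Prop,
    (forall z, A z -> exists e, 0 < e /\ forall y, Cmod (y - z) < e -> A y) ->
    (forall z, B z -> exists e, 0 < e /\ forall y, Cmod (y - z) < e -> B y) ->
    (forall z, U z \/ Cmod (z - u) < e -> A z \/ B z) ->
    (forall z, U z \/ Cmod (z - u) < e -> A z -> B z -> False) ->
    A u -> (exists z, (U z \/ Cmod (z - u) < e) /\ B z) -> False).
  { intros A B HA HB HAB HD Au [z [Ez Bz]].
    destruct Ez as [Uz | Dz].
    2:{ apply (HD z); auto. apply (Disc A B); auto.
        intros y Hy. apply (HD y); auto. }
    apply HU. exists A, B. rewrite !open_Cmod. split; auto. split; auto. split. intros; apply HAB; auto.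
    split; [|split].
    - destruct (HA u Au) as [k [Hk Hk']]. destruct (Hu k Hk) as [y [Uy Hy]]. eauto.
    - eauto.
    - intros y Uy. apply HD; auto. }
  assert (Eu : U u \/ Cmod (u - u) < e) by (right; rewrite Cmod_sub_self; auto).
  destruct (Cov u Eu) as [X | X].
  - apply (Side O1 O2); eauto.
  - apply (Side O2 O1); auto; intros.
    + destruct (Cov z H); auto.
    + eapply Dis; eauto.
    + eauto.
Qed.

(** By maximality a component absorbs a small disc about [u] on which [f] stays in [B(alpha, r)]. So
    [U] is open, and closed relative to the preimage. *)
Lemma tract_closure f alpha r U u : (forall z, ccont f z) -> punctured_tract f alpha r U ->
  closure_set U u -> Cmod (f u - alpha) < r ->
  exists e, 0 < e /\ forall y, Cmod (y - u) < e -> U y.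
Proof.
  intros Hc [Hr [[_ [Con [Sub Max]]] _]] Hu Hf.
  destruct (Hc u (r - Cmod (f u - alpha)) ltac:(lra)) as [e [He He']].
  exists e. split; auto. intros y Hy.
  apply (Max (fun z => U z \/ Cmod (z - u) < e)); auto.
  - apply connected_union_disc; auto.
  - intros z [Uz | Dz]; auto. specialize (He' z Dz).
    pose proof (Cmod_sub_tri (f z) (f u) alpha). unfold disk. lra.
Qed.

Lemma closure_self (A : C -> Prop) z : A z -> closure_set A z.
Proof. intros H e He. exists z. rewrite Cmod_sub_self. auto. Qed.

(** Points of [U] over values tending to [alpha] cannot cluster: the limit would belong to [U] and
    be mapped to the omitted value [alpha]. *)
Lemma tract_unbounded f alpha r U X : (forall z, ccont f z) -> punctured_tract f alpha r U ->
  exists u, U u /\ X < Cmod u.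
Proof.
  intros Hc T. assert (T' := T). destruct T' as [Hr [Hcomp [Na Sur]]]. apply NNPP. intros Q.
  assert (Ch : forall n : nat, exists u, U u /\ f u = (alpha + RtoC (r / (INR n + 2)))%C).
  { intros n. pose proof (pos_INR n).
    assert (0 < r / (INR n + 2)) by (apply Rdiv_lt_0_compat; lra).
    assert (E : (alpha + RtoC (r / (INR n + 2)) - alpha = RtoC (r / (INR n + 2)))%C) by ring.
    apply Sur.
    - rewrite E, Cmod_R, Rabs_pos_eq by lra. apply (Rmult_lt_reg_r (INR n + 2)). lra. field_simplify; nra.
    - intros E2. rewrite E2 in E. assert (Z : (alpha - alpha = 0)%C) by ring. rewrite Z in E.
      apply (f_equal fst) in E. simpl in E. lra. }
  apply choice in Ch. destruct Ch as [u Hu].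
  destruct (bounded_seq_cluster u X) as [v Hv].
  { intros n. apply Rnot_lt_le. intros L. apply Q. exists (u n). split; auto. apply Hu. }
  assert (Fv : f v = alpha).
  { apply Cmod_sub_lt_eps_eq. intros e He.
    destruct (Hc v (e / 2) ltac:(lra)) as [d [Hd Hd']].
    destruct (INR_unbounded (2 * r / e)) as [N HN].
    destruct (Hv d N Hd) as [n [Hn1 Hn2]]. specialize (Hd' _ Hn2). rewrite (proj2 (Hu n)) in Hd'.
    apply le_INR in Hn1. pose proof (pos_INR n).
    assert (B : r / (INR n + 2) <= e / 2).
    { apply (Rmult_le_reg_r (INR n + 2)). lra. replace (r / (INR n + 2) * (INR n + 2)) with r by (field; lra).
      assert (E : r = e / 2 * (2 * r / e)) by (field; lra). rewrite E. apply Rmult_le_compat_l; lra. }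
    assert (0 < r / (INR n + 2)) by (apply Rdiv_lt_0_compat; lra).
    pose proof (Cmod_sub_tri (f v) (alpha + RtoC (r / (INR n + 2))) alpha) as Tr.
    rewrite (Cmod_sub_sym (f v) (alpha + RtoC (r / (INR n + 2)))) in Tr.
    replace (alpha + RtoC (r / (INR n + 2)) - alpha)%C with (RtoC (r / (INR n + 2))) in Tr by ring.
    rewrite Cmod_R, Rabs_pos_eq in Tr; lra. }
  destruct (tract_closure f alpha r U v) as [e [He HU]]; auto.
  - intros e He. destruct (Hv e 0%nat He) as [n [_ Hn]]. exists (u n). split; auto. apply Hu.
  - rewrite Fv, Cmod_sub_self; auto.
  - apply (Na v); auto. apply HU. rewrite Cmod_sub_self; auto.
Qed.

Lemma tract_meets_circle f alpha r U u0 s : (forall z, ccont f z) -> punctured_tract f alpha r U ->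
  U u0 -> Cmod u0 < s -> exists u, U u /\ Cmod u = s.
Proof.
  intros Hc T U0 Hs. apply NNPP. intros Q.
  destruct (tract_unbounded f alpha r U s Hc T) as [u1 [U1 L1]].
  destruct T as [_ [[_ [Con _]] _]]. apply Con.
  exists (fun z => Cmod z < s), (fun z => s < Cmod z). rewrite !open_Cmod. split; [|split; [|split; [|split; [|split]]]].
  - intros z Hz. exists (s - Cmod z). split. lra. intros y Hy. pose proof (Cmod_sub_ge y z). lra.
  - intros z Hz. exists (Cmod z - s). split. lra. intros y Hy. pose proof (Cmod_sub_ge z y).
    rewrite (Cmod_sub_sym z y) in H. lra.
  - intros z Uz. destruct (Rtotal_order (Cmod z) s) as [L | [L | L]]; auto. exfalso. eauto.
  - eauto.
  - eauto.
  - intros z _ ? ?. lra.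
Qed.

(** If [|cexp c| <= |u0|], the point [c] itself serves. Otherwise the circle through [cexp c] meets
    [U], and the meeting point has a logarithm at most [PI] above or below [c]. *)
Lemma tract_log_net f alpha r U u0 R0 : (forall z, ccont f z) -> punctured_tract f alpha r U -> U u0 ->
  (forall z, Cmod z <= Cmod u0 -> Cmod (f z) <= R0) -> Cmod alpha + r <= R0 -> log_net f R0.
Proof.
  intros Hc T U0 B1 B2 c. pose proof PI_RGT_0.
  destruct (Rle_dec (Cmod (cexp c)) (Cmod u0)) as [L | L].
  - exists c. rewrite Cmod_sub_self. split. lra. apply B1; auto.
  - apply Rnot_le_lt in L. destruct (tract_meets_circle f alpha r U u0 _ Hc T U0 L) as [u [Uu Hu]].
    destruct (cexp_onto_circle c u Hu) as [t [Ht Et]]. exists (c + (0, t))%C.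
    rewrite Cplus_minus_l, Cmod_imag.
    split. apply Rabs_le; lra. unfold flog. rewrite Et.
    destruct T as [_ [[_ [_ [Sub _]]] _]]. specialize (Sub u Uu). unfold disk in Sub.
    pose proof (Cmod_sub_ge (f u) alpha). lra.
Qed.

(** Compactness of the circle: by openness, a preimage in [U] of a limit point provides preimages of
    bounded modulus for all nearby points. *)
Lemma tract_covers_circle f alpha r U r' : (forall z, holo f z) -> nonconstant f ->
  punctured_tract f alpha r U -> 0 < r' < r ->
  exists R2, forall w, Cmod (w - alpha) = r' -> exists u, U u /\ Cmod u < R2 /\ f u = w.
Proof.
  intros H N T Hr'. apply NNPP. intros Q.
  assert (Ch : forall n : nat, exists w, Cmod (w - alpha) = r' /\ ~ exists u, U u /\ Cmod u < INR n /\ f u = w).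
  { intros n. apply NNPP. intros Q'. apply Q. exists (INR n). intros w Hw. apply NNPP. intros Q2. apply Q'. eauto. }
  apply choice in Ch. destruct Ch as [w Hw].
  destruct (ccompact_cluster _ w (ccompact_circle alpha r')) as [v [Hv Cv]]. { intros n. apply Hw. }
  assert (T' := T). destruct T' as [Hr [Hcomp [Na Sur]]].
  destruct (Sur v) as [u [Uu Eu]]. lra. intros E. rewrite E, Cmod_sub_self in Hv. lra.
  destruct (tract_closure f alpha r U u) as [e [He HU]]; auto.
  { intros z. apply holo_ccont, H. } { apply closure_self; auto. } { rewrite Eu; lra. }
  destruct (open_mapping f u e H N He) as [m [Hm Hop]].
  destruct (INR_unbounded (Cmod u + e)) as [k Hk].
  destruct (Cv m k Hm) as [n [Hn Hn']]. rewrite <- Eu in Hn'.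
  destruct (Hop _ Hn') as [y [Y1 Y2]]. apply (Hw n). exists y. split; auto. split; auto.
  apply le_INR in Hn. pose proof (Cmod_sub_ge y u). lra.
Qed.

(** The closure of [G] makes the removed image relatively closed, hence the remaining set open. *)
Definition cut (f : C -> C) (alpha : C) (r' : R) (U G : C -> Prop) : C -> Prop :=
  fun w => Cmod (w - alpha) < r' /\ ~ exists u, U u /\ closure_set G u /\ f u = w.

Lemma closure_bounded G : bounded_set G -> bounded_set (closure_set G).
Proof.
  intros [M HM]. exists (M + 1). intros z Hz. destruct (Hz 1 ltac:(lra)) as [y [Gy Hy]].
  specialize (HM y Gy). pose proof (Cmod_sub_ge z y). rewrite (Cmod_sub_sym z y) in H. lra.
Qed.

Lemma closure_closed G z : closure_set (closure_set G) z -> closure_set G z.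
Proof.
  intros H e He. destruct (H (e / 2) ltac:(lra)) as [y [Hy Ly]].
  destruct (Hy (e / 2) ltac:(lra)) as [x [Gx Lx]]. exists x. split; auto.
  pose proof (Cmod_sub_tri x y z). lra.
Qed.

Lemma closure_ccompact G : bounded_set G -> ccompact (closure_set G).
Proof. intros H. split. apply closure_bounded; auto. apply closure_closed. Qed.

(** A boundary point is a limit of values not taken on [U /\ closure G], so by the open mapping
    theorem it has no preimage in [U /\ G]. This rules out the circle, which is covered from
    [U /\ G]; a boundary point is thus inside the disc and was removed because of a preimage on the
    boundary of [G]. *)
Lemma cut_spec f alpha r U r' G : (forall z, holo f z) -> nonconstant f ->
  punctured_tract f alpha r U -> 0 < r' < r -> open G -> bounded_set G ->
  (forall w, Cmod (w - alpha) = r' -> exists u, U u /\ G u /\ f u = w) ->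
  open (cut f alpha r' U G) /\ cut f alpha r' U G alpha /\
  (forall w, boundary (cut f alpha r' U G) w ->
     Cmod (w - alpha) <= r' /\ exists u, U u /\ boundary G u /\ f u = w).
Proof.
  intros H N T Hr' Go Gb Hcirc. assert (T' := T). destruct T' as [Hr [Hcomp [Na Sur]]].
  assert (Hc : forall z, ccont f z) by (intros; apply holo_ccont, H).
  rewrite open_Cmod in Go. split; [|split].
  - apply open_Cmod. intros w [Lw Nw].
    assert (Q : exists e, 0 < e /\ forall y, Cmod (y - w) < e -> ~ exists u, U u /\ closure_set G u /\ f u = y).
    { apply NNPP. intros Q.
      assert (Ch : forall n : nat, exists u, U u /\ closure_set G u /\ Cmod (f u - w) < / (INR n + 1)).
      { intros n. apply NNPP. intros Q'. apply Q. exists (/ (INR n + 1)).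
        split. apply Rinv_0_lt_compat. pose proof (pos_INR n); lra.
        intros y Hy [u [Uu [Gu Eu]]]. apply Q'. exists u. rewrite Eu. auto. }
      apply choice in Ch. destruct Ch as [u Hu].
      destruct (ccompact_cluster _ u (closure_ccompact G Gb)) as [v [Gv Cv]]. { intros n. apply Hu. }
      assert (Ev : f v = w).
      { apply Cmod_sub_lt_eps_eq. intros e He.
        destruct (Hc v (e / 2) ltac:(lra)) as [d [Hd Hd']].
        destruct (archimed_cor1 (e / 2)) as [k [Hk Hk0]]. lra.
        destruct (Cv d k Hd) as [n [Hn Hn']]. specialize (Hd' _ Hn').
        destruct (Hu n) as [_ [_ L]].
        assert (/ (INR n + 1) < / INR k).
        { apply Rinv_lt_contravar. apply Rmult_lt_0_compat. apply lt_0_INR; lia.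
          pose proof (pos_INR n); lra. pose proof (le_INR k n Hn). lra. }
        pose proof (Cmod_sub_tri (f v) (f (u n)) w) as Tr. rewrite (Cmod_sub_sym (f v) (f (u n))) in Tr. lra. }
      apply Nw. exists v. split; auto.
      destruct (tract_closure f alpha r U v) as [e [He HU]]; auto.
      - intros e He. destruct (Cv e 0%nat He) as [n [_ Hn]]. exists (u n). split; auto. apply Hu.
      - rewrite Ev; lra.
      - apply HU. rewrite Cmod_sub_self; auto. }
    destruct Q as [e [He Q]]. exists (Rmin e (r' - Cmod (w - alpha))).
    split. apply Rmin_glb_lt; lra. intros y Hy. split.
    + pose proof (Rmin_r e (r' - Cmod (w - alpha))). pose proof (Cmod_sub_tri y w alpha). lra.
    + apply Q. eapply Rlt_le_trans. apply Hy. apply Rmin_l.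
  - split. rewrite Cmod_sub_self; lra. intros [u [Uu [_ Eu]]]. apply (Na u); auto.
  - intros w [Cw Nw].
    assert (Lw : Cmod (w - alpha) <= r').
    { apply ccompact_disc. intros e He. destruct (Cw e He) as [y [[Ly _] Hy]]. exists y. split; auto. lra. }
    split; auto.
    assert (NoG : forall u, U u -> G u -> f u = w -> False).
    { intros u Uu Gu Eu.
      destruct (tract_closure f alpha r U u) as [e1 [He1 HU]]; auto. apply closure_self; auto. rewrite Eu; lra.
      destruct (Go u Gu) as [e2 [He2 HG]].
      destruct (open_mapping f u (Rmin e1 e2) H N) as [m [Hm Hop]]. apply Rmin_glb_lt; auto.
      destruct (Cw m Hm) as [y [[_ Ny] Hy]]. rewrite <- Eu in Hy. destruct (Hop y Hy) as [x [X1 X2]].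
      apply Ny. exists x. split; [|split]; auto.
      - apply HU. eapply Rlt_le_trans. apply X1. apply Rmin_l.
      - apply closure_self, HG. eapply Rlt_le_trans. apply X1. apply Rmin_r. }
    destruct Lw as [Lw | Lw].
    + assert (X : exists u, U u /\ closure_set G u /\ f u = w).
      { apply NNPP. intros X. apply Nw. split; auto. }
      destruct X as [u [Uu [Gu Eu]]]. exists u. split; auto. split; auto. split; auto. intros G'. eapply NoG; eauto.
    + exfalso. destruct (Hcirc w Lw) as [u [Uu [Gu Eu]]]. eapply NoG; eauto.
Qed.

(** The supremum of [W] along the horizontal line through [alpha] is attained at a boundary
    point. *)
Lemma boundary_nonempty (W : C -> Prop) alpha : open W -> W alpha -> bounded_set W -> exists w, boundary W w.
Proof.
  intros Wo Wa [M HM]. rewrite open_Cmod in Wo.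
  set (p := fun t => (alpha + RtoC t)%C).
  assert (Pd : forall s t, Cmod (p s - p t) = Rabs (s - t)).
  { intros s t. unfold p. replace (alpha + RtoC s - (alpha + RtoC t))%C with (RtoC (s - t)) by (rewrite RtoC_minus; ring).
    apply Cmod_R. }
  set (E := fun t => W (p t)).
  destruct (completeness E) as [T [TU TL]].
  { exists (M + Cmod alpha). intros t Et. specialize (HM _ Et). unfold p in HM.
    pose proof (Cmod_sub_ge (alpha + RtoC t) alpha) as G1.
    pose proof (Cmod_sub_ge (RtoC t) (- alpha)) as G2.
    replace (RtoC t - - alpha)%C with (alpha + RtoC t)%C in G2 by ring. rewrite Cmod_opp, Cmod_R in G2.
    pose proof (Rle_abs t). lra. }
  { exists 0. unfold E, p. rewrite Cplus_0_r. auto. }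
  exists (p T). split.
  - intros e He. apply NNPP. intros Q. assert (T <= T - e / 2); [|lra].
    apply TL. intros t Et. apply Rnot_lt_le. intros L. apply Q. exists (p t). split; auto.
    rewrite Pd. assert (t <= T) by (apply TU; auto). rewrite Rabs_left1; lra.
  - intros WT. destruct (Wo _ WT) as [e [He He']]. assert (T + e / 2 <= T); [|lra].
    apply TU. apply He'. rewrite Pd. rewrite Rabs_pos_eq; lra.
Qed.

Lemma exhaustion_contains_disc (G : nat -> C -> Prop) R2 :
  (forall n, open (G n)) -> (forall n z, G n z -> G (S n) z) -> (forall z, exists n, G n z) ->
  exists n, forall z, Cmod z < R2 -> G n z.
Proof.
  intros Go Gm Gc. apply NNPP. intros Q.
  assert (Mono : forall n m z, (n <= m)%nat -> G n z -> G m z) by (intros n m z L; induction L; auto).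
  assert (Ch : forall n, exists z, Cmod z <= R2 /\ ~ G n z).
  { intros n. apply NNPP. intros Q'. apply Q. exists n. intros z Hz. apply NNPP. intros Q2. apply Q'.
    exists z. split; auto. lra. }
  apply choice in Ch. destruct Ch as [u Hu].
  destruct (bounded_seq_cluster u R2) as [z Hz]. intros; apply Hu.
  destruct (Gc z) as [n Gz]. assert (O := Go n). rewrite open_Cmod in O.
  destruct (O z Gz) as [e [He He']]. destruct (Hz e n He) as [m [Hm Hm']].
  apply (Hu m). apply (Mono n); auto.
Qed.

(** * Nested preimages *)

(** The invariant of the alternation: [K] collects the starting points kept on the loop. It is
    nonempty because the boundary of [W] is. *)
Definition stage (f : C -> C) (alpha : C) (r' : R) (m : nat) (K : C -> Prop) : Prop :=
  ccompact K /\ exists W, open W /\ W alpha /\ (forall w, W w -> Cmod (w - alpha) < r') /\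
    forall w, boundary W w -> exists x, K x /\ iter m f x = w.

(** The disc and the covered circle both belong to the set, so a boundary point lies outside the
    closed disc and is a limit of images of points of [W]. Their cluster point is mapped to it and
    cannot lie in [W]. *)
Lemma image_filled_boundary f j rho (W : C -> Prop) :
  (forall z, ccont f z) -> bounded_set W ->
  (forall w, Cmod w = rho -> exists y, W y /\ iter j f y = w) ->
  forall w, boundary (fun w => Cmod w < rho \/ exists y, W y /\ iter j f y = w) w ->
    exists y, boundary W y /\ iter j f y = w.
Proof.
  intros Hc Wb Hcirc w [Cw Nw].
  assert (Lw : rho < Cmod w).
  { destruct (Rtotal_order (Cmod w) rho) as [L | [L | L]]; auto; exfalso; apply Nw; auto. }
  assert (Ch : forall n : nat, exists y, W y /\ Cmod (iter j f y - w) < / (INR n + 1)).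
  { intros n. pose proof (pos_INR n).
    assert (P : 0 < / (INR n + 1)) by (apply Rinv_0_lt_compat; lra).
    destruct (Cw (Rmin (Cmod w - rho) (/ (INR n + 1)))) as [v [Hv Lv]]. apply Rmin_glb_lt; lra.
    pose proof (Rmin_l (Cmod w - rho) (/ (INR n + 1))). pose proof (Rmin_r (Cmod w - rho) (/ (INR n + 1))).
    destruct Hv as [Hv | [y [Wy Ey]]].
    - exfalso. pose proof (Cmod_sub_ge w v). rewrite (Cmod_sub_sym w v) in *. lra.
    - exists y. split; auto. rewrite Ey. lra. }
  apply choice in Ch. destruct Ch as [u Hu].
  destruct (ccompact_cluster _ u (closure_ccompact W Wb)) as [y [Gy Cy]].
  { intros n. apply closure_self, Hu. }
  assert (Ey : iter j f y = w).
  { apply Cmod_sub_lt_eps_eq. intros e He.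
    destruct (iter_ccont f j y Hc (e / 2) ltac:(lra)) as [d [Hd Hd']].
    destruct (archimed_cor1 (e / 2)) as [k [Hk Hk0]]. lra.
    destruct (Cy d k Hd) as [n [Hn Hn']]. specialize (Hd' _ Hn'). destruct (Hu n) as [_ L].
    assert (/ (INR n + 1) < / INR k).
    { apply Rinv_lt_contravar. apply Rmult_lt_0_compat. apply lt_0_INR; lia.
      pose proof (pos_INR n); lra. pose proof (le_INR k n Hn). lra. }
    pose proof (Cmod_sub_tri (iter j f y) (iter j f (u n)) w) as Tr.
    rewrite (Cmod_sub_sym (iter j f y) (iter j f (u n))) in Tr. lra. }
  exists y. split; auto. split; auto. intros Wy. apply Nw. right. eauto.
Qed.

Lemma stage_step f alpha r U r' R0 R2 m K :
  regular_outside f R0 -> log_net f R0 -> punctured_tract f alpha r U -> 0 < r' < r ->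
  (forall e, 0 < e -> exists z, escaping_set f z /\ Cmod (z - alpha) < e) ->
  (forall w, Cmod (w - alpha) = r' -> exists u, U u /\ Cmod u < R2 /\ f u = w) ->
  stage f alpha r' m K ->
  exists m', (m < m')%nat /\ stage f alpha r' m' (fun x => K x /\ Cmod (iter m' f x - alpha) <= r').
Proof.
  intros Reg Net T Hr' Dense Circ [[Kb Kc] [W [Wo [Wa [Wr Wb]]]]].
  assert (Reg' := Reg). destruct Reg' as [H [N _]].
  assert (Hc : forall z, ccont f z) by (intros; apply holo_ccont, H).
  assert (Wo' := Wo). rewrite open_Cmod in Wo'.
  assert (WB : bounded_set W).
  { exists (r' + Cmod alpha). intros w Ww. specialize (Wr w Ww). pose proof (Cmod_sub_ge w alpha). lra. }
  destruct (Wo' alpha Wa) as [e1 [He1 HW1]].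
  destruct (Dense e1 He1) as [z [Ez Lz]]. assert (Wz := HW1 z Lz).
  destruct (Wo' z Wz) as [e0 [He0 HW0]].
  destruct (escaping_expansion f R0 R2 z e0 Reg Net Ez He0) as [j [rho [Hrho Hcirc]]].
  set (G := fun w => Cmod w < rho \/ exists y, W y /\ iter j f y = w).
  assert (Gbd : forall w, boundary G w -> exists y, boundary W y /\ iter j f y = w).
  { apply image_filled_boundary; auto. intros w Hw. destruct (Hcirc w Hw) as [y [Y1 Y2]]. eauto. }
  destruct (cut_spec f alpha r U r' G) as [Co [Ca Cb]]; auto.
  - apply open_Cmod. intros w [Lw | [y [Wy Ey]]].
    + exists (rho - Cmod w). split. lra. intros v Hv. left. pose proof (Cmod_sub_ge v w). lra.
    + destruct (Wo' y Wy) as [e [He HWy]]. destruct (iter_open f j y e H N He) as [k [Hk Hk']].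
      exists k. split; auto. intros v Hv. right. rewrite <- Ey in Hv. destruct (Hk' v Hv) as [x [X1 X2]]. eauto.
  - destruct (ccompact_bound _ (iter j f) (closure_ccompact W WB)) as [M HM].
    { intros; apply iter_ccont; auto. }
    exists (Rmax rho M). intros w [Lw | [y [Wy Ey]]].
    + apply Rle_trans with rho. lra. apply Rmax_l.
    + rewrite <- Ey. eapply Rle_trans. apply HM. apply closure_self; auto. apply Rmax_r.
  - intros w Hw. destruct (Circ w Hw) as [u [Uu [Lu Eu]]]. exists u. split; auto. split; auto. left. lra.
  (* [m] iterations lead to the boundary of [W], [j] more to that of [G], and one last application
     of [f] returns to the disc about [alpha]. *)
  - exists (S (j + m)). split. lia. split.
    + split.
      * destruct Kb as [M HM]. exists M. intros x [Kx _]. auto.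
      * intros x Hx. split.
        { apply Kc. intros e He. destruct (Hx e He) as [y [[Ky _] Ly]]. eauto. }
        { apply ccompact_disc. intros e He.
          destruct (iter_ccont f (S (j + m)) x Hc e He) as [d [Hd Hd']].
          destruct (Hx d Hd) as [y [[_ Ly] Hy]]. exists (iter (S (j + m)) f y). split; auto. }
    + exists (cut f alpha r' U G). split; auto. split; auto. split.
      * intros w [Lw _]; auto.
      * intros w Bw. destruct (Cb w Bw) as [Lw [u [Uu [Bu Eu]]]].
        destruct (Gbd u Bu) as [y [By Ey]]. destruct (Wb y By) as [x [Kx Ex]].
        assert (E : iter (S (j + m)) f x = w). { simpl. rewrite iter_add, Ex, Ey. auto. }
        exists x. rewrite E. auto.
Qed.

Lemma stage_nonempty f alpha r' m K : stage f alpha r' m K -> exists x, K x.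
Proof.
  intros [_ [W [Wo [Wa [Wr Wb]]]]]. destruct (boundary_nonempty W alpha) as [w Bw]; auto.
  { exists (r' + Cmod alpha). intros w Ww. specialize (Wr w Ww). pose proof (Cmod_sub_ge w alpha). lra. }
  destruct (Wb w Bw) as [x [Kx _]]. eauto.
Qed.

(** A cluster point of points from the nested compact sets lies in all of them. Its orbit is in the
    closed disc of radius [r'] about [alpha] at arbitrarily late times. *)
Lemma stage_nonescaping f alpha r' m K :
  (forall m K, stage f alpha r' m K -> exists m', (m < m')%nat /\
     stage f alpha r' m' (fun x => K x /\ Cmod (iter m' f x - alpha) <= r')) ->
  stage f alpha r' m K -> exists x, K x /\ ~ escaping_set f x.
Proof.
  intros Step S0.
  (* Bundling a stage with its proof lets the successor chosen for each stage be iterated. *)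
  set (St := {p : nat * (C -> Prop) | stage f alpha r' (fst p) (snd p)}).
  assert (Ch : forall s : St, exists s' : St, (fst (proj1_sig s) < fst (proj1_sig s'))%nat /\
    forall x, snd (proj1_sig s') x -> snd (proj1_sig s) x /\ Cmod (iter (fst (proj1_sig s')) f x - alpha) <= r').
  { intros [[m1 K1] H1]. destruct (Step m1 K1 H1) as [m2 [L2 H2]].
    exists (exist (fun p => stage f alpha r' (fst p) (snd p)) (m2, _) H2). simpl. auto. }
  apply choice in Ch. destruct Ch as [nx Hnx].
  set (s := fix s n := match n with O => exist (fun p => stage f alpha r' (fst p) (snd p)) (m, K) S0 : St | S n' => nx (s n') end).
  set (mm := fun n => fst (proj1_sig (s n))). set (KK := fun n => snd (proj1_sig (s n))).
  assert (HS : forall n, stage f alpha r' (mm n) (KK n)) by (intros n; apply (proj2_sig (s n))).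
  assert (Hm : forall n, (n <= mm n)%nat).
  { induction n. lia. pose proof (proj1 (Hnx (s n))). unfold mm in *. simpl. lia. }
  assert (HK : forall n x, KK (S n) x -> KK n x /\ Cmod (iter (mm (S n)) f x - alpha) <= r').
  { intros n x. apply (proj2 (Hnx (s n))). }
  assert (HKm : forall n k x, (n <= k)%nat -> KK k x -> KK n x).
  { intros n k x L. induction L; auto. intros Q. apply IHL. apply HK; auto. }
  assert (Ch : forall n, exists x, KK n x) by (intros n; apply (stage_nonempty f alpha r' (mm n)); auto).
  apply choice in Ch. destruct Ch as [u Hu].
  destruct (ccompact_cluster K u) as [x [Kx Cx]]. apply S0. intros n. apply (HKm 0%nat n); auto; lia.
  assert (Hx : forall n, KK n x).
  { intros n. destruct (HS n) as [[_ Cl] _]. apply Cl. intros e He. destruct (Cx e n He) as [k [Hk Hk']].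
    exists (u k). split; auto. apply (HKm n k); auto. }
  exists x. split; auto. intros Esc.
  destruct (escaping_spec f x Esc (Cmod alpha + r')) as [M HM].
  specialize (HM (mm (S M)) ltac:(pose proof (Hm (S M)); lia)).
  destruct (HK M x (Hx (S M))) as [_ L]. pose proof (Cmod_sub_ge (iter (mm (S M)) f x) alpha). lra.
Qed.

Theorem theorem1p4 (f : C -> C) :
  classB f ->
  (exists alpha : C, finite_log_asymptotic_value f alpha) ->
  ~ spiders_web (escaping_set f).
Proof.
  intros [[Ent _] [M0 Sing]] [alpha [r [U [Hr [Hcomp [[Hmap [Hsur _]] _]]]]]] [_ [G [HG [Gbd [Gm Gc]]]]].
  assert (H := entire_holo f Ent).
  assert (Hc : forall z, ccont f z) by (intros; apply holo_ccont, H).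
  assert (T : punctured_tract f alpha r U).
  { split; auto. split; auto. split.
    - intros u Uu. apply (Hmap u Uu).
    - intros w Lw Nw. apply Hsur. auto. }
  assert (N : nonconstant f).
  { destruct T as [_ [_ [Na Sur]]].
    assert (Q : forall t, 0 < t < r -> exists u, f u = (alpha + RtoC t)%C).
    { intros t Ht. destruct (Sur (alpha + RtoC t)%C) as [u [_ Eu]]; eauto.
      - replace (alpha + RtoC t - alpha)%C with (RtoC t) by ring. rewrite Cmod_R, Rabs_pos_eq; lra.
      - intros E. assert (E2 : (alpha + RtoC t - alpha)%C = 0) by (rewrite E; ring).
        replace (alpha + RtoC t - alpha)%C with (RtoC t) in E2 by ring. apply (f_equal fst) in E2. simpl in E2. lra. }
    destruct (Q (r / 2) ltac:(lra)) as [u1 E1]. destruct (Q (r / 3) ltac:(lra)) as [u2 E2].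
    exists u1, u2. rewrite E1, E2. intros E.
    apply (f_equal fst) in E. simpl in E. lra. }
  destruct Hcomp as [[u0 U0] _].
  destruct (ccompact_bound _ f (ccompact_disc 0 (Cmod u0))) as [M1 HM1]; auto.
  (* Exceeds the singular values, the values of [f] on [|z| <= |u0|], and the modulus on
     [B(alpha, r)]. *)
  set (R0 := Rabs M0 + Rabs M1 + (Cmod alpha + r) + 1).
  assert (Pa := Cmod_ge_0 alpha). assert (A0 := Rle_abs M0). assert (A1 := Rle_abs M1).
  assert (B0 := Rabs_pos M0). assert (B1 := Rabs_pos M1).
  assert (HR0 : R0 = Rabs M0 + Rabs M1 + (Cmod alpha + r) + 1) by reflexivity. clearbody R0.
  assert (Bu : forall z, Cmod z <= Cmod u0 -> Cmod (f z) <= R0).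
  { intros z Hz. specialize (HM1 z). replace (z - 0)%C with z in HM1 by ring. specialize (HM1 Hz). lra. }
  assert (Reg : regular_outside f R0).
  { split; auto. split; auto. split. lra. split. apply Bu. rewrite Cmod_0. apply Cmod_ge_0. split.
    - intros z l Lz Hl E. subst l. assert (Cmod (f z) <= M0); [|lra].
      apply Sing, closure_self. left. exists z. split; auto. apply cdiff_is_derive; auto.
    - intros w Lw As. assert (Cmod w <= M0); [|lra]. apply Sing, closure_self. auto. }
  assert (Net : log_net f R0) by (apply (tract_log_net f alpha r U u0); auto; lra).
  assert (Go : forall n, open (G n)) by (intros n; apply HG).
  assert (GB : forall n, bounded_set (G n)) by (intros n; apply HG).
  (* Cutting with a large web domain gives the first stage, at time 1. The radius is left free
     because arbitrarily small ones yield escaping points near [alpha]. *)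
  assert (Start : forall r', 0 < r' < r -> exists n, stage f alpha r' 1 (boundary (G n))).
  { intros r' Hr'. destruct (tract_covers_circle f alpha r U r' H N T Hr') as [R2 HR2].
    destruct (exhaustion_contains_disc G R2) as [n Hn]; auto. exists n.
    destruct (cut_spec f alpha r U r' (G n)) as [Co [Ca Cb]]; auto.
    { intros w Hw. destruct (HR2 w Hw) as [u [Uu [Lu Eu]]]. exists u. auto. }
    split.
    - split.
      + destruct (closure_bounded (G n) (GB n)) as [M HM]. exists M. intros z [Cz _]. auto.
      + intros z Hz. split.
        * apply closure_closed. intros e He. destruct (Hz e He) as [y [[Cy _] Ly]]. eauto.
        * intros Gz. assert (O := Go n). rewrite open_Cmod in O. destruct (O z Gz) as [e [He He']].
          destruct (Hz e He) as [y [[_ Ny] Ly]]. apply Ny, He', Ly.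
    - exists (cut f alpha r' U (G n)). split; auto. split; auto. split.
      + intros w [Lw _]; auto.
      + intros w Bw. destruct (Cb w Bw) as [_ [u [_ [Bu' Eu]]]]. exists u. auto. }
  (* Boundary points of the first neighbourhood are images of points of the loop, and images of
     escaping points escape. *)
  assert (Dense : forall e, 0 < e -> exists z, escaping_set f z /\ Cmod (z - alpha) < e).
  { intros e He. set (r' := Rmin (e / 2) (r / 2)).
    assert (P : 0 < r') by (apply Rmin_glb_lt; lra).
    assert (P1 : r' <= e / 2) by apply Rmin_l. assert (P2 : r' <= r / 2) by apply Rmin_r.
    destruct (Start r') as [n [_ [W [Wo [Wa [Wr Wb]]]]]]. lra.
    destruct (boundary_nonempty W alpha) as [w Bw]; auto.
    { exists (r' + Cmod alpha). intros w Ww. specialize (Wr w Ww). pose proof (Cmod_sub_ge w alpha). lra. }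
    destruct (Wb w Bw) as [x [Kx Ex]]. exists w. split.
    - rewrite <- Ex. simpl. apply escaping_image. apply (Gbd n); auto.
    - assert (Cmod (w - alpha) <= r'); [|lra]. apply ccompact_disc. intros k Hk.
      destruct (proj1 Bw k Hk) as [y [Wy Ly]]. exists y. split; auto. left; auto. }
  set (r' := r / 2). assert (Hr' : 0 < r' < r) by (unfold r'; lra).
  destruct (tract_covers_circle f alpha r U r' H N T Hr') as [R2 HR2].
  destruct (Start r' Hr') as [n S0].
  destruct (stage_nonescaping f alpha r' 1 (boundary (G n))) as [x [Kx Nx]]; auto.
  { intros m K S. apply (stage_step f alpha r U r' R0 R2); auto. }
  apply Nx, (Gbd n), Kx.
Qed.
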